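(* Let $k$ be a field, let $D$ be a $k$-algebra, let $\sigma$ be a $k$-algebra automorphism of $D$, let $a$ be a central element of $D$, and let $A=D(\sigma,a)$ be the generalized Weyl algebra. Consider the statements: (a) $\operatorname{GKdim}(A)=\operatorname{GKdim}(D)+1$; (b) $\sigma$ is locally algebraic; (c) $\sigma$ has finite order, i.e. $\sigma^m=\mathrm{id}_D$ for some integer $m\geq 1$; (d) $A$ is not simple. (1) If $P_n\subseteq D\subseteq Q_n$, where $P_n=k[z_1,\dots,z_n]$ is the polynomial algebra in $n$ indeterminates and $Q_n$ is its field of fractions, then (a) and (b) are equivalent. (2) If $k$ is algebraically closed, $D$ is a field which is finitely generated as a field over $k$, and $a\neq 0$, then (a), (b), (c) and (d) are all equivalent.
   Context: All algebras are associative unital $k$-algebras and automorphisms are $k$-algebra automorphisms. For an algebra $D$, an automorphism $\sigma$ of $D$ and a central element $a\in D$, the generalized Weyl algebra $D(\sigma,a)$ is the algebra generated by $D$ and two indeterminates $x,y$ subject to $xd=\sigma(d)x$, $yd=\sigma^{-1}(d)y$ for all $d\in D$, $yx=a$, $xy=\sigma(a)$. The Gelfand–Kirillov dimension of an algebra $B$ is $\operatorname{GKdim}(B)=\sup_V\limsup_{n\to\infty}\log_n\dim_k\big(\sum_{i=0}^n V^i\big)$, the supremum over all finite-dimensional subspaces $V$ of $B$ (with $V^0=k$). An automorphism $\sigma$ of $D$ is locally algebraic if every finite-dimensional subspace of $D$ is contained in a finite-dimensional subspace $U$ of $D$ with $\sigma(U)=U$. *)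

(* Defs.v *)
From HB Require Import structures.
From mathcomp Require Import all_boot all_order all_algebra.
From mathcomp Require Import fraction.
From mathcomp Require mpoly.

(* P_n = k[z_1,...,z_n] (multinomials' {mpoly k[n]}) and its field of fractions Q_n.
   mpoly is imported only inside this module, because its notations clash with
   those of MathComp-Analysis. *)
Module MP.
Import mpoly.
Definition Pn (k : fieldType) (n : nat) : idomainType := {mpoly k[n]}.
Definition Qn (k : fieldType) (n : nat) : fieldType := {fraction {mpoly k[n]}}.
Definition PtoQ (k : fieldType) (n : nat) (p : {mpoly k[n]}) : Qn k n := tofrac p.
Definition cst (k : fieldType) (n : nat) (c : k) : Qn k n := tofrac (c%:MP).
End MP.

From mathcomp Require Import all_classical all_reals all_analysis.
From mathcomp Require Import Rstruct.

Set Implicit Arguments.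
Unset Strict Implicit.
Unset Printing Implicit Defensive.

Import Order.TTheory GRing.Theory Num.Theory.
Local Open Scope ring_scope.

Section Defs.
Variable k : fieldType.

Definition lin_free (V : lmodType k) (t : seq V) : Prop :=
  forall c : 'I_(size t) -> k,
    \sum_(i < size t) c i *: t`_i = 0 -> forall i, c i = 0.

Definition in_span (V : lmodType k) (s : seq V) (v : V) : Prop :=
  exists c : 'I_(size s) -> k, v = \sum_(i < size s) c i *: s`_i.

Definition span_dim (V : lmodType k) (s : seq V) : nat :=
  \max_(m : (size s).-tuple bool | `[< lin_free (mask m s) >]) size (mask m s).

Fixpoint words (A : algType k) (vs : seq A) (n : nat) : seq A :=
  if n is n'.+1 then [seq v * w | v <- vs, w <- words vs n'] else [:: 1].

(* a spanning family of  V^0 + V^1 + ... + V^n, where V = span vs *)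
Definition words_upto (A : algType k) (vs : seq A) (n : nat) : seq A :=
  flatten [seq words vs i | i <- iota 0 n.+1].

Definition GK_growth (A : algType k) (vs : seq A) (n : nat) : \bar Rdefinitions.R :=
  ((ln (span_dim (words_upto vs n))%:R) / (ln n%:R))%:E.

(* GKdim A = sup_V limsup_n log_n dim (sum_{i<=n} V^i); every finite-dimensional
   subspace V of A is the span of a finite family vs, and conversely. *)
Definition GKdim (A : algType k) : \bar Rdefinitions.R :=
  ereal_sup (range (fun vs : seq A => limn_esup (GK_growth vs))).

Definition is_alg_automorphism (D : algType k) (sigma : {lrmorphism D -> D}) : Prop :=
  bijective sigma.

Definition central (D : algType k) (a : D) : Prop := forall d : D, a * d = d * a.

(* every finite-dimensional subspace (= span of a finite family vs) is contained in a
   finite-dimensional subspace U = span us with sigma(U) = U *)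
Definition locally_algebraic (D : algType k) (sigma : D -> D) : Prop :=
  forall vs : seq D, exists us : seq D,
    (forall v, v \in vs -> in_span us v) /\
    (forall u, in_span us u -> in_span us (sigma u)) /\
    (forall u, in_span us u -> exists u', in_span us u' /\ sigma u' = u).

Definition finite_order (D : Type) (sigma : D -> D) : Prop :=
  exists m : nat, (1 <= m)%N /\ forall d, iter m sigma d = d.

Definition two_sided_ideal (A : algType k) (I : A -> Prop) : Prop :=
  [/\ I 0, (forall u v, I u -> I v -> I (u + v)) &
      (forall r u, I u -> I (r * u) /\ I (u * r))].

Definition simple_algebra (A : algType k) : Prop :=
  (1 : A) != 0 /\
  forall I : A -> Prop, two_sided_ideal I -> (forall u, I u -> u = 0) \/ (forall u, I u).

(* ---------- the generalized Weyl algebra D(sigma,a), by generators and relations: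
   (A, iota, x, y) is D(sigma,a) iff iota : D -> A is a k-algebra map and x, y satisfy
   the defining relations, and (A, iota, x, y) is universal with these properties. *)

Definition GWA_relations (D A : algType k) (sigma : D -> D) (a : D)
    (iota : D -> A) (x y : A) : Prop :=
  [/\ forall d, x * iota d = iota (sigma d) * x,
      (* y d = sigma^{-1}(d) y, written with d := sigma e (sigma is bijective) *)
      forall e, y * iota (sigma e) = iota e * y,
      y * x = iota a &
      x * y = iota (sigma a)].

Definition is_GWA (D : algType k) (sigma : D -> D) (a : D)
    (A : algType k) (iota : {lrmorphism D -> A}) (x y : A) : Prop :=
  GWA_relations sigma a iota x y /\
  forall (C : algType k) (f : {lrmorphism D -> C}) (X Y : C),
    GWA_relations sigma a f X Y ->
    exists g : {lrmorphism A -> C},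
      [/\ forall d, g (iota d) = f d, g x = X, g y = Y &
          forall g' : {lrmorphism A -> C},
            (forall d, g' (iota d) = f d) -> g' x = X -> g' y = Y ->
            forall u, g' u = g u].

Definition is_field (D : algType k) : Prop :=
  (forall d e : D, d * e = e * d) /\
  (forall d : D, d != 0 -> exists e, d * e = 1).

Definition subfield_k (D : algType k) (S : D -> Prop) : Prop :=
  [/\ forall c : k, S (c%:A),
      (forall u v, S u -> S v -> S (u + v)),
      (forall u v, S u -> S v -> S (u * v)) &
      (forall u e, S u -> u * e = 1 -> S e)].

Definition fg_field_over_k (D : algType k) : Prop :=
  exists gs : seq D, forall S : D -> Prop,
    subfield_k S -> (forall g, g \in gs -> S g) -> forall d, S d.

End Defs.

Definition between_poly_and_fractions (k : fieldType) (n : nat) (D : algType k) : Prop :=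
  exists iota : {rmorphism D -> MP.Qn k n},
    [/\ injective iota,
        (forall (c : k) (d : D), iota (c *: d) = @MP.cst k n c * iota d) &
        forall p : MP.Pn k n, exists d : D, iota d = @MP.PtoQ k n p].

(* Main.v *)
Require Import Defs.
From HB Require Import structures.
From mathcomp Require Import all_boot all_order all_algebra fraction.
From mathcomp Require Import boolp classical_sets functions.
From mathcomp Require mpoly.
From mathcomp Require Import zify ring.

Set Implicit Arguments.
Unset Strict Implicit.
Unset Printing Implicit Defensive.

Import Order.TTheory GRing.Theory Num.Theory.
Local Open Scope ring_scope.

(* Both kinds of D embed in a field F of transcendence degree d = GKdim D over k, with
   d algebraically independent elements z_1, ..., z_d in D.  The monomial order on
   k[z_1, ..., z_d] extends, by Chevalley's theorem, to a valuation v of F with residue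
   field k for which the monomials have distinct values, so that the dimension of a
   finite-dimensional subspace is the number of values taken on it.

   If sigma is locally algebraic, a sigma-stable U of finite dimension gives words of
   length n inside the span of U^(cn) x^i and U^(cn) y^i with i <= cn, so
   GKdim A <= d + 1.  The monomials z^b x^i show GKdim A >= d + 1 in all cases.

   If sigma is not locally algebraic, U_n = V + sigma(V) + ... + sigma^(n-1)(V) has
   dimension at least n for some V.  Take n = h (2h+1)^d elements of U_n with distinct
   values.  Either they meet h classes modulo the group Z^d of values of monomials, or
   some class contains u, w with v(u) = v(w) + v(z^alpha) and |alpha_t| > h.  Then the
   u_i z^b, respectively the u^q w^(n-q) z^b, take at least h n^d values, and multiplying
   by the x^l with n <= l < 2n yields GKdim A >= d + 1 + 1/(d+1).

   For D a field and k algebraically closed, fractions 1/(e - c) with distinct c in k are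
   independent; applied to eigenvectors and to Jordan blocks this shows that a locally
   algebraic sigma has finite order.  Here A = D[x, x^-1; sigma]: it is simple if sigma
   has infinite order, and x^m - 1 generates a proper ideal if sigma^m = 1. *)

(** * Linear algebra of finite families *)

(** The obstacle in the lower bound is the price of a translate: sigma^i(v) costs i letters x, so n
    translates formed separately would cost about n^2 letters. They can share one power of x: a
    product of n elements of U_n times x^n is a combination of words of length 2n. This makes n-fold
    products of U_n affordable, but only in front of powers x^l with l >= n.

    Independence of such products is hard to see directly, but values are additive. If there were
    fewer than h classes modulo Z^d and all differences lay in [-h, h]^d, fewer than h (2h+1)^d
    values would occur; this dictates n. Otherwise a coordinate with |alpha_t| > h leaves room for a
    remainder s < h, so that q alpha_t + s determines q and s, and the n choices in that coordinate
    become h n.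

    A is known only by its universal property. Independence in A is therefore read off
    representations, and generation by D, x, y off the uniqueness clause. *)

Section LinearAlgebra.
Variables (k : fieldType) (V : lmodType k).
Implicit Types (s t : seq V) (u v w : V) (S : V -> Prop).

Definition subspace S := S 0 /\ forall (c : k) u v, S u -> S v -> S (c *: u + v).

Lemma subspaceD S u v : subspace S -> S u -> S v -> S (u + v).
Proof. by case=> _ SL Su Sv; rewrite -[u]scale1r; apply: SL. Qed.

Lemma subspaceZ S (c : k) u : subspace S -> S u -> S (c *: u).
Proof. by case=> S0 SL Su; rewrite -[_ *: _]addr0; apply: SL. Qed.

Lemma subspaceB S u v : subspace S -> S u -> S v -> S (u - v).
Proof.
by move=> sS Su Sv; apply: (subspaceD sS Su); rewrite -scaleN1r; apply: subspaceZ.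
Qed.

Lemma subspace_sum S (T : Type) (r : seq T) (P : pred T) (f : T -> V) :
  subspace S -> (forall i, P i -> S (f i)) -> S (\sum_(i <- r | P i) f i).
Proof.
move=> sS Sf; apply: (big_ind S) => //; first by case: sS.
by move=> u v; apply: subspaceD.
Qed.

(** Coefficients indexed by ordinals become functions on [nat], so that shifting an index needs no
    cast. *)
Lemma ext_ord (n : nat) (c : 'I_n -> k) : exists c' : nat -> k, forall i : 'I_n, c' i = c i.
Proof.
exists (fun i => if insub i is Some j then c j else 0) => i.
by rewrite valK.
Qed.

Lemma in_spanP s v :
  in_span s v <-> exists c : nat -> k, v = \sum_(i < size s) c i *: s`_i.
Proof.
split=> [[c ->]|[c ->]]; last by exists (fun i => c i).
have [c' c'E] := ext_ord c.
by exists c'; apply: eq_bigr => i _; rewrite c'E.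
Qed.

Lemma lin_freeP t : lin_free t <-> forall c : nat -> k,
  \sum_(i < size t) c i *: t`_i = 0 -> forall i, (i < size t)%N -> c i = 0.
Proof.
split=> [fr c c0 i ilt|fr c c0 i]; first exact: (fr (fun i => c i) c0 (Ordinal ilt)).
have [c' c'E] := ext_ord c; rewrite -c'E; apply: fr => //.
by rewrite -[RHS]c0; apply: eq_bigr => j _; rewrite c'E.
Qed.

Lemma in_span_subspace s : subspace (in_span s).
Proof.
split; first by exists (fun=> 0); rewrite big1 // => i _; rewrite scale0r.
move=> c u v [a ->] [b ->]; exists (fun i => c * a i + b i).
rewrite scaler_sumr -big_split; apply: eq_bigr => i _.
by rewrite scalerDl scalerA.
Qed.

Lemma in_span_mem s v : v \in s -> in_span s v.
Proof.
move=> vs; apply/in_spanP; exists (fun i => (i == index v s)%:R).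
have ilt : (index v s < size s)%N by rewrite index_mem.
rewrite (bigD1 (Ordinal ilt)) //= eqxx scale1r nth_index // big1 ?addr0 // => i ne.
by move: ne; rewrite -val_eqE /= => /negbTE ->; rewrite scale0r.
Qed.

Lemma in_span_min s S v : subspace S -> {in s, forall w, S w} -> in_span s v -> S v.
Proof.
move=> sS sub [c ->]; apply: subspace_sum => // i _.
by apply: subspaceZ => //; apply: sub; rewrite mem_nth.
Qed.

Lemma in_span_trans s t v : {in s, forall w, in_span t w} -> in_span s v -> in_span t v.
Proof. by apply: in_span_min; apply: in_span_subspace. Qed.

Lemma in_span_sub s t v : {subset s <= t} -> in_span s v -> in_span t v.
Proof. by move=> st; apply: in_span_trans => w /st; apply: in_span_mem. Qed.

Lemma lin_free_cons u s : lin_free (u :: s) <-> ~ in_span s u /\ lin_free s.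
Proof.
split=> [/lin_freeP fr|[nu /lin_freeP fr]].
  split=> [/in_spanP [c uE]|].
    have := fr (fun i => if i is i'.+1 then c i' else -1).
    rewrite /= big_ord_recl /= {1}uE scaleN1r addNr => /(_ erefl 0%N isT) /eqP.
    by rewrite oppr_eq0 oner_eq0.
  apply/lin_freeP => c c0 i ilt.
  have := fr (fun i => if i is i'.+1 then c i' else 0).
  by rewrite /= big_ord_recl /= scale0r add0r => /(_ c0 i.+1 ilt).
apply/lin_freeP => c; rewrite /= big_ord_recl /= => c0.
have c00 : c 0%N = 0.
  apply/eqP; apply: contra_notT nu => cn0; apply/in_spanP.
  exists (fun i => - (c 0%N)^-1 * c i.+1).
  transitivity (- (c 0%N)^-1 *: \sum_(i < size s) c i.+1 *: s`_i).
    move/eqP: c0; rewrite addrC addr_eq0 => /eqP ->.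
    by rewrite scaleNr scalerN opprK scalerA mulVf ?scale1r.
  by rewrite scaler_sumr; apply: eq_bigr => i _; rewrite scalerA.
move: c0; rewrite c00 scale0r add0r => c0 [|i] // ilt.
exact: (fr (fun i => c i.+1) c0).
Qed.

Lemma lin_free_nil : lin_free ([::] : seq V).
Proof. by move=> c _ []. Qed.

Lemma lin_free_swap u v s : lin_free (u :: v :: s) -> lin_free (v :: u :: s).
Proof.
move/lin_freeP => fr; apply/lin_freeP => c; rewrite /= !big_ord_recl /= => c0 i ilt.
pose c' i := if i is i'.+1 then if i' is i''.+1 then c i else c 0%N else c 1%N.
have := fr c'; rewrite /= !big_ord_recl /= addrCA => /(_ c0) c'0.
by case: i ilt => [|[|i]] ilt; [apply: (c'0 1%N)|apply: (c'0 0%N)|apply: (c'0 i.+2)].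
Qed.

Lemma lin_free_rem u s : u \in s -> lin_free s -> lin_free (u :: rem u s).
Proof.
elim: s => // v s IH; rewrite inE /=; case: (eqVneq v u) => [<-//|ne].
move=> us /lin_free_cons [nv fs].
apply/lin_free_swap/lin_free_cons; split; last by apply: IH.
move=> sv; apply: nv; apply: in_span_sub sv => w; rewrite inE => /predU1P [->//|].
exact: mem_rem.
Qed.

(** Expressing [t] through a shorter [s] gives a matrix with more rows than columns; a nonzero row
    in its left kernel is a relation on [t]. *)
Lemma steinitz s t : lin_free t -> {in t, forall v, in_span s v} -> (size t <= size s)%N.
Proof.
move=> /lin_freeP fr sub; rewrite leqNgt; apply/negP => lt_st.
have /choice [f fP] : forall i : 'I_(size t), exists c : nat -> k,
    t`_i = \sum_(l < size s) c l *: s`_l.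
  by move=> i; apply/in_spanP; apply: sub; rewrite mem_nth.
pose M := \matrix_(i < size t, l < size s) f i l.
have : kermx M != 0.
  by rewrite kermx_eq0 /row_free neq_ltn (leq_ltn_trans (rank_leq_col _)).
case/rowV0Pn => r /sub_kermxP rM r0.
have [c cE] := ext_ord (fun i => r 0 i).
case/negP: r0; apply/eqP/rowP => i; rewrite mxE -cE; apply: fr => //.
transitivity (\sum_(l < size s) (r *m M) 0 l *: s`_l); last first.
  by apply: big1 => l _; rewrite rM mxE scale0r.
under eq_bigr do rewrite fP scaler_sumr.
rewrite exchange_big; apply: eq_bigr => l _ /=.
rewrite mxE scaler_suml; apply: eq_bigr => j _.
by rewrite scalerA cE mxE.
Qed.

(** [span_dim] is a maximum over sublists. A greedily extracted basis is one of them, and [steinitz]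
    bounds all the others by it. *)
Lemma span_dim_basis s : exists b : seq V,
  [/\ lin_free b, size b = span_dim s, {subset b <= s} & {in s, forall v, in_span b v}].
Proof.
have [b [fb /subseqP [m sm bE] sb]] : exists b : seq V,
    [/\ lin_free b, subseq b s & {in s, forall v, in_span b v}].
  elim: s => [|u s [b [fb sub sb]]]; first by exists [::]; split=> //; apply: lin_free_nil.
  have [bu|nbu] := pselect (in_span b u).
    exists b; split=> //; first exact: subseq_trans (subseq_cons _ _).
    by move=> v; rewrite inE => /predU1P [->|/sb].
  exists (u :: b); split=> //; first exact/lin_free_cons; first by rewrite /= eqxx.
  move=> v; rewrite inE => /predU1P [->|/sb].
    by apply: in_span_mem; rewrite mem_head.
  by apply: in_span_sub => w bw; rewrite inE bw orbT.
exists b; split=> //; last by move=> v; rewrite bE; apply: mem_mask.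
apply/eqP; rewrite eqn_leq; apply/andP; split.
  move/eqP: sm => sm; rewrite bE.
  apply: (leq_bigmax_cond (F := fun m : (size s).-tuple bool => size (mask m s)) (Tuple sm)).
  by rewrite /= -bE; apply/asboolP.
apply/bigmax_leqP => m' /asboolP fm'; apply: steinitz => // v /mem_mask; exact: sb.
Qed.

Lemma span_dim_ge s t :
  lin_free t -> {in t, forall v, in_span s v} -> (size t <= span_dim s)%N.
Proof.
have [b [_ <- _ sb]] := span_dim_basis s.
by move=> ft ts; apply: steinitz => // v /ts; apply: in_span_trans.
Qed.

Lemma span_dim_le s t : {in s, forall v, in_span t v} -> (span_dim s <= size t)%N.
Proof.
have [b [fb <- bs _]] := span_dim_basis s.
by move=> st; apply: steinitz => // v /bs; apply: st.
Qed.

End LinearAlgebra.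

(** * Valuation rings *)

Section Valuation.
Variable F : fieldType.
Implicit Types (R I O : F -> Prop) (u v w : F) (p q : {poly F}).

Definition subring R :=
  [/\ R 1, forall u v, R u -> R v -> R (u - v) & forall u v, R u -> R v -> R (u * v)].

Lemma subring0 R : subring R -> R 0.
Proof. by case=> R1 RB _; rewrite -(subrr 1); apply: RB. Qed.

Lemma subringD R u v : subring R -> R u -> R v -> R (u + v).
Proof.
move=> sR; have R0 := subring0 sR; case: sR => _ RB _ Ru Rv.
have RNv : R (- v) by rewrite -sub0r; apply: RB.
by rewrite -[v]opprK; apply: RB.
Qed.

Lemma subringX R u n : subring R -> R u -> R (u ^+ n).
Proof.
move=> [R1 _ RM] Ru; elim: n => [|n IH]; first by rewrite expr0.
by rewrite exprS; apply: RM.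
Qed.

Definition proper_ideal R I :=
  [/\ subring R, forall u, I u -> R u, (forall u v, I u -> I v -> I (u + v)) /\ I 0,
      forall u v, R u -> I v -> I (u * v) & ~ I 1].

Definition valuation_ring O := subring O /\ forall u, O u \/ O u^-1.

Lemma sum_closed I (T : Type) (r : seq T) (P : pred T) (f : T -> F) :
  I 0 -> (forall u v, I u -> I v -> I (u + v)) -> (forall i, P i -> I (f i)) ->
  I (\sum_(i <- r | P i) f i).
Proof. by move=> I0 ID If; apply: (big_ind I). Qed.

(** For a ring [R] this is R[u]; for an ideal of [R] it is the ideal generated in R[u]. *)
Definition adjoin I u w := exists2 p : {poly F}, (forall i, I p`_i) & w = p.[u].

Lemma adjoin_sub I u w : I 0 -> I w -> adjoin I u w.
Proof.
move=> I0 Iw; exists w%:P; last by rewrite hornerC.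
by move=> i; rewrite coefC; case: ifP.
Qed.

Lemma adjoin_proper R I u :
  proper_ideal R I -> ~ adjoin I u 1 -> proper_ideal (adjoin R u) (adjoin I u).
Proof.
move=> [sR IR [ID I0] IM _] n1; have R0 := subring0 sR; have RD := @subringD R _ _ sR.
case: sR => R1 RB RM; split=> //.
- split; first exact: adjoin_sub.
  + move=> _ _ [p Rp ->] [q Rq ->]; exists (p - q); last by rewrite !hornerE.
    by move=> i; rewrite coefB; apply: RB.
  + move=> _ _ [p Rp ->] [q Rq ->]; exists (p * q); last by rewrite !hornerE.
    by move=> i; rewrite coefM; apply: sum_closed => // j _; apply: RM.
- by move=> _ [p Ip ->]; exists p => // i; apply: IR.
- split; last exact: adjoin_sub.
  move=> _ _ [p Rp ->] [q Rq ->]; exists (p + q); last by rewrite !hornerE.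
  by move=> i; rewrite coefD; apply: ID.
- move=> _ _ [p Rp ->] [q Rq ->]; exists (p * q); last by rewrite !hornerE.
  by move=> i; rewrite coefM; apply: sum_closed => // j _; apply: IM.
Qed.

(* If 1 lies both in I[u] and in I[1/u], the two relations can be played against each
   other to shorten the longer one. *)
Lemma adjoin_inv_contra R I u : proper_ideal R I -> u != 0 ->
  adjoin I u 1 -> adjoin I u^-1 1 -> False.
Proof.
move=> [sR IR [ID I0] IM n1] u0 [p Ip p1] [q Iq q1].
have [N ltN] := ubnP (size p + size q).
elim: N u u0 p q ltN Ip Iq p1 q1 => // N IH u u0 p q ltN Ip Iq p1 q1.
(* The situation is symmetric under exchanging u with 1/u and p with q. *)
wlog lepq : u u0 p q ltN Ip Iq p1 q1 / (size q <= size p)%N.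
  move=> W; have [le|/ltnW le] := leqP (size q) (size p); first exact: (W u u0 p q).
  by apply: (W u^-1 _ q p) => //; rewrite ?invr_neq0 ?invrK // addnC.
case sq: (size q) => [|m].
  move/eqP: sq; rewrite size_poly_eq0 => /eqP qE.
  by move/eqP: q1; rewrite qE horner0 oner_eq0.
case sp: (size p) => [|n]; first by rewrite sq sp in lepq.
set a := p`_n; set b := q`_0.
have Ia : I a by apply: Ip.
have Ib : I b by apply: Iq.
have R1b : R (1 - b) by case: sR => R1 RB _; apply: RB => //; apply: IR.
(* Multiplying 1 - b = sum_(j >= 1) q_j u^-j by a u^n rewrites the top term of (1 - b) p(u) in lower
   degrees, because m <= n. Adding b restores the value 1, so p' is a shorter relation. *)
pose r := \sum_(1 <= j < m.+1) (a * q`_j) *: 'X^(n - j).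
pose p' := (1 - b) *: (p - a *: 'X^n) + r + b%:P.
apply: (IH u u0 p' q).
- suff s : (size p' <= n)%N.
    by apply: leq_ltn_trans (leq_add s (leqnn _)) _; rewrite sp addSn ltnS in ltN.
  (* If n = 0, both relations are constant and 1 itself lies in I. *)
  case: (posnP n) => [n0|n_gt0].
    have m0 : m = 0%N by lia.
    move: q1; rewrite horner_coef sq m0 big_ord1 /= expr0 mulr1 => q1.
    by case: n1; rewrite q1.
  apply: leq_trans (size_polyD _ _) _; rewrite geq_max; apply/andP; split; last first.
    exact: leq_trans (size_polyC_leq1 _) _.
  apply: leq_trans (size_polyD _ _) _; rewrite geq_max; apply/andP; split.
    apply: leq_trans (size_scale_leq _ _) _; apply/leq_sizeP => j.
    rewrite leq_eqVlt => /predU1P [<-|ltj].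
      by rewrite coefB coefZ coefXn eqxx mulr1 subrr.
    by rewrite coefB coefZ coefXn gtn_eqF // mulr0 subr0 nth_default ?sp.
  apply/leq_sizeP => j lej; rewrite coef_sum big_nat big1 // => i /andP [i1 i2].
  by rewrite coefZ coefXn gtn_eqF ?mulr0 //; lia.
- move=> i; rewrite /p' coefD coefC; apply/ID; last by case: ifP.
  rewrite coefD; apply/ID; last first.
    rewrite coef_sum; apply: sum_closed => // j _; rewrite coefZ coefXn.
    by case: eqP; rewrite ?mulr0 ?mulr1 // => _; apply/IM => //; apply: IR.
  rewrite coefZ; apply: IM => //; rewrite coefB coefZ coefXn.
  by case: eqP => [->|_]; rewrite ?mulr1 ?subrr ?mulr0 ?subr0.
- by [].
- rewrite /p' !hornerE -p1.
  have -> : r.[u] = a * u ^+ n * \sum_(1 <= j < m.+1) q`_j * u^-1 ^+ j.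
    rewrite /r horner_sum mulr_sumr !big_nat; apply: eq_bigr => j /andP [j1 j2].
    rewrite hornerZ hornerXn expfB_cond; last by rewrite (negbTE u0); lia.
    by rewrite exprVn mulrACA.
  have -> : \sum_(1 <= j < m.+1) q`_j * u^-1 ^+ j = 1 - b.
    rewrite q1 horner_coef sq -(big_mkord xpredT (fun i => q`_i * u^-1 ^+ i)).
    by rewrite big_ltn // expr0 mulr1 addrAC subrr add0r.
  by ring.
- exact: q1.
Qed.

(** Zorn applied to pairs of a ring and a proper ideal. The ring of a maximal pair contains every u
    with 1 outside I[u], and by [adjoin_inv_contra] this applies to u or to its inverse. *)
Theorem chevalley R0 I0 : proper_ideal R0 I0 ->
  exists O, [/\ valuation_ring O, forall u, R0 u -> O u &
                forall u, u != 0 -> I0 u -> ~ O u^-1].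
Proof.
move=> pI0.
(* A pair is encoded as one set of tagged elements, [true] for the ring and [false] for the ideal.
   Joining [base] to every set makes the empty chain admissible. *)
pose base : set (bool * F) := fun x => if x.1 then R0 x.2 else I0 x.2.
pose good (S : set (bool * F)) :=
  proper_ideal (fun u => S (true, u)) (fun u => S (false, u)).
have [C CF totC|A [gA maxA]] := @Zorn_bigcup _ (fun S => good (S `|` base)%classic).
  have [[X0 CX0]|nC] := pselect (exists X, C X); last first.
    have -> : (\bigcup_(X in C) X = set0)%classic.
      by apply/seteqP; split=> // x [X CX _]; case: nC; exists X.
    by rewrite set0U.
  set U := (_ `|` _)%classic.
  have UE x : U x <-> exists2 X, C X & (X `|` base)%classic x.
    split=> [[[X CX Xx]|bx]|[X CX [Xx|bx]]]; last by right.
    - by exists X => //; left.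
    - by exists X0 => //; right.
    - by left; exists X.
  have U2 x y : U x -> U y ->
      exists2 X, C X & (X `|` base)%classic x /\ (X `|` base)%classic y.
    move=> /UE [X CX Xx] /UE [Y CY Yy]; have [XY|YX] := totC _ _ CX CY.
      by exists Y => //; split=> //; case: Xx => [/XY|]; [left|right].
    by exists X => //; split=> //; case: Yy => [/YX|]; [left|right].
  split.
  - split.
    + by apply/UE; exists X0 => //; case: (CF _ CX0) => [[]].
    + move=> u v uU vU; have [X CX [Xu Xv]] := U2 _ _ uU vU.
      by apply/UE; exists X => //; case: (CF _ CX) => [[_ RB _] *]; apply: RB.
    + move=> u v uU vU; have [X CX [Xu Xv]] := U2 _ _ uU vU.
      by apply/UE; exists X => //; case: (CF _ CX) => [[_ _ RM] *]; apply: RM.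
  - move=> u /UE [X CX Xu]; apply/UE; exists X => //.
    by case: (CF _ CX) => _ IR *; apply: IR.
  - split; last by apply/UE; exists X0 => //; case: (CF _ CX0) => [_ _ [_ ?]].
    move=> u v uU vU; have [X CX [Xu Xv]] := U2 _ _ uU vU.
    by apply/UE; exists X => //; case: (CF _ CX) => [_ _ [ID _] *]; apply: ID.
  - move=> u v uU vU; have [X CX [Xu Xv]] := U2 _ _ uU vU.
    by apply/UE; exists X => //; case: (CF _ CX) => [_ _ _ IM *]; apply: IM.
  - by move=> /UE [X CX X1]; case: (CF _ CX) => _ _ _ _; apply.
have max u : ~ adjoin (fun u => (A `|` base)%classic (false, u)) u 1 ->
    (A `|` base)%classic (true, u).
  move=> nu; have := adjoin_proper gA nu => gB.
  have R0' := subring0 (let: And5 s _ _ _ _ := gA in s).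
  have I0' : (A `|` base)%classic (false, 0) by case: gA => _ _ [].
  pose B : set (bool * F) := fun x =>
    adjoin (fun u => (A `|` base)%classic (x.1, u)) u x.2.
  have AB x : (A `|` base)%classic x -> B x.
    by case: x => -[] w ? ; apply: adjoin_sub.
  have BU : (B `|` base = B)%classic.
    by apply/seteqP; split=> [x [//|bx]|x]; [apply: AB; right|left].
  have Bu : B (true, u).
    exists 'X; last by rewrite hornerX.
    move=> i; rewrite coefX; case: eqP => // _ /=.
    by case: gA => [[]].
  have [nBA|/contrapT BA] := pselect (~ (B `<=` A)%classic); last by left; apply: BA.
  case: (maxA B); last by rewrite BU.
  by split=> // x Ax; apply: AB; left.
exists (fun u => (A `|` base)%classic (true, u)); split.
- split; first by case: gA.
  move=> u; have [->|u0] := eqVneq u 0; first by left; case: gA => /subring0.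
  have [/(adjoin_inv_contra gA u0) n|] :=
    pselect (adjoin (fun u => (A `|` base)%classic (false, u)) u 1); last by move/max; left.
  by right; apply: max.
- by move=> u Ru; right.
- move=> u u0 Iu Ru; case: gA => _ _ _ IM n1; case: n1.
  by rewrite -(mulVf u0); apply: IM => //; right.
Qed.

End Valuation.

(** * Values and linear independence *)

Section ValuationTheory.
Variables (F : fieldType) (O : F -> Prop).
Hypothesis vO : valuation_ring O.
Implicit Types u v w : F.

Let sO : subring O. Proof. by case: vO. Qed.

Lemma valM u v : O u -> O v -> O (u * v).
Proof. by case: sO => _ _; apply. Qed.

Lemma val1 : O 1. Proof. by case: sO. Qed.

(** The maximal ideal of [O]. Zero is listed apart because [0^-1 = 0] lies in [O]. *)
Definition small u := u = 0 \/ ~ O u^-1.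

Lemma smallM u v : O u -> small v -> small (u * v).
Proof.
move=> Ou [->|nv]; first by left; rewrite mulr0.
have [->|u0] := eqVneq u 0; first by left; rewrite mul0r.
right; rewrite invfM mulrC => Ouv; apply: nv.
by rewrite -[v^-1]mulr1 -(mulVf u0) mulrA; apply: valM.
Qed.

Lemma smallD u v : small u -> small v -> small (u + v).
Proof.
have [->|u0] := eqVneq u 0; first by rewrite add0r.
have [->|v0] := eqVneq v 0; first by rewrite addr0.
move=> su sv; have [_ /(_ (u / v))] := vO; rewrite invf_div => -[Ouv|Ovu].
  have -> : u + v = (u / v + 1) * v by rewrite mulrDl mul1r divfK.
  by apply: smallM => //; apply: subringD => //; apply: val1.
have -> : u + v = (v / u + 1) * u by rewrite mulrDl mul1r divfK // addrC.
by apply: smallM => //; apply: subringD => //; apply: val1.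
Qed.

Lemma smallN u : small u -> small (- u).
Proof.
rewrite -mulN1r; apply: smallM; rewrite -sub0r.
by case: sO => ? + _; apply; [apply: subring0|].
Qed.

Lemma small_sum (T : Type) (r : seq T) (P : pred T) (f : T -> F) :
  (forall i, P i -> small (f i)) -> small (\sum_(i <- r | P i) f i).
Proof. by move=> sf; apply: (big_ind small) => //; [left|apply: smallD]. Qed.

Lemma not_small u : O u -> ~ small u -> u != 0 /\ O u^-1.
Proof.
move=> Ou nu; split; first by apply/eqP => u0; apply: nu; left.
by apply: contrapT => nO; apply: nu; right.
Qed.

(** Equality of values: the quotient is a unit of [O]. The value group itself is never built. *)
Definition sim u v := O (u / v) /\ O (v / u).

Lemma sim_refl u : u != 0 -> sim u u.
Proof. by move=> u0; split; rewrite divff //; apply: val1. Qed.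

Lemma sim_sym u v : sim u v -> sim v u.
Proof. by case. Qed.

Lemma simM u v u' v' : sim u v -> sim u' v' -> sim (u * u') (v * v').
Proof.
by move=> [o1 o2] [o3 o4]; split; rewrite invfM mulrACA; apply: valM.
Qed.

Lemma sim_trans v u w : v != 0 -> sim u v -> sim v w -> sim u w.
Proof.
move=> v0 [o1 o2] [o3 o4]; split.
  have -> : u / w = (u / v) * (v / w) by rewrite mulrA divfK.
  exact: valM.
have -> : w / u = (w / v) * (v / u) by rewrite mulrA divfK.
exact: valM.
Qed.

Lemma simX u v n : sim u v -> sim (u ^+ n) (v ^+ n).
Proof.
move=> s; elim: n => [|n IH]; first by rewrite !expr0; apply/sim_refl/oner_neq0.
by rewrite !exprS; apply: simM.
Qed.

Lemma sim_cancel u v w : w != 0 -> sim (u * w) (v * w) -> sim u v.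
Proof.
move=> w0 []; rewrite !invfM mulrACA divff // mulr1 => ?.
by rewrite mulrACA divff // mulr1.
Qed.

Lemma sim_smallVO u v : v != 0 -> O (u / v) -> ~ sim u v -> small (u / v).
Proof.
move=> v0 Ouv ns; apply: contrapT => /(not_small Ouv) [_].
by rewrite invf_div => Ovu; apply: ns.
Qed.

Lemma max_val (T : eqType) (f : T -> F) (s : seq T) : s != [::] ->
  {in s, forall i, f i != 0} ->
  exists2 i, i \in s & {in s, forall l, O (f l / f i)}.
Proof.
elim: s => // i s IH _ nz; have [->|sn0] := eqVneq s [::].
  exists i; rewrite ?mem_head // => l; rewrite inE => /eqP ->.
  by rewrite divff; [apply: val1|apply: nz; rewrite mem_head].
have fi : f i != 0 by apply: nz; rewrite mem_head.
case: (IH sn0) => [l ls|l ls max]; first by apply: nz; rewrite inE ls orbT.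
have fl : f l != 0 by apply: nz; rewrite inE ls orbT.
have [_ /(_ (f i / f l))] := vO; rewrite invf_div => -[o|o].
  by exists l; [rewrite inE ls orbT|move=> m; rewrite inE => /predU1P [->|/max]].
exists i; rewrite ?mem_head // => m; rewrite inE => /predU1P [->|/max om].
  by rewrite divff //; apply: val1.
have -> : f m / f i = (f m / f l) * (f l / f i) by rewrite mulrA divfK.
exact: valM.
Qed.

Variables (k : fieldType) (kappa : {rmorphism k -> F}).
Hypothesis Ok : forall c, O (kappa c).

Lemma small_const c : small (kappa c) -> c = 0.
Proof.
case=> [/eqP|]; first by rewrite fmorph_eq0 => /eqP.
by rewrite -fmorphV.
Qed.

(** Divide a relation by its dominant term: the other terms become small, so the coefficient of the
    dominant one is a small constant, hence zero. *)
Lemma not_sim_indep (T : finType) (f : T -> F) (c : T -> k) :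
  (forall i, f i != 0) -> (forall i l, sim (f i) (f l) -> i = l) ->
  \sum_i kappa (c i) * f i = 0 -> forall i, c i = 0.
Proof.
move=> nz inj c0 i0; apply/eqP; apply: contraT => ci0.
have [|i|i is_ max] := @max_val _ f (enum [pred i | c i != 0]) _ _.
- by apply/eqP => e; have := mem_enum [pred i | c i != 0] i0; rewrite e !inE ci0.
- by [].
move: is_; rewrite mem_enum inE => ci; case/negP: ci; apply/eqP/small_const.
have -> : kappa (c i) = - \sum_(l | l != i) kappa (c l) * (f l / f i).
  move: c0; rewrite (bigD1 i) //= => /(congr1 (fun x => x / f i)).
  rewrite mul0r mulrDl mulfK // mulr_suml => /eqP; rewrite addr_eq0 => /eqP ->.
  by congr (- _); apply: eq_bigr => l _; rewrite mulrA.
apply/smallN/small_sum => l li.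
have [->|cl] := eqVneq (c l) 0; first by left; rewrite rmorph0 mul0r.
apply: smallM => //; apply: sim_smallVO => //.
  by apply: max; rewrite mem_enum.
by move=> /inj e; rewrite e eqxx in li.
Qed.

Hypothesis residue : forall u, O u -> exists c, small (u - kappa c).

Variables (D : lmodType k) (j : {additive D -> F}).
Hypothesis j_inj : injective j.
Hypothesis jZ : forall c d, j (c *: d) = kappa c * j d.

(** Gaussian elimination by values. Let [u] be dominant; as the residue field is [k], each other
    vector becomes strictly dominated by [u] after subtracting a constant multiple of [u]. *)
Lemma not_sim_family n (S : D -> Prop) (s : seq D) :
  subspace S -> lin_free s -> {in s, forall d, S d} -> size s = n ->
  exists f : 'I_n -> D, [/\ forall i, S (f i), forall i, j (f i) != 0 &
    forall i l, sim (j (f i)) (j (f l)) -> i = l].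
Proof.
have jn0 d : d != 0 -> j d != 0.
  by apply: contraNneq => jd; apply/eqP/j_inj; rewrite jd raddf0.
elim: n S s => [|n IH] S s sS fs sub sz.
  by exists (fun=> 0); split=> -[].
have nz0 : {in s, forall d, j d != 0}.
  move=> d ds; apply: jn0; apply/eqP => d0.
  have /lin_free_cons [] := lin_free_rem ds fs.
  by rewrite d0; case; case: (in_span_subspace (rem 0 s)).
have sn0 : s != [::] by case: (s) sz.
have [u us max] := max_val sn0 nz0.
have ju := nz0 _ us.
have Su := sub _ us.
have /choice [c cP] : forall d : D, exists c : k, O (j d / j u) ->
    small (j d / j u - kappa c).
  move=> d; have [/residue [c]|nO] := pselect (O (j d / j u)); first by exists c.
  by exists 0.
(* Recursion inside the vectors strictly dominated by [u] keeps all later values different from that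
   of [u]. *)
pose S' d := S d /\ small (j d / j u).
have sS' : subspace S'.
  split; first by split; [case: sS|left; rewrite raddf0 mul0r].
  move=> a d e [Sd sd] [Se se]; split; first by case: sS => _; apply.
  by rewrite raddfD jZ mulrDl -mulrA; apply: smallD => //; apply: smallM.
have szr : size (rem u s) = n by rewrite size_rem // sz.
have frs := lin_free_rem us fs.
case: (IH S' [seq d - c d *: u | d <- rem u s]) => //.
- move/lin_freeP: frs => frs; apply/lin_freeP => a; rewrite size_map => a0 i ilt.
  pose b i := if i is i'.+1 then a i'
              else - \sum_(i < size (rem u s)) a i * c (rem u s)`_i.
  have := frs b; rewrite /= big_ord_recl /= => fr; apply: (fr _ i.+1) => //.
  rewrite -[RHS]a0 scaleNr scaler_suml addrC -sumrB; apply: eq_bigr => l _.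
  by rewrite (nth_map 0) // scalerBr scalerA.
- move=> _ /mapP [d dr ->]; have ds := mem_rem dr; split.
    by apply: subspaceB => //; [apply: sub|apply: subspaceZ].
  rewrite raddfB jZ mulrBl mulfK //; apply: cP; exact: max.
- by rewrite size_map.
move=> f [Sf nzf injf].
exists (fun i => if unlift ord0 i is Some l then f l else u); split.
- by move=> i; case: unliftP => // l _; case: (Sf l).
- by move=> i; case: unliftP => // l _.
move=> i l; case: unliftP => [i'|] ->; case: unliftP => [l'|] -> //.
- by move=> /injf ->.
- have [_ [/eqP|nO [_ o]]] := Sf i'; last by rewrite invf_div in nO.
  by rewrite mulf_eq0 invr_eq0 (negbTE ju) (negbTE (nzf i')).
- have [_ [/eqP|nO [o _]]] := Sf l'; last by rewrite invf_div in nO.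
  by rewrite mulf_eq0 invr_eq0 (negbTE ju) (negbTE (nzf l')).
Qed.

End ValuationTheory.

Lemma leq_expn_base (m n e : nat) : (m <= n)%N -> (m ^ e <= n ^ e)%N.
Proof. by case: e => [|e] h; rewrite ?expn0 // leq_exp2r. Qed.

Lemma fractionP (R : idomainType) (x : {fraction R}) :
  exists p q : R, q != 0 /\ x = tofrac p / tofrac q.
Proof.
elim/quotW: x => r; exists r.1, r.2; split; first exact: denom_ratioP.
have d0 : tofrac r.2 != 0 by rewrite tofrac_eq0 denom_ratioP.
apply: (canRL (mulfK d0)); unlock FracField.tofrac.
rewrite -[LHS]FracField.pi_mul; apply/eqmodP.
rewrite /= FracField.equivfE /FracField.mulf !numden_Ratio ?mulf_neq0 ?oner_neq0 //.
- by rewrite !mulr1 mulrC.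
- exact: denom_ratioP.
- exact: denom_ratioP.
Qed.

(** * Algebraic dependence *)

Module TranscendenceBases.
Import mpoly.

Definition monomial (F : comRingType) (d : nat) (z : 'I_d -> F) (b : 'I_d -> nat) : F :=
  \prod_(i < d) z i ^+ b i.

Section Evaluation.
Variables (k F : fieldType) (kappa : {rmorphism k -> F}) (d : nat) (z : 'I_d -> F).
Implicit Types (p q : {mpoly k[d]}) (u v w : F).

Local Notation ev := (mmap kappa z).

Definition alg_indep := forall p, ev p = 0 -> p = 0.

(** Algebraicity over k(z) with denominators cleared; under [alg_indep] the image of [P] in F[X]
    stays nonzero. *)
Definition algebraic u :=
  exists2 P : {poly {mpoly k[d]}}, P != 0 & (map_poly ev P).[u] = 0.

Hypothesis indep : alg_indep.

Lemma ev_eq0 p : (ev p == 0) = (p == 0).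
Proof. by apply/eqP/eqP => [/indep|->]; rewrite ?mmap0. Qed.

(** The ring and the ideal to which Chevalley's theorem is applied. A zero numerator is listed apart
    in [frac_lt], since [mlead 0] is the zero exponent, which is not below the lead of a
    constant. *)
Definition frac_le u := exists p q,
  [/\ q != 0, (mlead p <= mlead q)%O & u = ev p / ev q].
Definition frac_lt u := exists p q,
  [/\ q != 0, p = 0 \/ (mlead p < mlead q)%O & u = ev p / ev q].

Lemma lead_ltM p q r : r != 0 -> (p = 0 \/ (mlead p < mlead q)%O) -> q != 0 ->
  p * r = 0 \/ (mlead (p * r) < mlead (q * r))%O.
Proof.
move=> r0 h q0; have [->|p0] := eqVneq p 0; first by left; rewrite mul0r.
case: h => [e|h]; first by rewrite e eqxx in p0.
by right; rewrite !mleadM // ltmc_add2l.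
Qed.

Lemma lead_leM p q r : r != 0 -> (mlead p <= mlead q)%O -> q != 0 ->
  (mlead (p * r) <= mlead (q * r))%O.
Proof.
move=> r0 h q0; have [->|p0] := eqVneq p 0; first by rewrite mul0r mlead0 le0x.
by rewrite !mleadM // lem_add.
Qed.

Lemma lead_ltD p p' q : (p = 0 \/ (mlead p < mlead q)%O) ->
  (p' = 0 \/ (mlead p' < mlead q)%O) -> p + p' = 0 \/ (mlead (p + p') < mlead q)%O.
Proof.
move=> [->|h]; first by rewrite add0r.
case=> [->|h']; first by rewrite addr0; right.
by right; apply: le_lt_trans (mleadD_le _ _) _; rewrite ltUx h.
Qed.

Lemma frac_proper : proper_ideal frac_le frac_lt.
Proof.
have fD p q p' q' : q != 0 -> q' != 0 ->
    ev p / ev q + ev p' / ev q' = ev (p * q' + p' * q) / ev (q * q').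
  move=> q0 q'0; rewrite !rmorphD !rmorphM /=.
  by field; rewrite !ev_eq0 q0 q'0.
have fM p q p' q' : (ev p / ev q) * (ev p' / ev q') = ev (p * p') / ev (q * q').
  by rewrite !rmorphM /= invfM mulrACA.
split.
- split.
  + by exists 1, 1; rewrite oner_eq0 rmorph1 divr1.
  + move=> _ _ [p [q [q0 h ->]]] [p' [q' [q'0 h' ->]]].
    exists (p * q' + (- p') * q), (q * q'); split; first by rewrite mulf_neq0.
      apply: le_trans (mleadD_le _ _) _; rewrite leUx lead_leM //=.
      by rewrite [q * q']mulrC lead_leM // mleadN.
    by rewrite -fD // rmorphN mulNr.
  + move=> _ _ [p [q [q0 h ->]]] [p' [q' [q'0 h' ->]]].
    exists (p * p'), (q * q'); split; rewrite ?fM ?mulf_neq0 //.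
    by apply: le_trans (mleadM_le _ _) _; rewrite mleadM // lem_add.
- move=> _ [p [q [q0 h ->]]]; exists p, q; split=> //.
  by case: h => [->|/ltW//]; rewrite mlead0 le0x.
- split.
    move=> _ _ [p [q [q0 h ->]]] [p' [q' [q'0 h' ->]]].
    exists (p * q' + p' * q), (q * q'); split; rewrite ?fD ?mulf_neq0 //.
    by apply: lead_ltD; [|rewrite [q * q']mulrC]; apply: lead_ltM.
  by exists 0, 1; rewrite oner_eq0 mmap0 mul0r; split=> //; left.
- move=> _ _ [p [q [q0 h ->]]] [p' [q' [q'0 h' ->]]].
  exists (p * p'), (q * q'); split; rewrite ?fM ?mulf_neq0 //.
  have [->|p0] := eqVneq p 0; first by left; rewrite mul0r.
  case: h' => [->|h']; first by left; rewrite mulr0.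
  right; apply: le_lt_trans (mleadM_le _ _) _; rewrite mleadM //.
  by rewrite [(mlead p + _)%MM]addmC [(mlead q + _)%MM]addmC; apply: ltmc_le_add.
(* The equation p(z)/q(z) = 1 forces p = q by independence, against the strict inequality of the
   leads. *)
- move=> [p [q [q0 h]]] /esym/eqP.
  rewrite -subr_eq0 -[X in _ - X](divff (_ : ev q != 0)) ?ev_eq0 // -mulrBl.
  rewrite mulf_eq0 invr_eq0 -rmorphB /= !ev_eq0 (negbTE q0) orbF subr_eq0 => /eqP pq.
  by move: q0 h; rewrite -pq => p0 [e|]; rewrite ?ltxx // e eqxx in p0 *.
Qed.

Lemma monomialE (b : 'I_d -> nat) : monomial z b = ev 'X_[[multinom b i | i < d]].
Proof. by rewrite mmapX; apply: eq_bigr => i _; rewrite mnmE. Qed.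

Lemma frac_lt_monomial (b b' : 'I_d -> nat) : ~ (b =1 b') ->
  frac_lt (monomial z b / monomial z b') \/ frac_lt (monomial z b' / monomial z b).
Proof.
move=> ne; rewrite !monomialE; set m := [multinom b i | i < d].
set m' := [multinom b' i | i < d].
have : m != m'.
  apply/eqP => e; apply: ne => i; have := congr1 (fun m : 'X_{1..d} => m i) e.
  by rewrite !mnmE.
rewrite neq_lt => /orP [] lt; [left; exists 'X_[m], 'X_[m']|right; exists 'X_[m'], 'X_[m]].
  by rewrite !mleadXm -mleadc_eq0 mleadXm mcoeffX eqxx oner_eq0; split=> //; right.
by rewrite !mleadXm -mleadc_eq0 mleadXm mcoeffX eqxx oner_eq0; split=> //; right.
Qed.

Lemma frac_le_const c : frac_le (kappa c).
Proof.
exists c%:MP, 1; rewrite oner_neq0 mmapC rmorph1 divr1; split=> //.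
by rewrite mleadC mlead1.
Qed.

Definition is_fraction u := exists p q, q != 0 /\ u = ev p / ev q.

Definition splits_over (K : fieldType) :=
  forall p : {poly K}, exists r : seq K, p = lead_coef p *: \prod_(x <- r) ('X - x%:P).

(** When the two leads agree, the residue is the quotient of the leading coefficients; no condition
    on [k] is involved. *)
Lemma is_fraction_trichotomy u : is_fraction u -> u != 0 ->
  [\/ frac_lt u, frac_lt u^-1 | exists c, frac_lt (u - kappa c)].
Proof.
move=> [p [q [q0 uE]]] u0.
have p0 : p != 0 by apply: contraNneq u0 => p0; rewrite uE p0 mmap0 mul0r.
case: (ltgtP (mlead p) (mlead q)) => h.
- by constructor 1; exists p, q; split=> //; right.
- by constructor 2; exists q, p; split; rewrite ?uE ?invf_div //; right.
constructor 3; exists (mleadc p / mleadc q); exists (p - (mleadc p / mleadc q) *: q), q.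
split=> //; last first.
  by rewrite rmorphB /= mmapZ mulrBl mulfK ?ev_eq0 // uE.
have [e|ne] := eqVneq (p - (mleadc p / mleadc q) *: q) 0; [by left|right].
have qc : mleadc q != 0 by rewrite mleadc_eq0.
rewrite lt_neqAle; apply/andP; split; last first.
  apply: le_trans (mleadB_le _ _) _; rewrite leUx h lexx /=; exact: mleadZ_le.
apply: contra ne => /eqP e; rewrite -mleadc_eq0 e mcoeffB mcoeffZ divfK //.
by rewrite -h subrr.
Qed.

(* The leading coefficients of a relation [sum_j P_j(z) u^j = 0] give a relation over
   [k] modulo the maximal ideal. *)
Lemma residue_algebraic (O : F -> Prop) u : valuation_ring O ->
  (forall v, frac_le v -> O v) -> (forall v, frac_lt v -> small O v) ->
  splits_over k -> algebraic u -> O u -> exists c, small O (u - kappa c).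
Proof.
move=> vO leO ltO spl [P P0 Pu] Ou.
have sO : subring O by case: vO.
have lt0 : ((size P).-1 < size P)%N by rewrite ltn_predL lt0n size_poly_eq0.
have lc0 : P`_(Ordinal lt0) != 0 by rewrite /= -lead_coefE lead_coef_eq0.
(* Coefficients are compared with the largest lead M among them: modulo the ideal each P_j / z^M is
   a constant, and the one at [i0] is nonzero. *)
have [i0 Pi0 max] := arg_maxP (P := fun i : 'I_(size P) => P`_i != 0)
  (fun i : 'I_(size P) => mlead P`_i) lc0.
pose M := mlead P`_i0.
have leM i : (mlead P`_i <= M)%O.
  have [->|n0] := eqVneq P`_i 0; first by rewrite mlead0 le0x.
  have [lt|ge] := ltnP i (size P); last by rewrite nth_default ?eqxx // in n0.
  exact: (max (Ordinal lt)).
pose p := \poly_(i < size P) (P`_i)@_M.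
have p0 : p != 0.
  apply: contraNneq Pi0 => p0; rewrite -mleadc_eq0 -/M.
  by have := coef_poly (size P) (fun i => (P`_i)@_M) i0; rewrite -/p p0 coef0 ltn_ord => <-.
have smallp : small O (map_poly kappa p).[u].
  have XM0 : 'X_[k, M] != 0 by rewrite -mleadc_eq0 mleadXm mcoeffX eqxx oner_eq0.
  have -> : (map_poly kappa p).[u] =
      - \sum_(i < size P) u ^+ i * (ev (P`_i - (P`_i)@_M *: 'X_[M]) / ev 'X_[M]).
    rewrite (horner_coef_wide _ (leq_trans (size_poly _ _) (size_poly _ _))).
    move/eqP: Pu; rewrite (horner_coef_wide _ (size_poly _ _)) => /eqP Pu.
    under [in RHS]eq_bigr do rewrite rmorphB /= mmapZ mulrBl mulfK ?ev_eq0 // mulrBr mulrA.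
    rewrite sumrB opprB -mulr_suml.
    under [X in _ = _ - X / _]eq_bigr do rewrite mulrC -coef_map.
    rewrite Pu mul0r subr0; apply: eq_bigr => i _.
    by rewrite coef_map coef_poly ltn_ord mulrC.
  apply: smallN => //; apply: small_sum => // i _; apply: smallM => //.
    exact: subringX.
  apply: ltO; exists (P`_i - (P`_i)@_M *: 'X_[M]), 'X_[M]; split=> //.
  have [e|ne] := eqVneq (P`_i - (P`_i)@_M *: 'X_[M]) 0; [by left|right].
  rewrite mleadXm lt_neqAle; apply/andP; split; last first.
    apply: le_trans (mleadB_le _ _) _; rewrite leUx leM /=.
    by apply: le_trans (mleadZ_le _ _) _; rewrite mleadXm.
  apply: contra ne => /eqP e.
  by rewrite -mleadc_eq0 e mcoeffB mcoeffZ mcoeffX eqxx mulr1 subrr.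
have [r pE] := spl p.
(* If no u - c were small, all of them would be units, and so would p(u), a nonzero constant times a
   product of such factors. *)
apply: contrapT => nc.
have ns c : u - kappa c != 0 /\ O (u - kappa c)^-1.
  have Ouc : O (u - kappa c).
    by case: sO => _ OB _; apply: OB => //; apply: leO; apply: frac_le_const.
  by apply: not_small => // sc; apply: nc; exists c.
suff [pu0 Opu] : (map_poly kappa p).[u] != 0 /\ O ((map_poly kappa p).[u])^-1.
  by case: smallp => [e|//]; rewrite e eqxx in pu0.
rewrite pE map_polyZ hornerZ; set l := lead_coef p.
have l0 : l != 0 by rewrite lead_coef_eq0.
elim: r {pE} => [|x r [IH1 IH2]].
  rewrite big_nil rmorph1 hornerC mulr1 fmorph_eq0 -fmorphV; split=> //.
  by apply: leO; apply: frac_le_const.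
rewrite big_cons rmorphM /= hornerM rmorphB /= map_polyX map_polyC /= hornerXsubC.
rewrite mulrCA; have [n1 n2] := ns x; split; first by rewrite mulf_neq0.
by rewrite invfM; apply: (valM vO).
Qed.

Lemma monomial_neq0 (b : 'I_d -> nat) : monomial z b != 0.
Proof. by rewrite monomialE ev_eq0 -mleadc_eq0 mleadXm mcoeffX eqxx oner_eq0. Qed.

(** The alternatives match the two parts of the theorem: residues of fractions are explicit over any
    [k], those of algebraic elements are roots of polynomials over [k]. *)
Theorem monomial_valuation :
  (forall u, is_fraction u) \/ splits_over k /\ (forall u, algebraic u) ->
  exists O, [/\ valuation_ring O, forall c, O (kappa c),
    forall u, O u -> exists c, small O (u - kappa c) &
    forall b b', sim O (monomial z b) (monomial z b') -> b =1 b'].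
Proof.
move=> hyp; have [O [vO leO ltO']] := chevalley frac_proper.
have ltO v : frac_lt v -> small O v.
  by have [->|v0] := eqVneq v 0; [left|right; apply: ltO'].
exists O; split=> //.
- by move=> c; apply: leO; apply: frac_le_const.
- move=> u Ou; case: hyp => [fr|[spl alg]]; last exact: residue_algebraic.
  have [->|u0] := eqVneq u 0; first by exists 0; left; rewrite rmorph0 subr0.
  case: (is_fraction_trichotomy (fr u) u0) => [lt|lt|[c lt]].
  + by exists 0; rewrite rmorph0 subr0; apply: ltO.
  + by case: (ltO' _ _ lt); rewrite ?invr_eq0 // invrK.
  + by exists c; apply: ltO.
- move=> b b' [o1 o2]; apply: contrapT => ne.
  have n0 : monomial z b / monomial z b' != 0.
    by rewrite mulf_neq0 ?invr_eq0 ?monomial_neq0.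
  case: (frac_lt_monomial ne) => lt.
    by apply: (ltO' _ n0 lt); rewrite invf_div.
  by apply: (ltO' _ _ lt); rewrite ?invf_div // -invr_eq0 invf_div.
Qed.

Definition gen_module (T : finType) (e : T -> F) v :=
  exists M : T -> {mpoly k[d]}, v = \sum_a ev (M a) * e a.

Lemma gen_module_sum (T : finType) (e : T -> F) (J : Type) (r : seq J) (f : J -> F) :
  (forall i, gen_module e (f i)) -> gen_module e (\sum_(i <- r) f i).
Proof.
move=> h; apply: (big_ind (gen_module e)) => //.
  by exists (fun=> 0); rewrite big1 // => a _; rewrite mmap0 mul0r.
move=> _ _ [M ->] [N ->]; exists (fun a => M a + N a); rewrite -big_split.
by apply: eq_bigr => a _; rewrite rmorphD mulrDl.
Qed.

Lemma gen_moduleZ (T : finType) (e : T -> F) p v :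
  gen_module e v -> gen_module e (ev p * v).
Proof.
move=> [M ->]; exists (fun a => p * M a); rewrite mulr_sumr.
by apply: eq_bigr => a _; rewrite rmorphM mulrA.
Qed.

Lemma gen_module_gen (T : finType) (e : T -> F) a : gen_module e (e a).
Proof.
exists (fun b => (b == a)%:R); rewrite (bigD1 a) //= eqxx rmorph1 mul1r big1 ?addr0 //.
by move=> b /negbTE ->; rewrite rmorph0 mul0r.
Qed.

(** With [q] the leading coefficient and [r] the degree of an equation of [v], multiplying the
    equation by q^(r-1) makes it monic in q v. *)
Lemma algebraic_integral v : algebraic v ->
  exists q r (M : 'I_r -> {mpoly k[d]}), [/\ q != 0, (0 < r)%N &
    (ev q * v) ^+ r = \sum_(i < r) ev (M i) * (ev q * v) ^+ i].
Proof.
move=> [P P0 Pv]; pose q := lead_coef P; pose r := (size P).-1.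
have q0 : q != 0 by rewrite lead_coef_eq0.
have sP : size P = r.+1 by rewrite prednK // lt0n size_poly_eq0.
exists q, r, (fun i => - (P`_i * q ^+ (r.-1 - i))); split=> //.
  rewrite lt0n; apply/eqP => r0; move: Pv.
  rewrite (@size1_polyC _ P) ?sP ?r0 // map_polyC hornerC /=; move/eqP.
  by rewrite ev_eq0 -{1}r0 -lead_coefE (negbTE q0).
case r_eq: r sP => [|r'] sP.
  move: Pv; rewrite (@size1_polyC _ P) ?sP // map_polyC hornerC /=; move/eqP.
  by rewrite ev_eq0 => /eqP e; move: q0; rewrite /q lead_coefE sP /= e eqxx.
have szm : (size (map_poly ev P) <= size P)%N by apply: size_poly.
move: Pv; rewrite (horner_coef_wide _ szm) sP big_ord_recr /= coef_map /=.
move=> /(congr1 (fun x => x * ev q ^+ r')); rewrite mul0r mulrDl => /eqP.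
rewrite addrC addr_eq0 => /eqP e.
have -> : (ev q * v) ^+ r'.+1 = ev P`_r'.+1 * v ^+ r'.+1 * ev q ^+ r'.
  have -> : P`_r'.+1 = q by rewrite /q lead_coefE sP.
  by rewrite exprMn exprS; ring.
rewrite e mulr_suml -sumrN; apply: eq_bigr => i _.
rewrite coef_map /= rmorphN rmorphM rmorphXn /= exprMn mulNr; congr (- _).
have -> : ev q ^+ r' = ev q ^+ (r' - i) * ev q ^+ i by rewrite -exprD subnK // -ltnS.
by ring.
Qed.

(** For a common denominator [q], the products of powers of the integral multiples of the [vs]
    generate a finite k[z]-module stable under each q v. *)
Lemma algebraic_gen_module (vs : seq F) : {in vs, forall v, algebraic v} ->
  exists (T : finType) (e : T -> F) q, [/\ q != 0, gen_module e 1 &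
    {in vs, forall v a, gen_module e (ev q * v * e a)}].
Proof.
elim: vs => [|v vs IH] alg.
  by exists unit, (fun=> 1), 1; split; rewrite ?oner_neq0 //; apply: (gen_module_gen _ tt).
case: IH => [w wvs|T [e [q [q0 e1 eM]]]]; first by apply: alg; rewrite inE wvs orbT.
have [q' [r [M [q'0 r0 wr]]]] := algebraic_integral (alg v (mem_head _ _)).
pose w := ev q' * v.
pose e' (x : T * 'I_r) := e x.1 * w ^+ x.2.
have lift x (i : 'I_r) : gen_module e x -> gen_module e' (x * w ^+ i).
  move=> [N ->]; rewrite mulr_suml; apply: gen_module_sum => a.
  by rewrite -mulrA; apply: gen_moduleZ; apply: (gen_module_gen e' (a, i)).
exists (T * 'I_r)%type, e', (q * q'); split; first by rewrite mulf_neq0.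
  by have := lift 1 (Ordinal r0) e1; rewrite expr0 mulr1.
move=> u; rewrite inE => /predU1P [->|uvs] [a i]; last first.
  have -> : ev (q * q') * u * e' (a, i) = ev q' * (ev q * u * e a * w ^+ i).
    by rewrite rmorphM /e' /=; ring.
  by apply/gen_moduleZ/lift/eM.
have -> : ev (q * q') * v * e' (a, i) = ev q * (e a * w ^+ i.+1).
  by rewrite rmorphM /e' /= exprS /w; ring.
apply: gen_moduleZ; have [lt|ge] := ltnP i.+1 r.
  exact: (gen_module_gen e' (a, Ordinal lt)).
have -> : i.+1 = r by apply/eqP; rewrite eqn_leq ltn_ord.
rewrite wr mulr_sumr; apply: gen_module_sum => l; rewrite mulrCA.
by apply: gen_moduleZ; apply: (gen_module_gen e' (a, l)).
Qed.

End Evaluation.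

(** * Growth of finite families algebraic over k(z) *)

Section Growth.
Variables (k F : fieldType) (kappa : {rmorphism k -> F}) (d : nat) (z : 'I_d -> F).
Implicit Types (p q : {mpoly k[d]}) (u v w : F).
Local Notation ev := (mmap kappa z).
Hypothesis indep : alg_indep kappa z.

Lemma msizeM_leq p q (s t : nat) : (msize p <= s.+1)%N -> (msize q <= t.+1)%N ->
  (msize (p * q) <= (s + t).+1)%N.
Proof.
have [->|p0] := eqVneq p 0; first by rewrite mul0r msize0.
have [->|q0] := eqVneq q 0; first by rewrite mulr0 msize0.
rewrite msizeM // => h1 h2; have := leq_add h1 h2.
by rewrite addSn addnS; case: (_ + _)%N.
Qed.

(** Coefficients have total degree at most [s]; [msize] exceeds the degree by one. *)
Definition bounded_module (T : finType) (e : T -> F) (s : nat) v :=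
  exists2 M : T -> {mpoly k[d]}, (forall a, msize (M a) <= s.+1)%N &
    v = \sum_a ev (M a) * e a.

Lemma bounded_moduleW (T : finType) (e : T -> F) (s t : nat) v : (s <= t)%N ->
  bounded_module e s v -> bounded_module e t v.
Proof. by move=> st [M Ms ->]; exists M => // a; apply: leq_trans (Ms a) _. Qed.

Lemma gen_module_bounded (T : finType) (e : T -> F) v :
  gen_module kappa z e v -> exists s, bounded_module e s v.
Proof.
move=> [M ->]; exists (\max_a msize (M a)), M => // a.
by rewrite ltnW // ltnS; apply: leq_bigmax.
Qed.

Lemma bounded_moduleM (T : finType) (e : T -> F) v (s t : nat) u :
  (forall a, bounded_module e s (v * e a)) -> bounded_module e t u ->
  bounded_module e (t + s) (v * u).
Proof.
move=> hv [M Mt ->].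
have /choice [N NP] : forall a, exists N : T -> {mpoly k[d]},
    (forall b, msize (N b) <= s.+1)%N /\ v * e a = \sum_b ev (N b) * e b.
  by move=> a; have [N] := hv a; exists N.
exists (fun b => \sum_a M a * N a b).
  move=> b; apply: leq_trans (msize_sum _ _ _) _.
  apply/bigmax_leqP => a _; apply: msizeM_leq; [exact: Mt|by case: (NP a)].
rewrite mulr_sumr.
under eq_bigr => a _ do [rewrite mulrCA (proj2 (NP a)) mulr_sumr].
rewrite exchange_big; apply: eq_bigr => b _; rewrite rmorph_sum mulr_suml.
by apply: eq_bigr => a _; rewrite rmorphM mulrA.
Qed.

Lemma card_bmultinom (s : nat) : (#|{: 'X_{1..d < s.+1}}| <= s.+1 ^ d)%N.
Proof.
have -> : (s.+1 ^ d = #|{ffun 'I_d -> 'I_s.+1}|)%N by rewrite card_ffun !card_ord.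
apply: (@leq_card _ _ (fun m : 'X_{1..d < s.+1} => [ffun i => inord (m i)])).
move=> m m' /ffunP e; apply/val_inj/mnmP => i.
have le (x : 'X_{1..d < s.+1}) : (bmnm x i < s.+1)%N.
  by apply: leq_ltn_trans (bmdeg x); rewrite mdegE (bigD1 i) //= leq_addr.
by have := congr1 (@nat_of_ord _) (e i); rewrite !ffunE !inordK.
Qed.

(** After multiplication by q^N, words of length at most N lie in a finite k[z]-module with
    coefficients of degree O(N), and only O(N^d) monomials have such a degree. *)
Theorem algebraic_growth (vs : seq F) : {in vs, forall v, algebraic kappa z v} ->
  exists C : nat, forall N : nat, exists (J : finType) (g : J -> F),
    (#|J| <= C * N.+1 ^ d)%N /\ forall l : seq F, {subset l <= vs} -> (size l <= N)%N ->
      exists c : J -> k, \prod_(v <- l) v = \sum_i kappa (c i) * g i.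
Proof.
move=> /(algebraic_gen_module indep) [T [e [q [q0 e1 eM]]]].
have evq : ev q != 0 by rewrite ev_eq0.
have [s0 b1] := gen_module_bounded e1.
have bq a : exists s, bounded_module e s (ev q * e a).
  exact/gen_module_bounded/gen_moduleZ/gen_module_gen.
have bv v : v \in vs -> exists s, forall a, bounded_module e s (ev q * v * e a).
  move=> vvs; have /choice [f fP] : forall a, exists s, bounded_module e s (ev q * v * e a).
    by move=> a; apply/gen_module_bounded/eM.
  by exists (\max_a f a) => a; apply: bounded_moduleW (fP a); apply: leq_bigmax.
(* [E] bounds the rise in degree caused by one multiplication by [q] or by q v. *)
have [E [Eq Ev]] : exists E, (forall a, bounded_module e E (ev q * e a)) /\
    {in vs, forall v a, bounded_module e E (ev q * v * e a)}.
  have /choice [f fP] := bq.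
  have /choice [h hP] : forall v, exists s, v \in vs ->
      forall a, bounded_module e s (ev q * v * e a).
    by move=> v; case: (boolP (v \in vs)) => [/bv [s]|_]; [exists s|exists 0%N].
  exists (maxn (\max_a f a) (\max_(v <- vs) h v)); split.
    move=> a; apply: bounded_moduleW (fP a).
    by apply: leq_trans (leq_maxl _ _); apply: leq_bigmax.
  move=> v vvs a; apply: bounded_moduleW (hP v vvs a).
  by apply: leq_trans (leq_maxr _ _); apply: leq_bigmax_seq.
(* Words shorter than N are padded with bare factors [q], so that the single denominator q^N serves
   all of them. *)
have main N l : {subset l <= vs} -> (size l <= N)%N ->
    bounded_module e (s0 + E * N) (ev q ^+ N * \prod_(v <- l) v).
  elim: N l => [|N IH] [|v l] sub sz //.
  - by rewrite big_nil mulr1 expr0 muln0 addn0.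
  - rewrite exprS -mulrA mulnSr addnA.
    by apply: bounded_moduleM => //; apply: IH.
  - rewrite big_cons exprS mulrACA mulnSr addnA.
    apply: bounded_moduleM; first by move=> a; apply: Ev; rewrite sub ?mem_head.
    by apply: IH => // w wl; apply: sub; rewrite inE wl orbT.
exists ((s0 + E).+1 ^ d * #|T|)%N => N.
pose S := (s0 + E * N)%N.
exists ('X_{1..d < S.+1} * T)%type,
  (fun x : 'X_{1..d < S.+1} * T => ev 'X_[bmnm x.1] * e x.2 / ev q ^+ N).
split.
  rewrite card_prod mulnAC leq_mul2r; apply/orP; right.
  apply: leq_trans (card_bmultinom _) _; rewrite -expnMn; apply: leq_expn_base.
  by rewrite /S; nia.
move=> l sub sz; have [M Ms eqM] := main N l sub sz.
exists (fun x : 'X_{1..d < S.+1} * T => (M x.2)@_(bmnm x.1)).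
apply: (mulfI (_ : ev q ^+ N != 0)); first exact: expf_neq0.
rewrite eqM mulr_sumr -(pair_bigA _ (fun m a => ev q ^+ N * (kappa (M a)@_(bmnm m) *
  (ev 'X_[m] * e a / ev q ^+ N)))) /=.
rewrite exchange_big; apply: eq_bigr => a _.
rewrite {1}(mpolywE (Ms a)) rmorph_sum mulr_suml; apply: eq_bigr => m _.
by rewrite /= mmapZ; field; rewrite expf_neq0.
Qed.

End Growth.

Section AlgebraicClosure.
Variables (k F : fieldType) (kappa : {rmorphism k -> F}) (d : nat) (z : 'I_d -> F).
Implicit Types (p q : {mpoly k[d]}) (u v w : F).
Local Notation ev := (mmap kappa z).
Hypothesis indep : alg_indep kappa z.
Local Notation K := {fraction {mpoly k[d]}}.

Lemma fraction_morphism : exists f : {rmorphism K -> F}, forall p, f (tofrac p) = ev p.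
Proof.
have /choice [n /choice [m nmP]] := @fractionP {mpoly k[d]}.
pose f (x : K) := ev (n x) / ev (m x).
have fE x p q : q != 0 -> x = tofrac p / tofrac q -> f x = ev p / ev q.
  have [m0 xE] := nmP x; move=> q0 xE'; move/eqP: (etrans (esym xE) xE').
  rewrite eqr_div ?tofrac_eq0 // -!tofracM tofrac_eq => /eqP e.
  by apply/eqP; rewrite eqr_div ?ev_eq0 // -!rmorphM /= e.
have fp p : f (tofrac p) = ev p.
  by rewrite (fE _ p 1) ?oner_neq0 // ?tofrac1 ?rmorph1 divr1.
have fB : zmod_morphism f.
  move=> x y; have [x0 xE] := nmP x; have [y0 yE] := nmP y.
  rewrite (fE (x - y) (n x * m y + - n y * m x) (m x * m y)) ?mulf_neq0 //.
    by rewrite /f rmorphD !rmorphM rmorphN /= -addf_div ?ev_eq0 // mulNr.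
  rewrite [LHS](congr2 (fun a b => a - b) xE yE) tofracD !tofracM tofracN.
  by rewrite -addf_div ?tofrac_eq0 // mulNr.
have fM : monoid_morphism f.
  split=> [|x y]; first by rewrite -tofrac1 fp rmorph1.
  have [x0 xE] := nmP x; have [y0 yE] := nmP y.
  rewrite (fE (x * y) (n x * n y) (m x * m y)) ?mulf_neq0 //.
    by rewrite /f !rmorphM /= mulf_div.
  by rewrite [LHS](congr2 *%R xE yE) !tofracM mulf_div.
pose fA := GRing.isZmodMorphism.Build K F f fB.
pose fR := GRing.isMonoidMorphism.Build K F f fM.
by exists (HB.pack f fA fR : {rmorphism K -> F}).
Qed.

(** Clearing denominators identifies [algebraic] with algebraicity over the field k(z), whose
    closure under the field operations is then available. *)
Lemma algebraicOver_fraction (f : {rmorphism K -> F}) u :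
  (forall p, f (tofrac p) = ev p) -> algebraic kappa z u <-> algebraicOver f u.
Proof.
move=> fp; split=> [[P P0 Pu]|[P P0 /rootP Pu]].
  exists (map_poly (@tofrac _) P).
    apply: contraNneq P0 => e; apply/eqP/polyP => i; rewrite coef0.
    have /eqP := congr1 (fun Q : {poly K} => Q`_i) e.
    by rewrite coef_map coef0 /= tofrac_eq0 => /eqP.
  rewrite -map_poly_comp /root -[X in _ == X]Pu; apply/eqP; congr _.[u].
  by apply: eq_map_poly => p /=; rewrite fp.
have /choice [n /choice [m nmP]] := @fractionP {mpoly k[d]}.
pose c := \prod_(i < size P) m P`_i.
have c0 : c != 0 by apply/prodf_neq0 => i _; case: (nmP P`_i).
pose Q := \poly_(i < size P) (n P`_i * \prod_(l < size P | l != i :> nat) m P`_l).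
have QE : map_poly (@tofrac _) Q = tofrac c *: P.
  apply/polyP => i; rewrite coef_map coefZ coef_poly /=.
  case: ltnP => [lt|ge]; last by rewrite nth_default // mulr0 tofrac0.
  have [m0 xE] := nmP P`_i.
  transitivity (tofrac c * (tofrac (n P`_i) / tofrac (m P`_i))); last by rewrite -xE.
  have -> : c = m P`_i * \prod_(l < size P | l != i :> nat) m P`_l.
    by rewrite /c (bigD1 (Ordinal lt)).
  by rewrite !rmorphM /= [RHS]mulrC mulrA divfK ?tofrac_eq0.
exists Q.
  apply: contraNneq P0 => Q0; move/eqP: QE; rewrite Q0 map_poly0 eq_sym scaler_eq0.
  by rewrite tofrac_eq0 (negbTE c0).
have -> : map_poly ev Q = map_poly f (map_poly (@tofrac _) Q).
  by rewrite -map_poly_comp; apply: eq_map_poly => p /=; rewrite fp.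
by rewrite QE map_polyZ hornerZ Pu mulr0.
Qed.

Lemma algebraic_field : [/\ forall c, algebraic kappa z (kappa c),
  forall u v, algebraic kappa z u -> algebraic kappa z v -> algebraic kappa z (u + v),
  forall u v, algebraic kappa z u -> algebraic kappa z v -> algebraic kappa z (u * v) &
  forall u, algebraic kappa z u -> algebraic kappa z u^-1].
Proof.
have [f fp] := fraction_morphism.
have E u := algebraicOver_fraction u fp.
split.
- by move=> c; apply/E; rewrite -(mmapC z) -fp; apply: algebraic_id.
- by move=> u v /E au /E av; apply/E; apply: algebraic_add.
- by move=> u v /E au /E av; apply/E; apply: algebraic_mul.
- by move=> u /E au; apply/E; apply: algebraic_inv.
Qed.

End AlgebraicClosure.

(** * Existence of transcendence bases *)

Section TranscendenceBasis.
Local Notation widen := (widen_ord (leqnSn _)).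
Variables (k F : fieldType) (kappa : {rmorphism k -> F}).

Definition snoc (d : nat) (z : 'I_d -> F) (g : F) (i : 'I_d.+1) : F :=
  if unlift ord_max i is Some l then z l else g.

Lemma snoc_widen (d : nat) (z : 'I_d -> F) g (i : 'I_d) : snoc z g (widen i) = z i.
Proof.
have -> : widen i = lift ord_max i by apply: ord_inj; rewrite lift_max.
by rewrite /snoc liftK.
Qed.

Lemma muni_inj0 (d : nat) (p : {mpoly k[d.+1]}) : muni p = 0 -> p = 0.
Proof.
move=> p0; apply/mpolyP => m; rewrite mcoeff0.
pose res (m : 'X_{1..d.+1}) := [multinom (m (widen i)) | i < d].
have := congr1 (fun P : {poly {mpoly k[d]}} => P`_(m ord_max)@_(res m)) p0.
rewrite muniE coef_sum raddf_sum coef0 mcoeff0 /= => <-.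
have E m' : (p@_m' *: 'X_[res m'] *: 'X^(m' ord_max) : {poly {mpoly k[d]}})`_(m ord_max)@_(res m)
    = p@_m' * (m' == m)%:R.
  rewrite coefZ coefXn; case: (eqVneq m' m) => [->|ne].
    by rewrite eqxx mulr1 mcoeffZ mcoeffX eqxx.
  rewrite mulr0; case: eqP => [e|_]; last by rewrite mulr0 mcoeff0.
  rewrite mulr1 mcoeffZ mcoeffX; case: eqP => [e'|_]; last by rewrite mulr0.
  case/eqP: ne; apply/mnmP => i; case: (unliftP ord_max i) => [l ->|->//].
  have -> : lift ord_max l = widen l by apply: ord_inj; rewrite lift_max.
  by have := congr1 (fun m : 'X_{1..d} => m l) e'; rewrite !mnmE.
under eq_bigr do rewrite E.
have [mp|mp] := boolP (m \in msupp p).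
  rewrite (bigD1_seq m) ?msupp_uniq //= eqxx mulr1 big1 ?addr0 // => i /negbTE ->.
  by rewrite mulr0.
rewrite (memN_msupp_eq0 mp) big_seq big1 // => i ip; case: eqP => [e|]; rewrite ?mulr0 //.
by rewrite -e ip in mp.
Qed.

Lemma muni_eval (d : nat) (z : 'I_d -> F) g (p : {mpoly k[d.+1]}) :
  (map_poly (mmap kappa z) (muni p)).[g] = mmap kappa (snoc z g) p.
Proof.
rewrite muniE rmorph_sum horner_sum; apply: eq_bigr => m _ /=.
rewrite map_polyZ map_polyXn hornerZ hornerXn /= mmapZ mmapX -mulrA; congr (_ * _).
rewrite /mmap1 big_ord_recr /=; congr (_ * _); last by rewrite /snoc unlift_none.
by apply: eq_bigr => i _; rewrite mnmE snoc_widen.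
Qed.

Lemma alg_indep_inj (d : nat) (z : 'I_d -> F) : alg_indep kappa z -> injective z.
Proof.
move=> ind i l e; have := ind ('X_i - 'X_l); rewrite rmorphB /= !mmapX !mmap1U e subrr.
move=> /(_ erefl) /eqP; rewrite subr_eq0 => /eqP /(congr1 (@mlead _ _)).
rewrite !mleadXm => /(congr1 (fun m : 'X_{1..d} => m i)).
by rewrite !mnm1E eqxx; case: eqP.
Qed.

(** Take an independent family in [gs] of maximal length; independent families are injective, so the
    length is bounded. A relation involving one more g, read as a polynomial in the last variable by
    [muni], would make g algebraic. *)
Theorem transcendence_basis (gs : seq F) : exists (d : nat) (z : 'I_d -> F),
  [/\ alg_indep kappa z, forall i, z i \in gs & {in gs, forall g, algebraic kappa z g}].
Proof.
pose Q d := `[< exists z : 'I_d -> F, alg_indep kappa z /\ forall i, z i \in gs >].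
have Q0 : exists d, Q d.
  exists 0%N; apply/asboolP; exists (fun=> 0); split=> [p|[]//].
  rewrite (_ : p = (p@_0)%:MP).
    by rewrite mmapC => /eqP; rewrite fmorph_eq0 => /eqP ->; rewrite mpolyC0.
  apply/mpolyP => m; rewrite mcoeffC; have -> : m = 0%MM by apply/mnmP => -[].
  by rewrite eqxx mulr1.
have bnd d : Q d -> (d <= size gs)%N.
  move=> /asboolP [z [ind zgs]]; rewrite -(size_enum_ord d) -(size_map z).
  apply: uniq_leq_size; first by rewrite (map_inj_uniq (alg_indep_inj ind)) enum_uniq.
  by move=> _ /mapP [i _ ->].
case: (ex_maxnP Q0 bnd) => d /asboolP [z [ind zgs]] max.
exists d, z; split=> // g ggs; apply: contrapT => nalg.
suff /max : Q d.+1 by rewrite ltnn.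
apply/asboolP; exists (snoc z g); split; last first.
  by move=> i; rewrite /snoc; case: (unlift _ _).
move=> p p0; apply: muni_inj0; apply/eqP; apply: contra_notT nalg => nz.
by exists (muni p); rewrite // muni_eval.
Qed.

End TranscendenceBasis.
End TranscendenceBases.

(** * Linear endomorphisms as an algebra *)

Section Endomorphisms.
Variables (k : fieldType) (V : lmodType k) (v0 : V).

(** The nonzero vector is a parameter of the type because the ring structure demands 1 != 0. These
    algebras are the targets to which the universal property of [A] is applied. *)
Record endo (nz : v0 != 0) := Endo {
  endo_fun :> V -> V;
  endo_linear : forall (c : k) u v, endo_fun (c *: u + v) = c *: endo_fun u + endo_fun v }.

Variable nz : v0 != 0.
Notation E := (endo nz).
Implicit Types f g h : E.

Lemma endoP f g : (forall v, f v = g v) -> f = g.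
Proof.
case: f g => [f fl] [g gl] /= /funext e; move: fl gl; rewrite e => fl gl.
by congr Endo; apply: Prop_irrelevance.
Qed.

HB.instance Definition _ := gen_eqMixin E.
HB.instance Definition _ := gen_choiceMixin E.

Lemma endoD f u v : f (u + v) = f u + f v.
Proof. by rewrite -[u]scale1r endo_linear !scale1r. Qed.

Lemma endo0 f : f 0 = 0.
Proof. by apply: (addrI (f 0)); rewrite -endoD !addr0. Qed.

Lemma endoZ f c u : f (c *: u) = c *: f u.
Proof. by rewrite -[c *: u]addr0 endo_linear endo0 addr0. Qed.

Definition endo_add f g : E.
Proof.
by exists (fun v => f v + g v) => c u v; rewrite !endo_linear scalerDr addrACA.
Defined.
Definition endo_opp f : E.
Proof. by exists (fun v => - f v) => c u v; rewrite endo_linear opprD scalerN. Defined.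
Definition endo_zero : E.
Proof. by exists (fun=> 0) => c u v; rewrite scaler0 addr0. Defined.
Definition endo_one : E.
Proof. by exists id. Defined.
Definition endo_mul f g : E.
Proof. by exists (fun v => f (g v)) => c u v; rewrite !endo_linear. Defined.
Definition endo_scale (c : k) f : E.
Proof.
by exists (fun v => c *: f v) => c' u v; rewrite endo_linear scalerDr !scalerA mulrC.
Defined.

Lemma endo_addA : associative endo_add.
Proof. by move=> f g h; apply: endoP => v /=; rewrite addrA. Qed.
Lemma endo_addC : commutative endo_add.
Proof. by move=> f g; apply: endoP => v /=; rewrite addrC. Qed.
Lemma endo_add0 : left_id endo_zero endo_add.
Proof. by move=> f; apply: endoP => v /=; rewrite add0r. Qed.
Lemma endo_addN : left_inverse endo_zero endo_opp endo_add.
Proof. by move=> f; apply: endoP => v /=; rewrite addNr. Qed.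
HB.instance Definition _ := GRing.isZmodule.Build E endo_addA endo_addC endo_add0 endo_addN.

Lemma endo_mulA : associative endo_mul.
Proof. by move=> f g h; apply: endoP. Qed.
Lemma endo_mul1 : left_id endo_one endo_mul.
Proof. by move=> f; apply: endoP. Qed.
Lemma endo_mulr1 : right_id endo_one endo_mul.
Proof. by move=> f; apply: endoP. Qed.
Lemma endo_mulDl : left_distributive endo_mul endo_add.
Proof. by move=> f g h; apply: endoP. Qed.
Lemma endo_mulDr : right_distributive endo_mul endo_add.
Proof. by move=> f g h; apply: endoP => v /=; rewrite endoD. Qed.
Lemma endo_one_neq0 : endo_one != 0.
Proof. by apply: contra_neq nz => /(congr1 (fun f : E => f v0)). Qed.
HB.instance Definition _ := GRing.Zmodule_isNzRing.Build E endo_mulA endo_mul1 endo_mulr1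
  endo_mulDl endo_mulDr endo_one_neq0.

Lemma endo_scaleA c c' f : endo_scale c (endo_scale c' f) = endo_scale (c * c') f.
Proof. by apply: endoP => v /=; rewrite scalerA. Qed.
Lemma endo_scale1 : left_id 1 endo_scale.
Proof. by move=> f; apply: endoP => v /=; rewrite scale1r. Qed.
Lemma endo_scaleDr : right_distributive endo_scale +%R.
Proof. by move=> c f g; apply: endoP => v /=; rewrite scalerDr. Qed.
Lemma endo_scaleDl f : {morph endo_scale^~ f : c c' / c + c'}.
Proof. by move=> c c'; apply: endoP => v /=; rewrite scalerDl. Qed.
HB.instance Definition _ := GRing.Zmodule_isLmodule.Build k E endo_scaleA endo_scale1
  endo_scaleDr endo_scaleDl.

Lemma endo_scaleAl c f g : c *: (f * g) = (c *: f) * g.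
Proof. exact: endoP. Qed.
HB.instance Definition _ := GRing.Lmodule_isLalgebra.Build k E endo_scaleAl.
Lemma endo_scaleAr c f g : c *: (f * g) = f * (c *: g).
Proof. by apply: endoP => v /=; rewrite endoZ. Qed.
HB.instance Definition _ := GRing.Lalgebra_isAlgebra.Build k E endo_scaleAr.

Lemma endo_expE f n v : (f ^+ n) v = iter n f v.
Proof. by elim: n v => [|n IH] v; rewrite ?exprS //= -IH. Qed.

End Endomorphisms.

Lemma lrmorphism_of (k : fieldType) (A B : algType k) (f : A -> B) :
  (forall c u v, f (c *: u + v) = c *: f u + f v) -> f 1 = 1 ->
  (forall u v, f (u * v) = f u * f v) -> exists g : {lrmorphism A -> B}, g =1 f.
Proof.
move=> fl f1 fM.
have fB : zmod_morphism f.
  by move=> u v; rewrite addrC -scaleN1r fl scaleN1r addrC.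
have fMM : monoid_morphism f by [].
have fZ : scalable f.
  move=> c u; have f0 : f 0 = 0 by rewrite -(subrr 1) fB subrr.
  by rewrite -[c *: u]addr0 fl f0 addr0.
pose m1 := GRing.isZmodMorphism.Build A B f fB.
pose m2 := GRing.isMonoidMorphism.Build A B f fMM.
pose m3 := GRing.isScalable.Build k A B *:%R f fZ.
by exists (HB.pack f m1 m2 m3 : {lrmorphism A -> B}).
Qed.

Section SubAlgebra.
Variables (k : fieldType) (A : algType k) (S : A -> Prop).
Hypothesis SB : forall u v, S u -> S v -> S (u - v).
Hypothesis SM : forall u v, S u -> S v -> S (u * v).
Hypothesis SZ : forall c u, S u -> S (c *: u).
Hypothesis S1 : S 1.

Definition subalg_pred : {pred A} := fun u => `[< S u >].

Lemma subalg_pred_closed : subalg_closed subalg_pred.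
Proof.
split; first exact/asboolP.
- move=> c u v /asboolP Su /asboolP Sv; apply/asboolP.
  rewrite -[v]opprK; apply: SB; first exact: SZ.
  by rewrite -scaleN1r; apply: SZ.
- by move=> u v /asboolP Su /asboolP Sv; apply/asboolP/SM.
Qed.

HB.instance Definition _ := GRing.isSubalgClosed.Build k A subalg_pred subalg_pred_closed.

Record subalg := SubAlg { subalg_val :> A; _ : subalg_val \in subalg_pred }.
HB.instance Definition _ := [isSub for subalg_val].
HB.instance Definition _ := [Choice of subalg by <:].
HB.instance Definition _ := [SubChoice_isSubAlgebra of subalg by <:].

(** The universal property yields a map from [A] to the subalgebra [S]. Followed by the inclusion it
    fixes D, x and y, so by uniqueness it is the identity. *)
Lemma GWA_generation (D : algType k) (sigma : D -> D) (a : D)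
    (iota : {lrmorphism D -> A}) (x y : A) :
  is_GWA sigma a iota x y -> (forall d, S (iota d)) -> S x -> S y -> forall u, S u.
Proof.
move=> [rel univ] Si Sx Sy.
pose Sub' (u : A) (Su : S u) : subalg := SubAlg (asboolT Su : u \in subalg_pred).
have [f fE] : exists f : {lrmorphism D -> subalg}, f =1 (fun d => Sub' _ (Si d)).
  apply: lrmorphism_of.
  - by move=> c u v; apply: val_inj; rewrite /= linearP.
  - by apply: val_inj; rewrite /= rmorph1.
  - by move=> u v; apply: val_inj; rewrite /= rmorphM.
have relf : GWA_relations sigma a f (Sub' _ Sx) (Sub' _ Sy).
  case: rel => r1 r2 r3 r4; split=> [d|e||]; apply: val_inj; rewrite /= !fE /=.
  - exact: r1.
  - exact: r2.
  - exact: r3.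
  - exact: r4.
have [g [g1 g2 g3 _]] := univ _ _ _ _ relf.
have [h [_ _ _ huniq]] := univ _ _ _ _ rel.
move=> u; have -> : u = val (g u); last by case: (g u) => w /= /asboolP.
have [g' g'E] : exists g' : {lrmorphism A -> A}, g' =1 (fun u => val (g u)).
  apply: lrmorphism_of => [c v w||v w]; rewrite ?linearP ?rmorph1 ?rmorphM //=.
have [i iE] : exists g' : {lrmorphism A -> A}, g' =1 id by apply: lrmorphism_of.
have -> : val (g u) = h u.
  rewrite -g'E; apply: huniq => [d||]; rewrite g'E; first by rewrite g1 fE.
  - by rewrite g2.
  - by rewrite g3.
by rewrite -[LHS]iE; apply: huniq => [d||]; rewrite iE.
Qed.

End SubAlgebra.

Section IndependentFamilies.
Variables (k : fieldType) (V : lmodType k).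

Definition indep_family (J : finType) (f : J -> V) :=
  forall c : J -> k, \sum_i c i *: f i = 0 -> forall i, c i = 0.

Lemma indep_family_span_dim (J : finType) (f : J -> V) (s : seq V) :
  indep_family f -> (forall i, in_span s (f i)) -> (#|J| <= span_dim s)%N.
Proof.
move=> ind sp; rewrite cardE -(size_map f); apply: span_dim_ge; last first.
  by move=> _ /mapP [i _ ->].
apply/lin_freeP => c; rewrite size_map -cardE => c0 l llt.
have [i0 _|J0] := pickP (fun _ : J => true); last first.
  by move: llt; rewrite eq_card0.
have := ind (fun i => c (enum_rank i)); rewrite (reindex_onto enum_val enum_rank) /=; last first.
  by move=> i _; rewrite enum_rankK.
rewrite (eq_bigl xpredT); last by move=> i; rewrite enum_valK eqxx.
move=> h; have := h _ (enum_val (Ordinal llt)); rewrite enum_valK /=; apply.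
rewrite -[RHS]c0; apply: eq_bigr => i _; rewrite enum_valK (nth_map i0) ?(enum_val_nth i0) //.
by rewrite -cardE.
Qed.

End IndependentFamilies.

(** * Generalized Weyl algebras *)

Section GWA.
Variables (k : fieldType) (D A : algType k) (sigma : {lrmorphism D -> D}) (a : D).
Variables (iota : {lrmorphism D -> A}) (x y : A).
Hypothesis bij : is_alg_automorphism sigma.
Hypothesis ca : central a.
Hypothesis gwa : is_GWA sigma a iota x y.

Lemma inverse_automorphism : exists tau : {lrmorphism D -> D},
  cancel sigma tau /\ cancel tau sigma.
Proof.
case: (bij) => tau sK tK.
have [t tE] : exists t : {lrmorphism D -> D}, t =1 tau.
  apply: lrmorphism_of => [c u v||u v]; apply: (can_inj sK); rewrite tK.
  - by rewrite linearP /= !tK.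
  - by rewrite rmorph1.
  - by rewrite rmorphM /= !tK.
by exists t; split=> d; rewrite tE.
Qed.

Lemma GWA_xd d i : x ^+ i * iota d = iota (iter i sigma d) * x ^+ i.
Proof.
case: gwa => [[r1 _ _ _] _]; elim: i => [|i IH]; first by rewrite expr0 mul1r mulr1.
by rewrite exprS -mulrA IH mulrA r1 -mulrA.
Qed.

Lemma GWA_yd (tau : D -> D) : cancel tau sigma ->
  forall d i, y ^+ i * iota d = iota (iter i tau d) * y ^+ i.
Proof.
move=> tK d; case: gwa => [[_ r2 _ _] _]; elim=> [|i IH]; first by rewrite expr0 mul1r mulr1.
by rewrite exprS -mulrA IH /= -[in LHS](tK (iter i tau d)) mulrA r2 -mulrA.
Qed.

Let delta (i : int) : D := (i == 0)%:R.
Let delta_neq0 : delta != 0.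
Proof.
apply/eqP => /(congr1 (fun f : int -> D => f 0)) /eqP.
by rewrite /delta eqxx oner_eq0.
Qed.

(* D[X, X^-1; sigma], acting on the functions int -> D, is a model of the relations
   with X = x and a X^-1 = y *)
Lemma GWA_coef : exists cf : nat -> A -> D,
  (forall n (c : k) u v, cf n (c *: u + v) = c *: cf n u + cf n v) /\
  (forall n m d, cf n (iota d * x ^+ m) = if n == m then d else 0).
Proof.
have [tau [sK tK]] := inverse_automorphism.
have fE (c : k) (f g : int -> D) i : (c *: f + g) i = c *: f i + g i by [].
have [phi phiE] : exists phi : {lrmorphism D -> endo delta_neq0},
    forall d (f : int -> D), phi d f = (fun i => d * f i).
  have lin d : forall (c : k) (f g : int -> D),
      (fun i => d * (c *: f + g) i) = c *: (fun i => d * f i) + (fun i => d * g i).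
    by move=> c f g; apply/funext => i; rewrite fE mulrDr -scalerAr.
  have [phi phiE] : exists phi : {lrmorphism D -> endo delta_neq0},
      phi =1 fun d => Endo delta_neq0 (lin d).
    apply: lrmorphism_of => [c u v||u v]; apply: endoP => f; apply/funext => i /=.
    - by rewrite fE mulrDl -scalerAl.
    - by rewrite mul1r.
    - by rewrite mulrA.
  by exists phi => d f; rewrite phiE.
have linX (c : k) (f g : int -> D) : (fun i : int => sigma ((c *: f + g) (i - 1))) =
    c *: (fun i : int => sigma (f (i - 1))) + (fun i : int => sigma (g (i - 1))).
  by apply/funext => i; rewrite !fE linearP.
have linY (c : k) (f g : int -> D) : (fun i : int => a * tau ((c *: f + g) (i + 1))) =
    c *: (fun i : int => a * tau (f (i + 1))) + (fun i : int => a * tau (g (i + 1))).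
  by apply/funext => i; rewrite !fE linearP /= mulrDr -scalerAr.
pose X : endo delta_neq0 := Endo delta_neq0 linX.
pose Y : endo delta_neq0 := Endo delta_neq0 linY.
have rel : GWA_relations sigma a phi X Y.
  split=> [d|e||]; apply: endoP => f; apply/funext => i /=; rewrite ?phiE /=.
  - by rewrite rmorphM.
  - by rewrite rmorphM /= sK !mulrA ca.
  - by rewrite addrK sK.
  - by rewrite rmorphM /= tK subrK.
have [g [gi gx _ _]] := (let: conj _ h := gwa in h) _ _ _ _ rel.
(* Since X^m moves [delta] from 0 to m, the value at n of the action of u on [delta] extracts the
   coefficient of x^n. *)
exists (fun n u => g u delta n%:Z); split=> [n c u v|n m d]; first by rewrite linearP.
rewrite rmorphM rmorphXn /= gi gx phiE endo_expE.
have -> : iter m X delta = (fun i : int => (i == m%:Z)%:R).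
  elim: m => [|m IH] //=; apply/funext => i; rewrite IH rmorph_nat; congr (_%:R).
  by rewrite subr_eq addrC -intS.
by rewrite eqz_nat; case: eqP; rewrite ?mulr1 ?mulr0.
Qed.

Lemma GWA_indep (J : finType) (f : J -> D) (s L : nat) : indep_family f ->
  indep_family (fun i : J * 'I_L => iota (f i.1) * x ^+ (s + i.2)).
Proof.
have [cf [cfl cfE]] := GWA_coef.
move=> ind c c0 [i l]; have := ind (fun i => c (i, l)); apply.
have cf0 n : cf n 0 = 0.
  by have := cfl n 1 0 0; rewrite !scale1r addr0 => /eqP; rewrite -subr_eq0 opprD addrA subrr
   sub0r oppr_eq0 => /eqP.
have cfS n (T : Type) (r : seq T) (e : T -> k) (u : T -> A) :
    cf n (\sum_(i <- r) e i *: u i) = \sum_(i <- r) e i *: cf n (u i).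
  by elim: r => [|t r IH]; rewrite ?big_nil ?cf0 // !big_cons cfl IH.
rewrite -[RHS](cf0 (s + l)%N) -[in RHS]c0 cfS.
rewrite [RHS](eq_bigr (fun p =>
  c (p.1, p.2) *: cf (s + l)%N (iota (f p.1) * x ^+ (s + p.2)))); last by case.
rewrite -(pair_bigA _ (fun i m => c (i, m) *: cf (s + l)%N (iota (f i) * x ^+ (s + m)))).
apply: eq_bigr => i' _ /=; rewrite (bigD1 l) //= cfE eqxx big1 ?addr0 // => m ne.
by rewrite cfE eqn_add2l eq_sym val_eqE (negbTE ne) scaler0.
Qed.

(** The normal forms of a generalized Weyl algebra, filtered by degree. Degree 0 occurs in both
    sums. *)
Definition bounded_GWA (S : D -> Prop) (g : nat) (u : A) := exists c c' : nat -> D,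
  [/\ forall i, S (c i), forall i, S (c' i) &
      u = \sum_(i < g.+1) iota (c i) * x ^+ i + \sum_(i < g.+1) iota (c' i) * y ^+ i].

Lemma bounded_GWA_subspace S g : subspace S -> subspace (bounded_GWA S g).
Proof.
move=> sS; split.
  exists (fun=> 0), (fun=> 0); split; try by case: sS.
  by rewrite !big1 ?addr0 // => i _; rewrite raddf0 mul0r.
move=> c _ _ [e [e' [Se Se' ->]]] [f [f' [Sf Sf' ->]]].
exists (fun i => c *: e i + f i), (fun i => c *: e' i + f' i).
split; try by move=> i; case: sS => _; apply.
rewrite scalerDr addrACA !scaler_sumr -!big_split /=.
by apply: eq_bigr => i _; rewrite !linearP !mulrDl !scalerAl.
Qed.

Lemma bounded_GWA_x (S : D -> Prop) g i d : subspace S -> S d -> (i <= g)%N ->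
  bounded_GWA S g (iota d * x ^+ i).
Proof.
move=> [S0 _] Sd ig; exists (fun l => if l == i then d else 0), (fun=> 0); split=> //.
  by move=> l; case: eqP.
rewrite [X in _ + X]big1 ?addr0; last by move=> l _; rewrite raddf0 mul0r.
rewrite (bigD1 (Ordinal (ig : (i < g.+1)%N))) //= eqxx big1 ?addr0 // => l ne.
by rewrite -val_eqE /= in ne; rewrite (negbTE ne) raddf0 mul0r.
Qed.

Lemma bounded_GWA_y (S : D -> Prop) g i d : subspace S -> S d -> (i <= g)%N ->
  bounded_GWA S g (iota d * y ^+ i).
Proof.
move=> [S0 _] Sd ig; exists (fun=> 0), (fun l => if l == i then d else 0); split=> //.
  by move=> l; case: eqP.
rewrite [X in X + _]big1 ?add0r; last by move=> l _; rewrite raddf0 mul0r.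
rewrite (bigD1 (Ordinal (ig : (i < g.+1)%N))) //= eqxx big1 ?addr0 // => l ne.
by rewrite -val_eqE /= in ne; rewrite (negbTE ne) raddf0 mul0r.
Qed.

Lemma bounded_GWA_min (S : D -> Prop) g (T : A -> Prop) u : subspace T ->
  (forall d i, S d -> (i <= g)%N -> T (iota d * x ^+ i)) ->
  (forall d i, S d -> (i <= g)%N -> T (iota d * y ^+ i)) -> bounded_GWA S g u -> T u.
Proof.
move=> sT Tx Ty [c [c' [Sc Sc' ->]]]; apply: subspaceD => //.
  by apply: subspace_sum => // i _; apply: Tx; rewrite // -ltnS.
by apply: subspace_sum => // i _; apply: Ty; rewrite // -ltnS.
Qed.

Lemma bounded_GWAW (S S' : D -> Prop) g g' u : subspace S' -> (forall d, S d -> S' d) ->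
  (g <= g')%N -> bounded_GWA S g u -> bounded_GWA S' g' u.
Proof.
move=> sS' SS gg; apply: bounded_GWA_min; first exact: bounded_GWA_subspace.
  by move=> d i Sd ig; apply: bounded_GWA_x; [|apply: SS|apply: leq_trans gg].
by move=> d i Sd ig; apply: bounded_GWA_y; [|apply: SS|apply: leq_trans gg].
Qed.

(** Normal forms are stable under left multiplication by D, x and y. The elements whose left
    multiplication preserves them form a subalgebra, which is therefore all of [A]; apply such an
    element to 1. *)
Lemma GWA_normal_form u : exists g, bounded_GWA (fun=> True) g u.
Proof.
have [tau [sK tK]] := inverse_automorphism.
have sT : subspace (fun _ : D => True) by [].
pose T u := exists g, bounded_GWA (fun=> True) g u.
have sTT : subspace T.
  split; first by exists 0%N; case: (bounded_GWA_subspace 0 sT).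
  move=> c v w [g gv] [g' gw]; exists (maxn g g').
  case: (bounded_GWA_subspace (maxn g g') sT) => _; apply.
    by apply: bounded_GWAW gv; rewrite ?leq_maxl.
  by apply: bounded_GWAW gw; rewrite ?leq_maxr.
have Tx d i : T (iota d * x ^+ i) by exists i; apply: bounded_GWA_x.
have Ty d i : T (iota d * y ^+ i) by exists i; apply: bounded_GWA_y.
have lift w : (forall d i, T (w * (iota d * x ^+ i))) ->
    (forall d i, T (w * (iota d * y ^+ i))) -> forall s, T s -> T (w * s).
  move=> wx wy s [g gs]; have := bounded_GWA_min (T := fun s => T (w * s)) _ _ _ gs.
  apply=> //; split; first by rewrite mulr0; case: sTT.
  by move=> c v v' Tv Tv'; rewrite mulrDr -scalerAr; case: sTT => _; apply.
case: (gwa) => [[r1 r2 r3 r4] _].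
suff all : forall u s, T s -> T (u * s).
  by rewrite -[u]mulr1; apply: all; have := Tx 1 0%N; rewrite rmorph1 mul1r.
apply: (GWA_generation _ _ _ _ gwa).
- move=> v w hv hw s Ts; rewrite mulrBl; apply: subspaceB; auto.
- by move=> v w hv hw s Ts; rewrite -mulrA; auto.
- by move=> c v hv s Ts; rewrite -scalerAl; apply: subspaceZ; auto.
- by move=> s; rewrite mul1r.
- by move=> d; apply: lift => e i; rewrite mulrA -rmorphM; [apply: Tx|apply: Ty].
- apply: lift => d i; rewrite mulrA r1 -mulrA -?exprS; first exact: Tx.
  case: i => [|i]; first by rewrite expr0 mulr1; have := Tx (sigma d) 1%N; rewrite expr1.
  by rewrite exprS [x * _]mulrA r4 mulrA -rmorphM; apply: Ty.
- apply: lift => d i; rewrite mulrA -(tK d) r2 -mulrA -?exprS; last exact: Ty.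
  case: i => [|i]; first by rewrite expr0 mulr1; have := Ty (tau d) 1%N; rewrite expr1.
  by rewrite exprS [y * _]mulrA r3 mulrA -rmorphM; apply: Tx.
Qed.

End GWA.

(** * Words in a finite family and their spans *)

Section Words.
Variables (k : fieldType) (B : algType k).
Implicit Types (vs l : seq B) (u v : B).

Lemma wordsP vs n v : reflect
  (exists l, [/\ size l = n, {subset l <= vs} & v = \prod_(w <- l) w]) (v \in words vs n).
Proof.
elim: n v => [|n IH] v.
  rewrite inE; apply: (iffP eqP) => [->|[l [/size0nil -> _ ->]]]; last by rewrite big_nil.
  by exists [::]; rewrite big_nil.
apply: (iffP allpairsP) => [[[u w] /= [uvs /IH [l [sl lvs ->]] ->]]|].
  exists (u :: l); rewrite big_cons /= sl; split=> // t; rewrite inE.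
  by case/predU1P => [->|/lvs].
case=> -[|u l] [] // [sl] lvs ->; exists (u, \prod_(w <- l) w); split; rewrite ?big_cons //=.
  by apply: lvs; rewrite mem_head.
by apply/IH; exists l; split=> // t tl; apply: lvs; rewrite inE tl orbT.
Qed.

Lemma words_uptoP vs n v : reflect
  (exists l, [/\ (size l <= n)%N, {subset l <= vs} & v = \prod_(w <- l) w])
  (v \in words_upto vs n).
Proof.
apply: (iffP flatten_mapP) => [[i]|[l [sl lvs ->]]].
  rewrite mem_iota add0n ltnS => ilt /wordsP [l [sl lvs ->]].
  by exists l; rewrite sl.
exists (size l); first by rewrite mem_iota add0n ltnS.
by apply/wordsP; exists l.
Qed.

Definition word_span vs n := in_span (words_upto vs n).

Lemma word_span_subspace vs n : subspace (word_span vs n).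
Proof. exact: in_span_subspace. Qed.

Lemma word_span_prod vs n l : {subset l <= vs} -> (size l <= n)%N ->
  word_span vs n (\prod_(w <- l) w).
Proof. by move=> lvs sl; apply/in_span_mem/words_uptoP; exists l. Qed.

Lemma word_span_mono vs n m u : (n <= m)%N -> word_span vs n u -> word_span vs m u.
Proof.
move=> nm; apply: in_span_sub => v /words_uptoP [l [sl lvs ->]].
by apply/words_uptoP; exists l; split=> //; apply: leq_trans nm.
Qed.

Lemma word_spanM vs n m u v :
  word_span vs n u -> word_span vs m v -> word_span vs (n + m) (u * v).
Proof.
move=> nu mv.
apply: (in_span_min (S := fun u => word_span vs (n + m) (u * v))) nu.
  split=> [|c w w' h h']; first by rewrite mul0r; case: (word_span_subspace vs (n + m)).
  by rewrite mulrDl -scalerAl; case: (word_span_subspace vs (n + m)) => _; apply.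
move=> w /words_uptoP [l [sl lvs ->]].
apply: (in_span_min (S := fun v => word_span vs (n + m) (\prod_(w <- l) w * v))) mv.
  split=> [|c s s' h h']; first by rewrite mulr0; case: (word_span_subspace vs (n + m)).
  by rewrite mulrDr -scalerAr; case: (word_span_subspace vs (n + m)) => _; apply.
move=> s /words_uptoP [l' [sl' lvs' ->]]; rewrite -big_cat; apply: word_span_prod.
  by move=> t; rewrite mem_cat => /orP [/lvs|/lvs'].
by rewrite size_cat leq_add.
Qed.

Lemma word_span1 vs n : word_span vs n 1.
Proof. by have := @word_span_prod vs n [::]; rewrite big_nil; apply. Qed.

Lemma word_span_gen vs u : in_span vs u -> word_span vs 1 u.
Proof.
apply: in_span_min; first exact: word_span_subspace.
move=> v vvs; have := @word_span_prod vs 1 [:: v]; rewrite big_seq1; apply=> // t.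
by rewrite inE => /eqP ->.
Qed.

Lemma word_spanX vs n u i : word_span vs n u -> word_span vs (i * n) (u ^+ i).
Proof.
move=> nu; elim: i => [|i IH]; first by rewrite expr0; apply: word_span1.
by rewrite exprS mulSn; apply: word_spanM.
Qed.

Lemma word_span_stable vs (f : {lrmorphism B -> B}) n u :
  (forall v, in_span vs v -> in_span vs (f v)) -> word_span vs n u -> word_span vs n (f u).
Proof.
move=> st; apply: (in_span_min (S := fun u => word_span vs n (f u))).
  split=> [|c w w' h h']; first by rewrite raddf0; case: (word_span_subspace vs n).
  by rewrite linearP; case: (word_span_subspace vs n) => _; apply.
move=> _ /words_uptoP [l [sl lvs ->]]; apply: (word_span_mono sl).
elim: l lvs {sl} => [|v l IH] lvs; first by rewrite big_nil rmorph1; apply: word_span1.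
rewrite big_cons rmorphM /= -add1n; apply: word_spanM.
  by apply/word_span_gen/st/in_span_mem/lvs; rewrite mem_head.
by apply: IH => t tl; apply: lvs; rewrite inE tl orbT.
Qed.

End Words.

(** * Upper bound for the growth of A *)

Section GWAUpperBound.
Variables (k : fieldType) (D A : algType k) (sigma : {lrmorphism D -> D}) (a : D).
Variables (iota : {lrmorphism D -> A}) (x y : A).
Hypothesis bij : is_alg_automorphism sigma.
Hypothesis ca : central a.
Hypothesis gwa : is_GWA sigma a iota x y.

Section Stable.
Variables (us : seq D) (tau : {lrmorphism D -> D}).
Hypotheses (sK : cancel sigma tau) (tK : cancel tau sigma).
Hypothesis us_a : in_span us a.
Hypothesis stab : forall u, in_span us u -> in_span us (sigma u).
Hypothesis stab' : forall u, in_span us u -> in_span us (tau u).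
Local Notation S n := (word_span us n).
Local Notation BG n g := (bounded_GWA iota x y (S n) g).

Let sS n : subspace (S n). Proof. exact: word_span_subspace. Qed.
Let sB n g : subspace (BG n g). Proof. exact: bounded_GWA_subspace. Qed.

Lemma iter_sigma n i u : S n u -> S n (iter i sigma u).
Proof. by move=> Su; elim: i => //= i IH; apply: word_span_stable. Qed.

Lemma iter_tau n i u : S n u -> S n (iter i tau u).
Proof. by move=> Su; elim: i => //= i IH; apply: word_span_stable. Qed.

Lemma bounded_left n m g d u : S n d -> BG m g u -> BG (n + m) g (iota d * u).
Proof.
move=> Sd; apply: (bounded_GWA_min (T := fun u => BG (n + m) g (iota d * u))).
- split=> [|c w w' h h']; first by rewrite mulr0; case: (sB (n + m) g).
  by rewrite mulrDr -scalerAr; case: (sB (n + m) g) => _; apply.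
- by move=> e i Se ig; rewrite mulrA -rmorphM; apply: bounded_GWA_x => //; apply: word_spanM.
- by move=> e i Se ig; rewrite mulrA -rmorphM; apply: bounded_GWA_y => //; apply: word_spanM.
Qed.

(** Each cancellation of an x against a y leaves a translate of [a], which lies in the stable span;
    at most [i] cancellations occur. *)
Lemma bounded_xy i l : BG i (i + l) (x ^+ i * y ^+ l).
Proof.
elim: i l => [|i IH] [|l].
- rewrite mulr1 -[_ ^+ _]mul1r -(rmorph1 iota); apply: bounded_GWA_x => //; exact: word_span1.
- rewrite expr0 mul1r -[_ ^+ _]mul1r -(rmorph1 iota); apply: bounded_GWA_y => //; exact: word_span1.
- rewrite mulr1 addn0 -[_ ^+ _]mul1r -(rmorph1 iota); apply: bounded_GWA_x => //; exact: word_span1.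
have [[r1 r2 r3 r4] _] := gwa.
rewrite exprSr exprS -mulrA [x * _]mulrA r4 mulrA (GWA_xd gwa) -mulrA -add1n.
apply: bounded_left; first exact/iter_sigma/word_span_gen/stab.
by apply: bounded_GWAW (IH l) => //; lia.
Qed.

Lemma bounded_yx i l : BG i (i + l) (y ^+ i * x ^+ l).
Proof.
elim: i l => [|i IH] [|l].
- rewrite mulr1 -[_ ^+ _]mul1r -(rmorph1 iota); apply: bounded_GWA_y => //; exact: word_span1.
- rewrite expr0 mul1r -[_ ^+ _]mul1r -(rmorph1 iota); apply: bounded_GWA_x => //; exact: word_span1.
- rewrite mulr1 addn0 -[_ ^+ _]mul1r -(rmorph1 iota); apply: bounded_GWA_y => //; exact: word_span1.
have [[r1 r2 r3 r4] _] := gwa.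
rewrite exprSr exprS -mulrA [y * _]mulrA r3 mulrA (GWA_yd gwa tK) -mulrA -add1n.
apply: bounded_left; first exact/iter_tau/word_span_gen.
by apply: bounded_GWAW (IH l) => //; lia.
Qed.

(** One unit of weight pays for the coefficient in [u], and [h] units for the translates of [a] left
    by at most [h] cancellations. *)
Lemma bounded_mul n h g u v : bounded_GWA iota x y (in_span us) h u -> BG n g v ->
  BG (h.+1 + n) (h + g) (u * v).
Proof.
move=> hu gv; set N := (_ + n)%N.
apply: (bounded_GWA_min (T := fun u => BG N (h + g) (u * v))) hu.
- split=> [|c w w' h1 h2]; first by rewrite mul0r; case: (sB N (h + g)).
  by rewrite mulrDl -scalerAl; case: (sB N (h + g)) => _; apply.
- move=> d i dU ih; have {}dU := word_span_gen dU.
  apply: (bounded_GWA_min (T := fun v => BG N (h + g) (iota d * x ^+ i * v))) gv.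
  + split=> [|c w w' h1 h2]; first by rewrite mulr0; case: (sB N (h + g)).
    by rewrite mulrDr -scalerAr; case: (sB N (h + g)) => _; apply.
  + move=> e l Se lg; rewrite -mulrA [x ^+ i * _]mulrA (GWA_xd gwa) -mulrA -exprD mulrA -rmorphM.
    apply: bounded_GWA_x => //; last by rewrite leq_add.
    apply: (@word_span_mono _ _ _ (1 + n)); first by rewrite /N; lia.
    by apply: word_spanM => //; apply: iter_sigma.
  + move=> e l Se lg; rewrite -mulrA [x ^+ i * _]mulrA (GWA_xd gwa) -mulrA mulrA -rmorphM.
    apply: (bounded_GWAW _ _ _ (bounded_left (word_spanM dU (iter_sigma i Se)) (bounded_xy i l))).
    * by [].
    * by move=> w; apply: word_span_mono; rewrite /N; lia.
    * by rewrite leq_add.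
- move=> d i dU ih; have {}dU := word_span_gen dU.
  apply: (bounded_GWA_min (T := fun v => BG N (h + g) (iota d * y ^+ i * v))) gv.
  + split=> [|c w w' h1 h2]; first by rewrite mulr0; case: (sB N (h + g)).
    by rewrite mulrDr -scalerAr; case: (sB N (h + g)) => _; apply.
  + move=> e l Se lg; rewrite -mulrA [y ^+ i * _]mulrA (GWA_yd gwa tK) -mulrA mulrA -rmorphM.
    apply: (bounded_GWAW _ _ _ (bounded_left (word_spanM dU (iter_tau i Se)) (bounded_yx i l))).
    * by [].
    * by move=> w; apply: word_span_mono; rewrite /N; lia.
    * by rewrite leq_add.
  + move=> e l Se lg; rewrite -mulrA [y ^+ i * _]mulrA (GWA_yd gwa tK) -mulrA -exprD mulrA -rmorphM.
    apply: bounded_GWA_y => //; last by rewrite leq_add.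
    apply: (@word_span_mono _ _ _ (1 + n)); first by rewrite /N; lia.
    by apply: word_spanM => //; apply: iter_tau.
Qed.

Lemma bounded_words (vs : seq A) h n :
  {in vs, forall v, bounded_GWA iota x y (in_span us) h v} ->
  (span_dim (words_upto vs n) <= (h * n).+1.*2 * span_dim (words_upto us (h.+1 * n)))%N.
Proof.
move=> hvs.
have [b [_ <- _ sb]] := span_dim_basis (words_upto us (h.+1 * n)).
pose L := [seq iota d * x ^+ i | d <- b, i <- seq.iota 0 (h * n).+1] ++
          [seq iota d * y ^+ i | d <- b, i <- seq.iota 0 (h * n).+1].
have <- : size L = ((h * n).+1.*2 * size b)%N.
  by rewrite size_cat !size_allpairs size_iota addnn mulnC -doubleMl.
apply: span_dim_le => v /words_uptoP [l [sl lvs ->]].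
have : BG (h.+1 * n) (h * n) (\prod_(w <- l) w).
  have h1 : BG (h.+1 * size l) (h * size l) (\prod_(w <- l) w).
    elim: l lvs {sl} => [|w l IH] lvs.
      rewrite big_nil !muln0.
      have -> : 1 = iota 1 * x ^+ 0 by rewrite rmorph1 mulr1.
      by apply: bounded_GWA_x => //; apply: word_span1.
    rewrite big_cons /= !mulnS; apply: bounded_mul; first by apply/hvs/lvs/mem_head.
    by apply: IH => t tl; apply: lvs; rewrite inE tl orbT.
  apply: bounded_GWAW h1; rewrite ?leq_mul2l ?sl ?orbT //.
  by move=> w; apply: word_span_mono; rewrite leq_mul2l sl orbT.
apply: bounded_GWA_min; first exact: in_span_subspace.
- move=> d i Sd ig; have {}Sd := in_span_trans sb Sd.
  apply: (in_span_min (S := fun d => in_span L (iota d * x ^+ i))) Sd.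
    split=> [|c w w' h1 h2]; first by rewrite raddf0 mul0r; case: (in_span_subspace L).
    by rewrite linearP mulrDl -scalerAl; case: (in_span_subspace L) => _; apply.
  move=> w wb; apply: in_span_mem; rewrite mem_cat; apply/orP; left.
  by apply/allpairsP; exists (w, i); rewrite mem_iota add0n.
- move=> d i Sd ig; have {}Sd := in_span_trans sb Sd.
  apply: (in_span_min (S := fun d => in_span L (iota d * y ^+ i))) Sd.
    split=> [|c w w' h1 h2]; first by rewrite raddf0 mul0r; case: (in_span_subspace L).
    by rewrite linearP mulrDl -scalerAl; case: (in_span_subspace L) => _; apply.
  move=> w wb; apply: in_span_mem; rewrite mem_cat; apply/orP; right.
  by apply/allpairsP; exists (w, i); rewrite mem_iota add0n.
Qed.

End Stable.

Definition growth_le (B : algType k) (e : nat) := forall vs : seq B,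
  exists C : nat, forall n, (span_dim (words_upto vs n) <= C * n.+1 ^ e)%N.

Lemma GWA_growth_le e : locally_algebraic sigma -> growth_le D e -> growth_le A e.+1.
Proof.
move=> la gD vs.
have [tau [sK tK]] := inverse_automorphism bij.
have [h [cs hvs]] : exists h (cs : seq D),
    {in vs, forall v, bounded_GWA iota x y (in_span cs) h v}.
  elim: vs => [|v vs [h [cs hvs]]]; first by exists 0%N, [::].
  have [g [c [c' [_ _ vE]]]] := GWA_normal_form bij gwa v.
  pose cs' := [seq c i | i <- seq.iota 0 g.+1] ++ [seq c' i | i <- seq.iota 0 g.+1].
  have sub1 u : in_span cs u -> in_span (cs' ++ cs) u.
    by apply: in_span_sub => w wcs; rewrite mem_cat wcs orbT.
  exists (maxn g h), (cs' ++ cs) => w; rewrite inE => /predU1P [->|/hvs]; last first.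
    by apply: bounded_GWAW => //; rewrite ?leq_maxr //; apply: in_span_subspace.
  apply: (@bounded_GWAW _ _ _ _ _ _ (in_span (cs' ++ cs)) _ g) => //.
  - exact: in_span_subspace.
  - by rewrite leq_maxl.
  have sB := bounded_GWA_subspace iota x y g (in_span_subspace (cs' ++ cs)).
  rewrite vE; apply: subspaceD => //; apply: subspace_sum => // i _.
    apply: bounded_GWA_x; [exact: in_span_subspace| |by rewrite -ltnS].
    apply: in_span_mem; rewrite !mem_cat; apply/orP; left; apply/orP; left.
    by apply/mapP; exists (nat_of_ord i); rewrite // mem_iota add0n ltn_ord.
  apply: bounded_GWA_y; [exact: in_span_subspace| |by rewrite -ltnS].
  apply: in_span_mem; rewrite !mem_cat; apply/orP; left; apply/orP; right.
  by apply/mapP; exists (nat_of_ord i); rewrite // mem_iota add0n ltn_ord.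
(* [a] is put among the vectors because its translates appear when x meets y. *)
have [us [usv [st1 st2]]] := la (a :: cs).
have {}hvs : {in vs, forall v, bounded_GWA iota x y (in_span us) h v}.
  move=> v /hvs; apply: bounded_GWAW => //; first exact: in_span_subspace.
  by move=> d; apply: in_span_trans => w wcs; apply: usv; rewrite inE wcs orbT.
have [C CP] := gD us.
exists (h.+1.*2 * (C * h.+1 ^ e))%N => n.
have us_a : in_span us a by apply: usv; rewrite mem_head.
have st' u : in_span us u -> in_span us (tau u).
  by move=> /st2 [u' [u'us <-]]; rewrite sK.
apply: leq_trans (bounded_words tK us_a st1 st' n hvs) _.
rewrite -!doubleMl leq_double expnS.
apply: leq_trans (leq_mul (leqnn _) (CP _)) _.
have -> : (h.+1 * (C * h.+1 ^ e) * (n.+1 * n.+1 ^ e) = h.+1 * n.+1 * (C * (h.+1 * n.+1) ^ e))%N.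
  by rewrite expnMn; ring.
apply: leq_mul; first by nia.
by rewrite leq_mul2l leq_expn_base ?orbT //; nia.
Qed.

End GWAUpperBound.

(** * Growth *)

Section NotLocallyAlgebraic.
Variables (k : fieldType) (D : algType k) (sigma : {lrmorphism D -> D}).
Hypothesis inj : injective sigma.

Definition orbit_list (vs : seq D) (n : nat) :=
  [seq iter i sigma v | i <- iota 0 n, v <- vs].

Lemma orbit_listP vs n u : reflect
  (exists i v, [/\ (i < n)%N, v \in vs & u = iter i sigma v]) (u \in orbit_list vs n).
Proof.
apply: (iffP allpairsP) => [[[i v] /= [ilt vvs ->]]|[i [v [ilt vvs ->]]]].
  by exists i, v; rewrite mem_iota add0n in ilt.
by exists (i, v); rewrite mem_iota add0n.
Qed.

(** An injective map of a finite-dimensional space into itself is onto, so local algebraicity only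
    fails through stability. *)
Lemma stable_span_surj (us : seq D) : (forall u, in_span us u -> in_span us (sigma u)) ->
  forall u, in_span us u -> exists u', in_span us u' /\ sigma u' = u.
Proof.
move=> st u usu; have [b [fb _ bus usb]] := span_dim_basis us.
have fsb : lin_free [seq sigma v | v <- b].
  move/lin_freeP: fb => fb; apply/lin_freeP => c; rewrite size_map => c0 i ilt.
  apply: fb => //; apply: inj; rewrite raddf0 -[RHS]c0 raddf_sum.
  by apply: eq_bigr => l _; rewrite /= linearZ (nth_map 0).
have : in_span [seq sigma v | v <- b] u.
  apply: contrapT => nu.
  suff: (size (u :: [seq sigma v | v <- b]) <= size b)%N by rewrite /= size_map ltnn.
  apply: steinitz; first exact/lin_free_cons.
  move=> v; rewrite inE => /predU1P [->|/mapP [w wb ->]].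
    exact: in_span_trans usu.
  by apply: in_span_trans usb _; apply/st/in_span_mem/bus.
apply: (in_span_min (S := fun u => exists u', in_span us u' /\ sigma u' = u)).
  split; first by exists 0; rewrite raddf0; split=> //; case: (in_span_subspace us).
  move=> c _ _ [v [vs <-]] [w [ws <-]]; exists (c *: v + w); rewrite linearP; split=> //.
  by case: (in_span_subspace us) => _; apply.
by move=> _ /mapP [w wb ->]; exists w; split=> //; apply/in_span_mem/bus.
Qed.

(** If at some stage n every sigma^n(v) fell into the span of the earlier translates, that span
    would be stable. So each stage supplies a new independent vector. *)
Lemma orbit_growth : ~ locally_algebraic sigma -> exists vs : seq D, forall n,
  exists s : seq D, [/\ lin_free s, size s = n & {subset s <= orbit_list vs n}].
Proof.
move=> nla; have [vs nvs] : exists vs : seq D, ~ exists us : seq D,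
    (forall v, v \in vs -> in_span us v) /\
    (forall u, in_span us u -> in_span us (sigma u)) /\
    (forall u, in_span us u -> exists u', in_span us u' /\ sigma u' = u).
  by apply: contrapT => h; apply: nla => vs; apply: contrapT => h'; apply: h; exists vs.
exists vs; have new n : exists2 v, v \in vs & ~ in_span (orbit_list vs n) (iter n sigma v).
  apply: contrapT => h; have {}h v : v \in vs -> in_span (orbit_list vs n) (iter n sigma v).
    by move=> vvs; apply: contrapT => nv; apply: h; exists v.
  have st u : in_span (orbit_list vs n) u -> in_span (orbit_list vs n) (sigma u).
    apply: (in_span_min (S := fun u => in_span (orbit_list vs n) (sigma u))).
      split; first by rewrite raddf0; case: (in_span_subspace (orbit_list vs n)).
      move=> c v w sv sw; rewrite linearP.
      by case: (in_span_subspace (orbit_list vs n)) => _; apply.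
    move=> _ /orbit_listP [i [v [ilt vvs ->]]]; move: ilt; rewrite leq_eqVlt.
    case/predU1P => [e|ilt]; first by rewrite -iterS e; apply: h.
    by apply/in_span_mem/orbit_listP; exists i.+1, v.
  apply: nvs; exists (orbit_list vs n); split; last first.
    by split=> //; apply: stable_span_surj.
  move=> v vvs; case: n h {st} => [|n] h; first exact: h.
  by apply/in_span_mem/orbit_listP; exists 0%N, v.
elim=> [|n [s [fs sz sub]]]; first by exists [::]; split=> //; apply: lin_free_nil.
have [v vvs nv] := new n; exists (iter n sigma v :: s); split.
- by apply/lin_free_cons; split=> // /(in_span_sub sub).
- by rewrite /= sz.
move=> u; rewrite inE => /predU1P [->|/sub /orbit_listP [i [w [ilt wvs ->]]]].
  by apply/orbit_listP; exists n, v.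
by apply/orbit_listP; exists i, w; split=> //; apply: ltnW.
Qed.

End NotLocallyAlgebraic.

(** The equation reads (q - q') (B' - B) = s' - s, where |B' - B| > h > |s' - s|. *)
Lemma spread_arith (q q' B B' s s' h : nat) : (s < h)%N -> (s' < h)%N ->
  (B' + h < B)%N \/ (B + h < B')%N ->
  (q * B' + q' * B + s = q' * B' + q * B + s')%N -> q = q'.
Proof.
have main (p p' C C' t t' : nat) : (t' < h)%N -> (C' + h < C)%N -> (p < p')%N ->
    (p * C' + p' * C + t = p' * C' + p * C + t')%N -> False.
  move=> th /subnK <- /subnK <-.
  set e := (C - _)%N; set f := (p' - _)%N => E.
  have : (h <= f.+1 * (e + h).+1)%N by nia.
  by nia.
move=> sh s'h [] lt E; case: (ltngtP q q') => // qq.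
- by case: (main q q' B B' s s').
- by case: (main q' q B B' s' s) => //; rewrite E.
- by case: (main q q' B' B s' s) => //; lia.
- by case: (main q' q B' B s s') => //; lia.
Qed.

Lemma prod_nseq (R : nzRingType) (u : R) n : \prod_(v <- nseq n u) v = u ^+ n.
Proof. by elim: n => [|n IH] /=; rewrite ?big_nil // big_cons IH exprS. Qed.

Section Monomials.
Variables (F : fieldType) (d : nat) (z : 'I_d -> F).
Local Notation M := (TranscendenceBases.monomial z).

Lemma monomialD b b' : M b * M b' = M (fun i => b i + b' i)%N.
Proof. by rewrite /M -big_split; apply: eq_bigr => i _; rewrite exprD. Qed.

Lemma monomialX b n : M b ^+ n = M (fun i => n * b i)%N.
Proof. by rewrite /M -prodrXl; apply: eq_bigr => i _; rewrite mulnC exprM. Qed.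

End Monomials.

(** * Many products with distinct values *)

Section Frame.
Variables (k : fieldType) (D : algType k) (F : fieldType) (kappa : {rmorphism k -> F}).
Variables (j : {rmorphism D -> F}) (d : nat) (z : 'I_d -> D) (O : F -> Prop).
Hypothesis j_inj : injective j.
Hypothesis jZ : forall c u, j (c *: u) = kappa c * j u.
Hypothesis vO : valuation_ring O.
Hypothesis Ok : forall c, O (kappa c).
Hypothesis residue : forall u, O u -> exists c, small O (u - kappa c).
Local Notation M := (TranscendenceBases.monomial (fun i => j (z i))).
Hypothesis mon_neq0 : forall b, M b != 0.
Hypothesis mon_sim : forall b b', sim O (M b) (M b') -> b =1 b'.
Implicit Types (u v w : D).

Lemma frame_comm u v : u * v = v * u.
Proof. by apply: j_inj; rewrite !rmorphM mulrC. Qed.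

Lemma not_sim_indep_family (J : finType) (f : J -> D) : (forall i, j (f i) != 0) ->
  (forall i l, sim O (j (f i)) (j (f l)) -> i = l) -> indep_family f.
Proof.
move=> nz ns c c0; apply: (not_sim_indep vO Ok nz ns).
rewrite -[RHS](rmorph0 j) -[in RHS]c0 rmorph_sum; apply: eq_bigr => i _; by rewrite /= jZ.
Qed.

Definition zmon (b : 'I_d -> nat) : D := \prod_(i < d) z i ^+ b i.

Lemma j_zmon b : j (zmon b) = M b.
Proof. by rewrite rmorph_prod; apply: eq_bigr => i _; rewrite rmorphXn. Qed.

Lemma box_indep m : indep_family (fun b : {ffun 'I_d -> 'I_m} => zmon (fun i => b i)).
Proof.
apply: not_sim_indep_family => [b|b b']; rewrite !j_zmon // => /mon_sim e.
by apply/ffunP => i; apply/val_inj/e.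
Qed.

Lemma zmon_word (B : algType k) (f : {rmorphism D -> B}) (W : seq B) m (b : 'I_d -> nat) :
  (forall i, f (z i) \in W) -> (forall i, b i <= m)%N -> word_span W (d * m) (f (zmon b)).
Proof.
move=> zW bm; have -> : (d * m = \sum_(i < d) m)%N by rewrite sum_nat_const card_ord.
rewrite rmorph_prod /=; elim/big_rec2: _ => [|i s u _ IH]; first exact: word_span1.
apply: word_spanM => //; rewrite rmorphXn /=; apply: (word_span_mono (bm i)).
by rewrite -[X in word_span _ X]muln1; apply/word_spanX/word_span_gen/in_span_mem.
Qed.

(** Monomials in a box need words of length d m; the factor [d.+1] stays positive when d = 0. *)
Lemma frame_growth_ge : exists W : seq D, forall m,
  (m ^ d <= span_dim (words_upto W (d.+1 * m)))%N.
Proof.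
exists (codom z) => m.
have -> : (m ^ d = #|{ffun 'I_d -> 'I_m}|)%N by rewrite card_ffun !card_ord.
apply: indep_family_span_dim (@box_indep m) _ => b.
apply: (@word_span_mono _ _ _ (d * m)); first by rewrite leq_mul2r leqnSn orbT.
apply: (@zmon_word D idfun) => i; first exact: codom_f.
exact: ltnW.
Qed.

Section Spread.
Variables (n : nat) (f : 'I_n -> D) (h m : nat).
Hypothesis f_neq0 : forall i, j (f i) != 0.
Hypothesis f_sim : forall i l, sim O (j (f i)) (j (f l)) -> i = l.
Hypothesis h_gt0 : (0 < h)%N.
Hypothesis hm : (h <= m)%N.
Hypothesis hn : (h * h.*2.+1 ^ d <= n)%N.

Definition spread_elt (e : D) := exists (l : seq D) (b : 'I_d -> nat),
  [/\ {subset l <= codom f}, (size l <= m)%N, forall i, (b i <= m)%N &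
      e = zmon b * \prod_(u <- l) u].

(** Equality of classes modulo the values of monomials. A monomial on each side avoids negative
    exponents. *)
Let apx i l := exists b b', sim O (j (f i) * M b) (j (f l) * M b').

Let apx_sym i l : apx i l -> apx l i.
Proof. by move=> [b [b' s]]; exists b', b; apply: sim_sym. Qed.

Let nzM i b : j (f i) * M b != 0. Proof. by rewrite mulf_neq0. Qed.

Let apx_trans l i q : apx i l -> apx l q -> apx i q.
Proof.
move=> [b [b' s]] [c [c' s']]; exists (fun i => b i + c i)%N, (fun i => b' i + c' i)%N.
rewrite -!monomialD; apply: (sim_trans vO (v := j (f l) * M b' * M c)).
- by rewrite mulf_neq0.
- by rewrite mulrA; apply: simM => //; apply: sim_refl.
- rewrite mulrAC [M b' * _]mulrC mulrA; apply: simM => //; exact: sim_refl.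
Qed.

Let apx_refl i : apx i i.
Proof. by exists (fun=> 0%N), (fun=> 0%N); apply: sim_refl. Qed.

(** A canonical representative: [pick] depends only on the predicate, hence only on the class, so
    [codom r] counts the classes. *)
Let r i := odflt i [pick l | `[< apx i l >]].

Let rP i : apx i (r i).
Proof. by rewrite /r; case: pickP => [l /asboolP|_]. Qed.

Let r_eq i l : apx i l -> r i = r l.
Proof.
move=> il; rewrite /r.
have e : (fun q => `[< apx i q >]) =1 (fun q => `[< apx l q >]).
  by move=> q; apply/asboolP/asboolP; apply: apx_trans; [apply: apx_sym|].
rewrite (eq_pick e); case: pickP => // /(_ l) /asboolP []; exact: apx_refl.
Qed.

(** One representative per class, times all monomials of a box: the class determines the
    representative, and cancelling it determines the monomial. *)
Lemma spread_many_classes : (h <= #|codom r|)%N ->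
  exists (J : finType) (e : J -> D), [/\ (h * m ^ d <= #|J|)%N, forall i, spread_elt (e i),
    forall i, j (e i) != 0 & forall i l, sim O (j (e i)) (j (e l)) -> i = l].
Proof.
move=> hr; exists ({i : 'I_n | i \in codom r} * {ffun 'I_d -> 'I_m})%type.
exists (fun x : {i : 'I_n | i \in codom r} * {ffun 'I_d -> 'I_m} =>
  f (val x.1) * zmon (fun i => x.2 i)); split.
- by rewrite card_prod card_sig card_ffun !card_ord leq_mul2r hr orbT.
- move=> [i b] /=; exists [:: f (sval i)], (fun t => nat_of_ord (b t)); split=> //=.
  + by move=> u; rewrite inE => /eqP ->; apply: codom_f.
  + by apply: leq_trans hm.
  + by move=> t; apply: ltnW.
  + by rewrite big_seq1 frame_comm.
- by move=> [i b]; rewrite rmorphM j_zmon.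
move=> [i b] [i' b']; rewrite /= !rmorphM !j_zmon => s.
have fixr (q : {i : 'I_n | i \in codom r}) : r (val q) = val q.
  by case: q => q /= /codomP [q0 qE]; rewrite [in RHS]qE; apply/esym/r_eq; rewrite qE.
have ii' : i = i'.
  apply: val_inj; rewrite -fixr -[RHS]fixr; apply: r_eq.
  by exists (fun t => nat_of_ord (b t)), (fun t => nat_of_ord (b' t)).
congr (_, _) => //; apply/ffunP => t; apply: val_inj.
rewrite ii' mulrC [X in sim _ _ X]mulrC in s.
exact: (mon_sim (sim_cancel (f_neq0 (val i')) s)).
Qed.

(** With few classes, some element and its representative differ by a large exponent in one
    coordinate; the powers of this difference spread out the values. *)
Lemma spread_one_class : (#|codom r| < h)%N ->
  exists (J : finType) (e : J -> D), [/\ (h * m ^ d <= #|J|)%N, forall i, spread_elt (e i),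
    forall i, j (e i) != 0 & forall i l, sim O (j (e i)) (j (e l)) -> i = l].
Proof.
move=> hr; have /choice [b /choice [b' bP]] := rP.
have [i [t it]] : exists i t, (b' i t + h < b i t)%N \/ (b i t + h < b' i t)%N.
  apply: contrapT => nit.
  have bd i t : (b i t <= b' i t + h)%N /\ (b' i t <= b i t + h)%N.
    by split; rewrite leqNgt; apply/negP => lt; apply: nit; exists i, t; [left|right].
  (* Pigeonhole: class and exponent difference determine the value. Differences in [-h, h] are
     shifted by h to become naturals at most 2h, giving fewer than h (2h+1)^d possibilities. *)
  pose phi i : {i | i \in codom r} * {ffun 'I_d -> 'I_(h.*2.+1)} :=
    (exist _ (r i) (codom_f r i), [ffun t => inord (b i t + h - b' i t)]).
  have phi_inj : injective phi.
    move=> i l [] ril /ffunP e; apply: f_sim.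
    have {}e t : (b i t + b' l t = b l t + b' i t)%N.
      have := congr1 (@nat_of_ord _) (e t).
      have [b1 b2] := bd i t; have [b3 b4] := bd l t.
      by rewrite !ffunE !inordK ?ltnS; lia.
    apply: (sim_cancel (w := M (fun t => b i t + b' l t)%N)) => //.
    rewrite -monomialD mulrA.
    apply: (sim_trans vO (v := j (f (r i)) * M (b' i) * M (b' l))).
    - by rewrite mulf_neq0.
    - by apply: simM => //; apply: sim_refl.
    - have -> : M (b i) * M (b' l) = M (b l) * M (b' i).
        by rewrite !monomialD; apply: eq_bigr => q _; rewrite e.
      rewrite ril mulrAC mulrA; apply: (simM vO); last exact: sim_refl.
      exact: sim_sym (bP l).
  have := leq_card phi phi_inj; rewrite card_prod card_sig card_ffun !card_ord => le.
  have : (n < h * h.*2.+1 ^ d)%N.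
    by apply: leq_ltn_trans le _; rewrite ltn_mul2r hr andbT expn_gt0.
  by rewrite ltnNge hn.
pose u := f i; pose w := f (r i); pose B := b i; pose B' := b' i.
have uw : sim O (j u * M B) (j w * M B') by apply: bP.
have {}it : (B' t + h < B t)%N \/ (B t + h < B' t)%N by [].
have ju : j u != 0 by apply: f_neq0.
have jw : j w != 0 by apply: f_neq0.
(* In coordinate [t] the box exponent serves as the power q of [u], and the monomial carries the
   remainder [x.1] below h there instead. *)
pose ex (x : 'I_h * {ffun 'I_d -> 'I_m}) (q : 'I_d) : nat :=
  if q == t then x.1 : nat else x.2 q.
exists ('I_h * {ffun 'I_d -> 'I_m})%type.
exists (fun x : 'I_h * {ffun 'I_d -> 'I_m} =>
  u ^+ (x.2 t) * w ^+ (m - x.2 t) * zmon (ex x)); split.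
- by rewrite card_prod card_ffun !card_ord.
- move=> x; exists (nseq (x.2 t) u ++ nseq (m - x.2 t) w), (ex x); split.
  + by move=> v; rewrite mem_cat !mem_nseq => /orP [] /andP [_ /eqP ->]; apply: codom_f.
  + by rewrite size_cat !size_nseq subnKC // ltnW.
  + move=> q; rewrite /ex; case: eqP => _; last exact: ltnW.
    by apply: leq_trans hm; apply: ltnW.
  + by rewrite frame_comm big_cat !prod_nseq.
- by move=> x; rewrite !rmorphM !rmorphXn j_zmon !mulf_neq0 // expf_neq0.
(* Multiplying by M B^q M B^q', a factor symmetric in the two elements compared, trades each power
   of [u] for one of [w]. Both elements then become w^m times a monomial, and [mon_sim] compares
   exponents. *)
have red (x x' : 'I_h * {ffun 'I_d -> 'I_m}) :
    sim O (j (u ^+ (x.2 t) * w ^+ (m - x.2 t) * zmon (ex x)) * (M B ^+ (x.2 t) * M B ^+ (x'.2 t)))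
      (j w ^+ m * (M B' ^+ (x.2 t) * M B ^+ (x'.2 t) * M (ex x))).
  rewrite !rmorphM !rmorphXn /= j_zmon.
  set q : nat := x.2 t; set q' : nat := x'.2 t.
  have -> : j u ^+ q * j w ^+ (m - q) * M (ex x) * (M B ^+ q * M B ^+ q') =
      (j u * M B) ^+ q * (j w ^+ (m - q) * M B ^+ q' * M (ex x)) by rewrite exprMn; ring.
  have -> : j w ^+ m * (M B' ^+ q * M B ^+ q' * M (ex x)) =
      (j w * M B') ^+ q * (j w ^+ (m - q) * M B ^+ q' * M (ex x)).
    have qm : (q <= m)%N by apply/ltnW/ltn_ord.
    have -> : j w ^+ m = j w ^+ q * j w ^+ (m - q) by rewrite -exprD subnKC.
    by rewrite exprMn; ring.
  apply: (simM vO); first exact: (simX vO).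
  by apply: (sim_refl vO); rewrite !mulf_neq0 // expf_neq0.
move=> x x' s; set q : nat := x.2 t; set q' : nat := x'.2 t.
have E : (fun p => q * B' p + q' * B p + ex x p)%N =1
         (fun p => q' * B' p + q * B p + ex x' p)%N.
  apply: mon_sim; rewrite -!monomialD -!monomialX.
  apply: (sim_cancel (w := j w ^+ m)); first by rewrite expf_neq0.
  rewrite mulrC [X in sim _ _ X]mulrC.
  have nz (y : 'I_h * {ffun 'I_d -> 'I_m}) : j (u ^+ (y.2 t) * w ^+ (m - y.2 t) * zmon (ex y)) *
      (M B ^+ (x.2 t) * M B ^+ (x'.2 t)) != 0.
    by rewrite !rmorphM !rmorphXn j_zmon !mulf_neq0 // expf_neq0.
  apply: (sim_trans vO (nz x) (sim_sym (red x x'))).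
  apply: (sim_trans vO (nz x')).
    by apply: (simM vO) => //; apply: (sim_refl vO); rewrite mulf_neq0 // expf_neq0.
  by have := red x' x; rewrite [M B ^+ (x'.2 t) * M B ^+ _]mulrC.
have Et := E t; rewrite /ex eqxx in Et.
have x1 : (x.1 < h)%N by []. have x1' : (x'.1 < h)%N by [].
have qq : q = q' := spread_arith x1 x1' it Et.
have ss : x.1 = x'.1 by apply: val_inj => /=; rewrite qq in Et; lia.
case: x x' @q @q' E qq ss {s Et x1 x1'} => [s c] [s' c'] /= E qq ->; congr (_, _).
apply/ffunP => p; apply: val_inj; have [->|pt] := eqVneq p t; first exact: qq.
by have := E p; rewrite /ex (negbTE pt) qq /=; lia.
Qed.

Theorem spread : exists (J : finType) (e : J -> D), [/\ (h * m ^ d <= #|J|)%N,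
  forall i, spread_elt (e i), forall i, j (e i) != 0 &
  forall i l, sim O (j (e i)) (j (e l)) -> i = l].
Proof.
by have [/spread_many_classes|/spread_one_class] := leqP h #|codom r|.
Qed.

End Spread.
End Frame.

Section FrameUpperBound.
Variables (k : fieldType) (D : algType k) (F : fieldType) (kappa : {rmorphism k -> F}).
Variables (j : {rmorphism D -> F}) (d : nat).
Hypothesis j_inj : injective j.
Hypothesis jZ : forall c u, j (c *: u) = kappa c * j u.

(** The spanning family lives in [F], since its elements carry denominators that [D] may not
    contain. *)
Lemma steinitz_image (t : seq D) (J : finType) (g : J -> F) : lin_free t ->
  {in t, forall v, exists c : J -> k, j v = \sum_i kappa (c i) * g i} ->
  (size t <= #|J|)%N.
Proof.
move=> /lin_freeP fr sub; rewrite leqNgt; apply/negP => lt_st.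
have /choice [f fP] : forall i : 'I_(size t), exists c : J -> k,
    j t`_i = \sum_l kappa (c l) * g l.
  by move=> i; apply: sub; rewrite mem_nth.
pose M := \matrix_(i < size t, l < #|J|) f i (enum_val l).
have : kermx M != 0.
  by rewrite kermx_eq0 /row_free neq_ltn (leq_ltn_trans (rank_leq_col _)).
case/rowV0Pn => r /sub_kermxP rM r0.
have [c cE] := ext_ord (fun i => r 0 i).
case/negP: r0; apply/eqP/rowP => i; rewrite mxE -cE; apply: fr => //.
apply: j_inj; rewrite rmorph0 rmorph_sum.
transitivity (\sum_l kappa ((r *m M) 0 (enum_rank l)) * g l); last first.
  by apply: big1 => l _; rewrite rM mxE rmorph0 mul0r.
under eq_bigr do rewrite /= jZ fP mulr_sumr.
rewrite exchange_big; apply: eq_bigr => l _ /=.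
rewrite mxE rmorph_sum mulr_suml; apply: eq_bigr => q _.
by rewrite /= mulrA -rmorphM cE mxE enum_rankK.
Qed.

Lemma frame_growth_le : (forall us : seq D, exists C : nat, forall N : nat,
    exists (J : finType) (g : J -> F), (#|J| <= C * N.+1 ^ d)%N /\
    forall l : seq F, {subset l <= [seq j u | u <- us]} -> (size l <= N)%N ->
      exists c : J -> k, \prod_(v <- l) v = \sum_i kappa (c i) * g i) ->
  growth_le D d.
Proof.
move=> gr us; have [C CP] := gr us; exists C => N.
have [J [g [gJ gP]]] := CP N; apply: leq_trans gJ.
have [b [fb <- bs _]] := span_dim_basis (words_upto us N).
apply: (@steinitz_image _ _ g) => // v /bs /words_uptoP [l [sl lus ->]].
have [||c cE] := gP [seq j u | u <- l]; last by exists c; rewrite rmorph_prod -cE big_map.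
- by move=> _ /mapP [u ul ->]; apply/map_f/lus.
- by rewrite size_map.
Qed.

End FrameUpperBound.

(** * Lower bounds for the growth of A *)

Section GWALowerBound.
Variables (k : fieldType) (D : algType k) (F : fieldType) (kappa : {rmorphism k -> F}).
Variables (j : {rmorphism D -> F}) (d : nat) (z : 'I_d -> D) (O : F -> Prop).
Hypothesis j_inj : injective j.
Hypothesis jZ : forall c u, j (c *: u) = kappa c * j u.
Hypothesis vO : valuation_ring O.
Hypothesis Ok : forall c, O (kappa c).
Hypothesis residue : forall u, O u -> exists c, small O (u - kappa c).
Local Notation M := (TranscendenceBases.monomial (fun i => j (z i))).
Hypothesis mon_neq0 : forall b, M b != 0.
Hypothesis mon_sim : forall b b', sim O (M b) (M b') -> b =1 b'.
Variables (A : algType k) (sigma : {lrmorphism D -> D}) (a : D).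
Variables (iota : {lrmorphism D -> A}) (x y : A).
Hypothesis bij : is_alg_automorphism sigma.
Hypothesis ca : central a.
Hypothesis gwa : is_GWA sigma a iota x y.

Section OrbitWords.
Variables (vs : seq D) (W : seq A).
Hypothesis xW : x \in W.
Hypothesis vsW : {in vs, forall v, iota v \in W}.

Lemma word_mem (w : A) : w \in W -> word_span W 1 w.
Proof. by move=> wW; apply/word_span_gen/in_span_mem. Qed.

Lemma word_xX n : word_span W n (x ^+ n).
Proof. by rewrite -[n in word_span _ n]muln1; apply/word_spanX/word_mem. Qed.

(* Commuting the factors with a zero shift to the front leaves a word in which every
   remaining shift can be lowered by one letter [x]. *)
Lemma orbit_monomial_word n (p : seq (nat * D)) e :
  {in p, forall q, (q.1 <= n)%N /\ q.2 \in vs} ->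
  j e = \prod_(q <- p) j (iter q.1 sigma q.2) ->
  word_span W (n + size p) (iota e * x ^+ n).
Proof.
have flat l : {subset l <= vs} -> word_span W (size l) (iota (\prod_(v <- l) v)).
  move=> lvs; rewrite rmorph_prod /= -(big_map iota xpredT id).
  apply: word_span_prod; last by rewrite size_map.
  by move=> _ /mapP [v vl ->]; apply/vsW/lvs.
elim: n p e => [|n IH] p e hp je.
  have -> : e = \prod_(v <- [seq q.2 | q <- p]) v.
    apply: j_inj; rewrite rmorph_prod big_map je !big_seq; apply: eq_bigr => q /hp [].
    by rewrite leqn0 => /eqP ->.
  rewrite expr0 mulr1 add0n -(size_map snd); apply: flat.
  by move=> _ /mapP [q /hp [_ qvs] ->].
pose e0 := \prod_(v <- [seq q.2 | q <- p & q.1 == 0%N]) v.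
pose p1 := [seq (q.1.-1, q.2) | q <- p & q.1 != 0%N].
pose e1 := \prod_(q <- p1) iter q.1 sigma q.2.
have -> : e = e0 * sigma e1.
  apply: j_inj; rewrite je rmorphM (bigID (fun q => q.1 == 0%N)) /=; congr (_ * _).
    rewrite rmorph_prod big_map big_filter; apply: eq_bigr => q /eqP ->.
    by [].
  rewrite !rmorph_prod big_map big_filter; apply: eq_bigr => -[[|i] v] //= _.
(* Moving one x to the left of sigma(e1) undoes sigma on all remaining factors at once, at the price
   of a single letter. *)
have [[r1 _ _ _] _] := gwa.
rewrite rmorphM exprS -mulrA [iota (sigma _) * _]mulrA -r1.
have -> : (n.+1 + size p = size [seq q.2 | q <- p & q.1 == 0%N] + (1 + (n + size p1)))%N.
  rewrite !size_map -[in LHS](count_predC (fun q => q.1 == 0%N) p) !size_filter.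
  exact: addnCA.
apply: word_spanM.
  by apply: flat => v /mapP [q]; rewrite mem_filter => /andP [_ /hp [_ qvs]] ->.
rewrite -mulrA; apply: word_spanM; first exact: word_mem.
apply: IH; last by rewrite rmorph_prod.
move=> t /mapP [q]; rewrite mem_filter => /andP [q0 /hp [qn qvs]] -> /=; split=> //.
by rewrite -ltnS prednK // lt0n.
Qed.

(** Multilinear expansion: [p] collects the orbit elements already chosen for factors removed from
    [l]. Equations are tested through [j], where factors commute. *)
Lemma orbit_span_word n (l : seq D) (p : seq (nat * D)) e :
  {in p, forall q, (q.1 <= n)%N /\ q.2 \in vs} ->
  {in l, forall u, in_span (orbit_list sigma vs n) u} ->
  j e = \prod_(u <- l) j u * \prod_(q <- p) j (iter q.1 sigma q.2) ->
  word_span W (n + (size l + size p)) (iota e * x ^+ n).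
Proof.
elim: l p e => [|u l IH] p e hp hl je.
  by apply: orbit_monomial_word; rewrite // je big_nil mul1r.
pose e' := \prod_(u <- l) u * \prod_(q <- p) iter q.1 sigma q.2.
have -> : e = u * e'.
  by apply: j_inj; rewrite je big_cons !rmorphM !rmorph_prod mulrA.
set N := (n + _)%N.
apply: (in_span_min (S := fun u => word_span W N (iota (u * e') * x ^+ n)))
  (hl u (mem_head _ _)).
  have [w0 wL] := word_span_subspace W N; split=> [|c v w hv hw].
    by rewrite mul0r rmorph0 mul0r.
  by rewrite mulrDl -scalerAl linearP mulrDl -scalerAl; apply: wL.
move=> _ /orbit_listP [i [v [ilt vvs ->]]].
have -> : N = (n + (size l + size ((i, v) :: p)))%N by rewrite /N /= addSnnS.
apply: IH.
- move=> q; rewrite inE => /predU1P [->|/hp//]; split=> //; exact: ltnW.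
- by move=> w wl; apply: hl; rewrite inE wl orbT.
- by rewrite !rmorphM !rmorph_prod big_cons /= mulrCA.
Qed.

End OrbitWords.

Lemma GWA_growth_ge : exists W : seq A, forall m,
  (m ^ d.+1 <= span_dim (words_upto W (d.+1 * m)))%N.
Proof.
pose W := x :: [seq iota (z i) | i <- enum 'I_d].
exists W => m.
have -> : (m ^ d.+1 = #|{: {ffun 'I_d -> 'I_m} * 'I_m}|)%N.
  by rewrite card_prod card_ffun !card_ord expnSr.
have ib := box_indep jZ vO Ok mon_neq0 mon_sim (m := m).
have ind := GWA_indep bij ca gwa (s := 0) (L := m) ib.
apply: (indep_family_span_dim ind).
move=> [b l] /=; rewrite mulSn addnC; apply: word_spanM.
  apply: zmon_word => i; last exact: ltnW.
  by rewrite inE; apply/orP; right; apply/mapP; exists i; rewrite ?mem_enum.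
apply: (@word_span_mono _ _ _ l); first exact: ltnW.
by apply: word_xX; rewrite mem_head.
Qed.

Definition spread_size (h : nat) := (h * h.*2.+1 ^ d)%N.

Theorem GWA_growth_big : ~ locally_algebraic sigma -> exists W : seq A,
  forall h, (0 < h)%N -> (h * spread_size h ^ d.+1 <=
    span_dim (words_upto W ((d + 3) * spread_size h)))%N.
Proof.
move=> nla; have [vs vsP] := orbit_growth (bij_inj bij) nla.
pose W := x :: [seq iota v | v <- vs] ++ [seq iota (z i) | i <- enum 'I_d].
have zW i : iota (z i) \in W.
  rewrite inE mem_cat; apply/orP; right; apply/orP; right.
  by apply/mapP; exists i; rewrite ?mem_enum.
have vsW : {in vs, forall v, iota v \in W}.
  by move=> v vvs; rewrite inE mem_cat map_f // orbT.
have xW : x \in W by rewrite mem_head.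
exists W => h h0; set n := spread_size h.
have hn : (h <= n)%N by rewrite /n /spread_size leq_pmulr // expn_gt0.
have [s [fs sz sub]] := vsP n.
have [f [fU f0 fns]] := not_sim_family vO Ok residue (j := j) j_inj jZ
  (in_span_subspace (orbit_list sigma vs n)) fs (fun u us => in_span_mem (sub u us)) sz.
have [J [e [cJ eP e0 ens]]] := spread (z := z) j_inj vO mon_neq0 mon_sim f0 fns h0 hn (leqnn n).
have ind := GWA_indep bij ca gwa (s := n) (L := n) (not_sim_indep_family jZ vO Ok e0 ens).
rewrite expnS mulnCA mulnC; apply: (@leq_trans (#|J| * n)); first by rewrite leq_mul2r cJ orbT.
have -> : (#|J| * n = #|{: J * 'I_n}|)%N by rewrite card_prod card_ord.
apply: (indep_family_span_dim ind) => -[i l] /=.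
have [q [b [qf sq bn ->]]] := eP i.
(* Letters: d n for the monomial, n + n for a product of at most n elements of U_n together with
   x^n, and n for the further power of x. *)
have -> : ((d + 3) * n = d * n + ((n + (n + 0)) + n))%N by lia.
rewrite rmorphM -mulrA exprD; apply: word_spanM; first exact: zmon_word.
rewrite mulrA; apply: word_spanM; last first.
  by apply: (@word_span_mono _ _ _ l); [apply: ltnW|apply: word_xX].
apply: (@word_span_mono _ _ _ (n + (size q + 0))); first by rewrite leq_add2l leq_add2r.
apply: (orbit_span_word xW vsW (p := [::])) => //.
  by move=> u /qf /codomP [t ->]; apply: fU.
by rewrite rmorph_prod big_nil mulr1.
Qed.

End GWALowerBound.

(** * Locally algebraic automorphisms of fields *)

Section LocallyAlgebraicField.
Variables (k F : fieldType) (kappa : {rmorphism k -> F}) (s : {rmorphism F -> F}).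
Hypothesis s_const : forall c, s (kappa c) = kappa c.
Hypothesis spl : TranscendenceBases.splits_over k.
(** Local algebraicity at u. The exponents [g] are free, so that orbits of powers of [s] can be used
    as well. *)
Hypothesis fd : forall u : F, exists n, forall g : nat -> nat, exists c : nat -> k,
  (exists2 i, (i <= n)%N & c i != 0) /\ \sum_(i < n.+1) kappa (c i) * iter (g i) s u = 0.

Lemma not_const_transcendental e (p : {poly k}) : (forall c, e <> kappa c) -> p != 0 ->
  (map_poly kappa p).[e] != 0.
Proof.
move=> ne p0; have [r ->] := spl p; set l := lead_coef p.
have l0 : l != 0 by rewrite lead_coef_eq0.
rewrite map_polyZ hornerZ mulf_neq0 ?fmorph_eq0 //.
elim: r => [|x r IH]; first by rewrite big_nil rmorph1 hornerC oner_eq0.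
rewrite big_cons rmorphM /= hornerM rmorphB /= map_polyX map_polyC /= hornerXsubC.
by rewrite mulf_neq0 // subr_eq0; apply/eqP.
Qed.

(** Clearing denominators gives a polynomial relation for e, which is transcendental because k is
    algebraically closed. So the polynomial vanishes, and its value at c_i isolates b_i. *)
Lemma simple_fractions_indep e n (b c : 'I_n -> k) : (forall c, e <> kappa c) ->
  injective c -> \sum_i kappa (b i) / (e - kappa (c i)) = 0 -> forall i, b i = 0.
Proof.
move=> ne c_inj b0 i0; apply/eqP; apply: contraT => bi0.
have ec l : e - kappa (c l) != 0 by rewrite subr_eq0; apply/eqP.
pose Q := \sum_i b i *: \prod_(l | l != i) ('X - (c l)%:P).
have Q0 : Q != 0.
  apply: contraNneq bi0 => Q0; have := congr1 (fun P : {poly k} => P.[c i0]) Q0.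
  rewrite horner0 horner_sum (bigD1 i0) //= [X in _ + X = _]big1 => [|i ne0].
    rewrite addr0 hornerZ horner_prod => /eqP; rewrite mulf_eq0 => /orP [//|].
    move/prodf_eq0 => [l li0]; rewrite hornerXsubC subr_eq0 => /eqP /c_inj e'.
    by rewrite e' eqxx in li0.
  rewrite hornerZ horner_prod (bigD1 i0) ?(eq_sym i0) //=.
  by rewrite hornerXsubC subrr mul0r mulr0.
case/negP: (not_const_transcendental ne Q0); apply/eqP.
rewrite rmorph_sum horner_sum /=.
transitivity ((\prod_l (e - kappa (c l))) * \sum_i kappa (b i) / (e - kappa (c i))).
  rewrite mulr_sumr; apply: eq_bigr => i _.
  rewrite map_polyZ hornerZ rmorph_prod horner_prod [X in _ = X * _](bigD1 i) //=.
  rewrite [RHS]mulrC mulrA divfK //; congr (_ * _); apply: eq_bigr => l _.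
  by rewrite rmorphB /= map_polyX map_polyC /= hornerXsubC.
by rewrite b0 mulr0.
Qed.

Lemma simple_fraction_orbit e f (g : nat -> nat) (mu c : nat -> k) :
  (forall c, e <> kappa c) -> injective c -> (forall i, mu i != 0) ->
  (forall i, iter (g i) s f = kappa (mu i) / (e - kappa (c i))) -> False.
Proof.
move=> ne c_inj mu0 fE; have [n /(_ g) [b [[i0 i0n bi0] b0]]] := fd f.
have := @simple_fractions_indep e n.+1 (fun i => b i * mu i) (fun i => c i) ne.
move=> h; case/negP: bi0; have /h h' : injective (fun i : 'I_n.+1 => c i).
  by move=> i l /c_inj; apply: val_inj.
have /h' /(_ (Ordinal (i0n : (i0 < n.+1)%N))) /eqP /=: \sum_(i < n.+1)
    kappa (b i * mu i) / (e - kappa (c i)) = 0.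
  by rewrite -[RHS]b0; apply: eq_bigr => i _; rewrite fE rmorphM mulrA.
by rewrite mulf_eq0 (negbTE (mu0 _)) orbF.
Qed.

Lemma iter_const i c : iter i s (kappa c) = kappa c.
Proof. by elim: i => //= i ->. Qed.

Lemma iter_rmorphM i u v : iter i s (u * v) = iter i s u * iter i s v.
Proof. by elim: i => //= i ->; rewrite rmorphM. Qed.

Lemma iter_fmorphV i u : iter i s u^-1 = (iter i s u)^-1.
Proof. by elim: i => //= i ->; rewrite fmorphV. Qed.

Lemma iter_rmorphD i u v : iter i s (u + v) = iter i s u + iter i s v.
Proof. by elim: i => //= i ->; rewrite rmorphD. Qed.

Lemma iter_rmorph0 i : iter i s 0 = 0.
Proof. by elim: i => //= i ->; rewrite rmorph0. Qed.

(** The iterates of 1/(e - 1) are lam^-i / (e - lam^-i); if [lam] is not a root of unity, their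
    poles are distinct. *)
Lemma eigenvalue_root_of_unity e lam : e != 0 -> s e = kappa lam * e ->
  exists2 M, (0 < M)%N & lam ^+ M = 1.
Proof.
move=> e0 se; have [[c ec]|ne] := pselect (exists c, e = kappa c).
  exists 1%N => //; apply: (fmorph_inj kappa); rewrite expr1 rmorph1.
  by apply: (mulIf e0); rewrite -se mul1r ec s_const.
have {}ne c : e <> kappa c by move=> ec; apply: ne; exists c.
apply: contrapT => nM.
have lam0 : lam != 0.
  apply: contraNneq e0 => l0; rewrite -(fmorph_eq0 s) se l0 rmorph0.
  by rewrite mul0r.
have se_i i : iter i s e = kappa (lam ^+ i) * e.
  elim: i => [|i IH]; first by rewrite rmorph1 mul1r.
  by rewrite iterSr se iter_rmorphM iter_const IH mulrA -rmorphM exprS.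
have inj i l : lam ^+ i = lam ^+ l -> i = l.
  wlog il : i l / (i <= l)%N.
    by move=> W; case/orP: (leq_total i l) => il E; [apply: W|apply/esym/W].
  move=> E; apply: contrapT => nil; apply: nM; exists (l - i)%N; first by lia.
  by apply: (mulfI (_ : lam ^+ i != 0)); rewrite ?expf_neq0 // -exprD subnKC // mulr1.
apply: (@simple_fraction_orbit e (e - 1)^-1 id (fun i => (lam ^+ i)^-1)
  (fun i => (lam ^+ i)^-1) ne).
- by move=> i l /invr_inj /inj.
- by move=> i; rewrite invr_eq0 expf_neq0.
move=> i; rewrite iter_fmorphV -[1](rmorph1 kappa).
have li : kappa (lam ^+ i) != 0 by rewrite fmorph_eq0 expf_neq0.
have -> : iter i s (e - kappa 1) = kappa (lam ^+ i) * (e - kappa (lam ^+ i)^-1).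
  by rewrite -rmorphN iter_rmorphD iter_const se_i mulrBr -rmorphM mulfV ?expf_neq0 // rmorphN.
by rewrite invfM fmorphV.
Qed.

(** The iterates of 1/t under s^M are 1/(t + i), with distinct poles in characteristic zero. *)
Lemma no_translation t M : (forall n, (0 < n)%N -> n%:R != 0 :> k) ->
  iter M s t = t + 1 -> False.
Proof.
move=> ch tM.
have ne c : t <> kappa c.
  move=> tc; move: tM; rewrite tc iter_const => /eqP; rewrite addrC -subr_eq subrr.
  by rewrite eq_sym oner_eq0.
apply: (@simple_fraction_orbit t t^-1 (fun i => i * M)%N (fun=> 1) (fun i => - i%:R) ne).
- move=> i l /oppr_inj; wlog il : i l / (i <= l)%N.
    by move=> W; case/orP: (leq_total i l) => il E; [apply: W|apply/esym/W].
  move=> E; apply: contrapT => nil.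
  have /negP := ch (l - i)%N (ltac:(lia)); apply.
  by rewrite natrB // E subrr.
- by move=> i; rewrite oner_eq0.
move=> i; rewrite rmorph1 mul1r iter_fmorphV; congr (_^-1); rewrite rmorphN opprK rmorph_nat.
elim: i => [|i IH]; first by rewrite addr0.
rewrite mulSn iterD IH iter_rmorphD tM -(rmorph_nat kappa) iter_const rmorph_nat.
by rewrite -addrA -natr1 [1 + _]addrC.
Qed.

(** The operator p(s) applied to u: [F] as a module over k[X]. *)
Definition pact (p : {poly k}) (u : F) := \sum_(i < size p) kappa p`_i * iter i s u.

Lemma pact_wide n (p : {poly k}) u : (size p <= n)%N ->
  pact p u = \sum_(i < n) kappa p`_i * iter i s u.
Proof.
move=> pn; rewrite /pact (big_ord_widen n (fun i => kappa p`_i * iter i s u)) //.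
rewrite big_mkcond; apply: eq_bigr => i _; case: ltnP => // ge.
by rewrite nth_default // rmorph0 mul0r.
Qed.

Lemma pactD (p q : {poly k}) u : pact (p + q) u = pact p u + pact q u.
Proof.
pose n := maxn (size p) (size q).
rewrite !(@pact_wide n) ?leq_maxl ?leq_maxr ?(leq_trans (size_polyD _ _)) //.
by rewrite -big_split; apply: eq_bigr => i _; rewrite coefD rmorphD mulrDl.
Qed.

Lemma pactZ c (p : {poly k}) u : pact (c *: p) u = kappa c * pact p u.
Proof.
rewrite (pact_wide _ (size_scale_leq _ _)) /pact mulr_sumr; apply: eq_bigr => i _.
by rewrite coefZ rmorphM mulrA.
Qed.

Lemma pactXn n u : pact 'X^n u = iter n s u.
Proof.
rewrite /pact size_polyXn (bigD1 ord_max) //= coefXn eqxx rmorph1 mul1r big1 ?addr0 //.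
by move=> i; rewrite -val_eqE coefXn /= => /negbTE ->; rewrite rmorph0 mul0r.
Qed.

Lemma pactC c u : pact c%:P u = kappa c * u.
Proof. by rewrite -[c%:P]mulr1 mul_polyC pactZ -(expr0 'X) pactXn. Qed.

Lemma pactN (p : {poly k}) u : pact (- p) u = - pact p u.
Proof. by rewrite -scaleN1r pactZ rmorphN1 mulN1r. Qed.

Lemma pact_s (p : {poly k}) u : pact p (s u) = s (pact p u).
Proof.
rewrite /pact rmorph_sum; apply: eq_bigr => i _.
by rewrite rmorphM /= s_const -iterS iterSr.
Qed.

Lemma pactMX (p : {poly k}) u : pact (p * 'X) u = pact p (s u).
Proof.
rewrite (@pact_wide (size p).+1); last first.
  by apply: leq_trans (size_polyMleq _ _) _; rewrite size_polyX addn2.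
rewrite big_ord_recl coefMX rmorph0 mul0r add0r; apply: eq_bigr => i _.
by rewrite coefMX /= -iterS iterSr.
Qed.

Lemma pactM (p q : {poly k}) u : pact (p * q) u = pact p (pact q u).
Proof.
elim/poly_ind: p u => [|p c IH] u; first by rewrite mul0r -polyC0 !pactC rmorph0 !mul0r.
rewrite mulrDl pactD pactD pactC mul_polyC pactZ; congr (_ + _).
by rewrite -mulrA ['X * q]mulrC mulrA pactMX IH pact_s pactMX.
Qed.

Lemma pact_dvd (p q : {poly k}) u : p %| q -> pact p u = 0 -> pact q u = 0.
Proof.
move=> /dvdpP [r ->] p0; rewrite pactM p0 /pact big1 // => i _.
by rewrite iter_rmorph0 mulr0.
Qed.

(* The roots of the minimal polynomial of [s] at [u] are roots of unity, so a power [t]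
   of [s] is unipotent at [u]; a nontrivial Jordan block would give [t z = z + 1]. *)
Theorem locally_algebraic_periodic u : exists2 m, (0 < m)%N & iter m s u = u.
Proof.
have [->|u0] := eqVneq u 0; first by exists 1%N; rewrite //= rmorph0.
have ann : exists n, `[< exists p : {poly k}, [/\ p != 0, size p = n & pact p u = 0] >].
  have [n /(_ id) [c [[i ilt ci] c0]]] := fd u.
  pose p := \poly_(i < n.+1) c i.
  exists (size p); apply/asboolP; exists p; split=> //.
    apply: contraNneq ci => p0; have := congr1 (fun p : {poly k} => p`_i) p0.
    by rewrite coef0 coef_poly ltnS ilt => ->.
  rewrite (pact_wide _ (size_poly _ _)) -[RHS]c0; apply: eq_bigr => l _.
  by rewrite coef_poly ltn_ord.
case: (ex_minnP ann) => n /asboolP [p [p0 sp pu]] minp.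
have [r pE] := spl p.
have roots : {in r, forall x, exists2 M, (0 < M)%N & x ^+ M = 1}.
  move=> x xr; have [q pq] : exists q, p = q * ('X - x%:P).
    rewrite pE (perm_big _ (perm_to_rem xr)) big_cons.
    by exists (lead_coef p *: \prod_(z <- rem x r) ('X - z%:P)); rewrite -scalerAl mulrC.
  have q0 : q != 0 by apply: contraNneq p0 => q0; rewrite pq q0 mul0r.
  (* By minimality of p, the vector q(s) u is nonzero, and it is an eigenvector of s for the root
     x. *)
  apply: (@eigenvalue_root_of_unity (pact q u)).
    apply/eqP => qu; have : (n <= size q)%N by apply: minp; apply/asboolP; exists q.
    by rewrite -sp pq size_Mmonic ?monicXsubC // size_XsubC addn2 ltnn.
  have := pu; rewrite pq mulrC pactM pactD pactN pactC -['X]expr1 pactXn /=.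
  by move/eqP; rewrite subr_eq0 => /eqP.
have [M M0 Mr] : exists2 M, (0 < M)%N & {in r, forall x, x ^+ M = 1}.
  elim: (r) roots => [|x r' IH] roots; first by exists 1%N.
  have [M1 M10 xM1] := roots x (mem_head _ _).
  have [|M2 M20 rM2] := IH; first by move=> y yr; apply: roots; rewrite inE yr orbT.
  exists (M1 * M2)%N; first by rewrite muln_gt0 M10.
  move=> y; rewrite inE => /predU1P [->|/rM2 yM2]; first by rewrite exprM xM1 expr1n.
  by rewrite mulnC exprM yM2 expr1n.
pose T : {poly k} := 'X^M - 1.
have pactT v : pact T v = iter M s v - v.
  by rewrite pactD pactN pactXn -polyC1 pactC rmorph1 mul1r.
have Tr : pact (T ^+ size r) u = 0.
  apply: pact_dvd pu; rewrite pE; apply: dvdp_trans (_ : \prod_(x <- r) ('X - x%:P) %| _).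
    by rewrite dvdpZl ?lead_coef_eq0.
  elim: (r) Mr => [|x r' IH] Mr; first by rewrite big_nil dvd1p.
  rewrite big_cons exprS dvdp_mul //; last by apply: IH => y yr; apply: Mr; rewrite inE yr orbT.
  by rewrite dvdp_XsubCl /root !hornerE Mr ?mem_head // subrr.
(* In characteristic q, Frobenius turns (X^M - 1)^(q^r) into X^(M q^r) - 1, and q^r is large enough
   to kill u; no Jordan block has to be excluded. *)
have [[q qch]|ch0] := pselect (exists q, q \in [pchar k]).
  have q_pr := pcharf_prime qch.
  exists (M * q ^ size r)%N; first by rewrite muln_gt0 M0 expn_gt0 prime_gt0.
  have qnat : [pchar {poly k}].-nat (q ^ size r)%N.
    rewrite (eq_pnat _ (pcharf_eq (_ : q \in [pchar {poly k}]))) ?pnatX ?pnat_id //.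
    by rewrite pchar_poly.
  have TE : T ^+ (q ^ size r) = 'X^(M * q ^ size r) - 1.
    by rewrite exprDn_pchar // exprNn_pchar // expr1n exprM.
  have : pact (T ^+ (q ^ size r)) u = 0.
    by apply: pact_dvd Tr; rewrite dvdp_exp2l // ltnW // ltn_expl // prime_gt1.
  rewrite TE pactD pactN pactXn -polyC1 pactC rmorph1 mul1r.
  by move/eqP; rewrite subr_eq0 => /eqP.
have ch n' : (0 < n')%N -> n'%:R != 0 :> k.
  by move=> n0; apply: contra_notN ch0 => /(natf0_pchar n0).
(* Nilpotency index of s^M - 1 at u. If it is at least 2, the last two vectors w, v of the chain
   satisfy s^M w = w + v and s^M v = v, so w/v is translated by 1. *)
case: (ex_minnP (ex_intro (fun i => pact (T ^+ i) u == 0) _ (introT eqP Tr))) => R' /eqP R'0 minR.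
case: R' R'0 minR => [|[|R']] R'0 minR.
- by case/eqP: u0; move: R'0; rewrite expr0 -polyC1 pactC rmorph1 mul1r.
- by exists M => //; move/eqP: R'0; rewrite expr1 pactT subr_eq0 => /eqP.
exfalso; pose w := pact (T ^+ R') u; pose v := pact T w.
have v0 : v != 0.
  by apply/negP; rewrite /v /w -pactM -exprS => /minR; rewrite ltnn.
have Mv : iter M s v = v.
  apply/eqP; rewrite -subr_eq0 -pactT /v /w -[pact T (pact (T ^+ R') u)]pactM.
  by rewrite -exprS -pactM -exprS R'0.
have Mw : iter M s w = w + v by rewrite /v pactT addrC subrK.
apply: (no_translation ch (t := w / v) (M := M)).
by rewrite iter_rmorphM iter_fmorphV Mv Mw mulrDl divff.
Qed.

End LocallyAlgebraicField.

(** * Simplicity *)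

Section Simplicity.
Variables (k : fieldType) (D A : algType k) (sigma : {lrmorphism D -> D}) (a : D).
Variables (iota : {lrmorphism D -> A}) (x y : A).
Hypothesis bij : is_alg_automorphism sigma.
Hypothesis ca : central a.
Hypothesis gwa : is_GWA sigma a iota x y.

(* D itself is a module, with x acting as sigma; x^m - 1 annihilates it. *)
Lemma finite_order_not_simple : finite_order sigma -> ~ simple_algebra A.
Proof.
move=> [m [m1 sm]] [_ simple].
have [tau [sK tK]] := inverse_automorphism bij.
have nz : 1 != 0 :> D := oner_neq0 _.
have linM (d : D) : forall (c : k) (u v : D), d * (c *: u + v) = c *: (d * u) + d * v.
  by move=> c u v; rewrite mulrDr -scalerAr.
have [phi phiE] : exists phi : {lrmorphism D -> endo nz},
    phi =1 fun d => Endo nz (linM d).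
  apply: lrmorphism_of => [c u v||u v]; apply: endoP => f /=.
  - by rewrite mulrDl -scalerAl.
  - by rewrite mul1r.
  - by rewrite mulrA.
have linX (c : k) (u v : D) : sigma (c *: u + v) = c *: sigma u + sigma v by rewrite linearP.
have linY (c : k) (u v : D) : a * tau (c *: u + v) = c *: (a * tau u) + a * tau v.
  by rewrite linearP mulrDr -scalerAr.
pose X : endo nz := Endo nz linX.
pose Y : endo nz := Endo nz linY.
have rel : GWA_relations sigma a phi X Y.
  split=> [d|e||]; rewrite ?phiE; apply: endoP => f /=.
  - by rewrite rmorphM.
  - by rewrite rmorphM /= sK !mulrA ca.
  - by rewrite sK.
  - by rewrite rmorphM /= tK.
have [g [gi gx _ _]] := (let: conj _ h := gwa in h) _ _ _ _ rel.
have ideal : two_sided_ideal (fun u => g u = 0).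
  split=> [|u v gu gv|r u gu]; first exact: rmorph0.
  - by rewrite rmorphD /= gu gv addr0.
  - by rewrite !rmorphM /= gu mulr0 mul0r.
case: (simple _ ideal) => [zero|/(_ 1)]; last by apply/eqP; rewrite rmorph1 oner_eq0.
have xm : x ^+ m - 1 = 0.
  apply: zero; rewrite rmorphB rmorphXn rmorph1 /= gx; apply/eqP; rewrite subr_eq0; apply/eqP.
  by apply: endoP => v; rewrite endo_expE /= sm.
(* In [A] itself x^m differs from 1, as their coefficients at x^m show. *)
have [cf [cfl cfE]] := GWA_coef bij ca gwa.
have := cfE m m 1; rewrite eqxx rmorph1 mul1r.
move/eqP: xm; rewrite subr_eq0 => /eqP ->.
have := cfE m 0%N 1; rewrite rmorph1 mul1r expr0 => ->.
by rewrite gtn_eqF // => /eqP; rewrite eq_sym oner_eq0.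
Qed.

Hypothesis fD : is_field D.
Hypothesis a0 : a != 0.

Let inv_iota d : d != 0 -> exists e, iota e * iota d = 1.
Proof. by case: fD => C V /V [e de]; exists e; rewrite -rmorphM C de rmorph1. Qed.

Definition x_poly n u := exists c : nat -> D, u = \sum_(i < n) iota (c i) * x ^+ i.

Lemma x_poly_subspace n : subspace (x_poly n).
Proof.
split; first by exists (fun=> 0); rewrite big1 // => i _; rewrite raddf0 mul0r.
move=> c _ _ [e ->] [f ->]; exists (fun i => c *: e i + f i).
rewrite scaler_sumr -big_split; apply: eq_bigr => i _.
by rewrite linearP mulrDl scalerAl.
Qed.

Lemma x_poly_monomial n i d : (i < n)%N -> x_poly n (iota d * x ^+ i).
Proof.
move=> ilt; exists (fun l => if l == i then d else 0).
rewrite (bigD1 (Ordinal ilt)) //= eqxx big1 ?addr0 // => l ne.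
by rewrite -val_eqE /= in ne; rewrite (negbTE ne) raddf0 mul0r.
Qed.

Lemma yx_cancel i l : (i <= l)%N -> exists d, y ^+ i * x ^+ l = iota d * x ^+ (l - i).
Proof.
have [tau [sK tK]] := inverse_automorphism bij.
elim: i l => [|i IH] [|l] //; try by exists 1; rewrite rmorph1 !mul1r.
rewrite ltnS => /IH [d de]; case: gwa => [[_ _ r3 _] _].
exists (iter i tau a * d); rewrite exprSr exprS -mulrA [y * _]mulrA r3 mulrA.
by rewrite (GWA_yd gwa tK) -mulrA de mulrA -rmorphM.
Qed.

(** As x y = sigma(a) is a unit, x has a right inverse. *)
Lemma x_regular u n : u * x ^+ n = 0 -> u = 0.
Proof.
have [e eE] : exists e, iota (sigma a) * iota e = 1.
  have sa : sigma a != 0.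
    apply: contraNneq a0 => sa; apply/eqP/(bij_inj bij); rewrite sa raddf0 //.
  by case: fD => _ /(_ _ sa) [e ae]; exists e; rewrite -rmorphM ae rmorph1.
have x1 v : v * x = 0 -> v = 0.
  move=> vx; case: gwa => [[_ _ _ r4] _].
  by rewrite -[v]mulr1 -eE -r4 !mulrA vx !mul0r.
elim: n => [|n IH]; first by rewrite expr0 mulr1.
by rewrite exprSr mulrA => /x1 /IH.
Qed.

(** A nonzero polynomial in x of least length in the ideal is shown to be a single term c x^n, and
    its factors are then stripped off. *)
Lemma infinite_order_simple : ~ finite_order sigma -> simple_algebra A.
Proof.
move=> inf; split; first exact: oner_neq0.
move=> I [I0 ID IM].
have IB u v : I u -> I v -> I (u - v).
  by move=> Iu Iv; rewrite -mulN1r; apply: ID => //; case: (IM (-1) v Iv).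
have [[u [Iu u0]]|nI] := pselect (exists u, I u /\ u <> 0); last first.
  by left=> u Iu; apply: contrapT => u0; apply: nI; exists u.
right.
pose Q n := `[< exists2 c : nat -> D, (exists2 i, (i < n)%N & c i != 0) &
                I (\sum_(i < n) iota (c i) * x ^+ i) >].
have exQ : exists n, Q n.
  have [g ug] := GWA_normal_form bij gwa u.
  (* Right multiplication by x^g absorbs all powers of y, and the product stays nonzero by
     [x_regular]. *)
  have [c cE] : x_poly (g + g).+1 (u * x ^+ g).
    apply: (bounded_GWA_min (T := fun u => x_poly (g + g).+1 (u * x ^+ g))) ug.
    - have [p0 pL] := x_poly_subspace (g + g).+1; split; first by rewrite mul0r.
      by move=> c v w pv pw; rewrite mulrDl -scalerAl; apply: pL.
    - move=> d i _ ig; rewrite -mulrA -exprD; apply: x_poly_monomial.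
      by rewrite ltnS leq_add2r.
    - move=> d i _ ig; rewrite -mulrA; have [e ->] := yx_cancel ig.
      by rewrite mulrA -rmorphM; apply: x_poly_monomial; lia.
  exists (g + g).+1; apply/asboolP; exists c; last by rewrite -cE; case: (IM (x ^+ g) u Iu).
  apply: contrapT => nc; apply: u0; apply: (@x_regular _ g); rewrite cE big1 // => i _.
  have -> : c i = 0; last by rewrite raddf0 mul0r.
  by apply/eqP; apply: contraT => ci; case: nc; exists (i : nat).
case: (ex_minnP exQ) => -[|n] /asboolP [c [i ilt ci] Ic] minn //.
(* In sigma^n(e) f - f e the term of degree n cancels, so minimality kills every other
   coefficient. *)
have small e l : (l < n)%N -> (iter n sigma e - iter l sigma e) * c l = 0.
  move=> ln; apply/eqP; apply: contraT => cl.
  suff : Q n by move/minn; rewrite ltnn.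
  apply/asboolP; exists (fun l => (iter n sigma e - iter l sigma e) * c l); first by exists l.
  have Ie : I (iota (iter n sigma e) * (\sum_(i < n.+1) iota (c i) * x ^+ i)
               - (\sum_(i < n.+1) iota (c i) * x ^+ i) * iota e).
    by apply: IB; [case: (IM (iota (iter n sigma e)) _ Ic)|case: (IM (iota e) _ Ic)].
  move: Ie; rewrite mulr_sumr mulr_suml -sumrB big_ord_recr /=.
  have E (q : nat) : iota (iter n sigma e) * (iota (c q) * x ^+ q) - iota (c q) * x ^+ q * iota e
      = iota ((iter n sigma e - iter q sigma e) * c q) * x ^+ q.
    rewrite -mulrA (GWA_xd gwa) !mulrA -!rmorphM -mulrBl -rmorphB.
    by case: fD => C _; rewrite [c q * _]C -mulrBl.
  rewrite E subrr mul0r raddf0 mul0r addr0.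
  by under eq_bigr do rewrite E.
have cl0 l : (l < n)%N -> c l = 0.
  move=> ln; apply/eqP; apply: contraT => cl; case: inf; exists (n - l)%N.
  split; first by rewrite subn_gt0.
  move=> e; case: fD => _ V; have [f cf] := V _ cl.
  have := congr1 (fun w => w * f) (small e l ln); rewrite -mulrA cf mulr1 mul0r => /eqP.
  rewrite subr_eq0 -{1}(subnKC (ltnW ln)) iterD => /eqP.
  by move: (iter (n - l) sigma e) => w; elim: (l) => //= l' IH /(bij_inj bij).
have cn : c n != 0.
  move: ilt ci; rewrite ltnS leq_eqVlt => /predU1P [->//|/cl0 ->].
  by rewrite eqxx.
have Ixn : I (x ^+ n).
  have := Ic; rewrite big_ord_recr /= big1 ?add0r => [Icn|l _]; last first.
    by rewrite cl0 // raddf0 mul0r.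
  have [e ec] := inv_iota cn.
  by have [+ _] := IM (iota e) _ Icn; rewrite mulrA ec mul1r.
(* Since y x = a is a unit, left multiplication by y removes the factors x from x^n one at a
   time. *)
have I1 : I 1.
  case: gwa => [[_ _ r3 _] _]; have [e ea] := inv_iota a0.
  elim: (n) Ixn => // m IH Ixm; apply: IH.
  have [+ _] := IM (iota e * y) _ Ixm.
  by rewrite exprS -mulrA [y * _]mulrA r3 mulrA ea mul1r.
by move=> v; have [+ _] := IM v _ I1; rewrite mulr1.
Qed.

End Simplicity.

(** * Coordinate frames *)

(* An embedding of D into a field F, carrying a valuation with residue field k under
   which the monomials in z_1, ..., z_d have distinct values. *)
Record frame (k : fieldType) (D : algType k) (d : nat) := Frame {
  fr_field : fieldType;
  fr_const : {rmorphism k -> fr_field};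
  fr_emb : {rmorphism D -> fr_field};
  fr_var : 'I_d -> D;
  fr_val : fr_field -> Prop;
  fr_inj : injective fr_emb;
  fr_scale : forall c u, fr_emb (c *: u) = fr_const c * fr_emb u;
  fr_valP : valuation_ring fr_val;
  fr_val_const : forall c, fr_val (fr_const c);
  fr_residue : forall u, fr_val u -> exists c, small fr_val (u - fr_const c);
  fr_mon_neq0 : forall b, TranscendenceBases.monomial (fun i => fr_emb (fr_var i)) b != 0;
  fr_mon_sim : forall b b',
    sim fr_val (TranscendenceBases.monomial (fun i => fr_emb (fr_var i)) b)
      (TranscendenceBases.monomial (fun i => fr_emb (fr_var i)) b') -> b =1 b';
  fr_growth : growth_le D d }.

Module FrameConstruction.
Import mpoly TranscendenceBases.

Lemma frame_of_transcendence_basis (k : fieldType) (D : algType k) (F : fieldType)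
    (kappa : {rmorphism k -> F}) (j : {rmorphism D -> F}) (d : nat) (z : 'I_d -> D) :
  injective j -> (forall c u, j (c *: u) = kappa c * j u) ->
  alg_indep kappa (fun i => j (z i)) ->
  (forall u, algebraic kappa (fun i => j (z i)) u) ->
  (forall u, is_fraction kappa (fun i => j (z i)) u) \/ splits_over k ->
  inhabited (frame D d).
Proof.
move=> j_inj jZ ind alg res.
have [|O [vO Ok rO mO]] := monomial_valuation ind; first by case: res; [left|right].
constructor; apply: (@Frame k D d F kappa j z O) => //.
  by move=> b; apply: monomial_neq0 ind b.
by apply: (frame_growth_le j_inj jZ) => us; apply: (algebraic_growth ind) => v _.
Qed.

Lemma frame_between (k : fieldType) (n : nat) (D : algType k) :
  between_poly_and_fractions n D -> inhabited (frame D n).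
Proof.
move=> [j [j_inj jZ jP]].
have [kappa kE] : exists kappa : {rmorphism k -> MP.Qn k n}, kappa =1 @MP.cst k n.
  have h1 : zmod_morphism (@MP.cst k n).
    by move=> c c'; rewrite /MP.cst mpolyCB tofracB.
  have h2 : monoid_morphism (@MP.cst k n).
    by split=> [|c c']; rewrite /MP.cst ?mpolyC1 ?tofrac1 // mpolyCM tofracM.
  pose m1 := GRing.isZmodMorphism.Build _ _ _ h1.
  pose m2 := GRing.isMonoidMorphism.Build _ _ _ h2.
  by exists (HB.pack (@MP.cst k n) m1 m2 : {rmorphism k -> MP.Qn k n}).
have /choice [z zE] : forall i : 'I_n, exists d : D, j d = tofrac ('X_i : {mpoly k[n]}).
  by move=> i; apply: jP.
have evE p : mmap kappa (fun i => j (z i)) p = tofrac p.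
  rewrite [in RHS](mpolyE p) rmorph_sum; apply: eq_bigr => m _ /=.
  rewrite -mul_mpolyC tofracM kE /MP.cst; congr (_ * _).
  rewrite mpolyXE_id rmorph_prod; apply: eq_bigr => i _.
  by rewrite zE /= tofracXn.
have ind : alg_indep kappa (fun i => j (z i)).
  by move=> p; rewrite evE => /eqP; rewrite tofrac_eq0 => /eqP.
have frac u : is_fraction kappa (fun i => j (z i)) u.
  by have [p [q [q0 uE]]] := fractionP u; exists p, q; rewrite !evE.
apply: (@frame_of_transcendence_basis k D _ kappa j n z) => //; last by left.
  by move=> c u; rewrite jZ kE.
move=> u; have [p [q [q0 uE]]] := frac u.
exists (q *: 'X - p%:P).
  apply: contraNneq q0 => /(congr1 (fun P : {poly {mpoly k[n]}} => P`_1)).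
  by rewrite coefB coefZ coefX coefC mulr1 subr0 coef0 => ->.
rewrite rmorphB /= map_polyZ map_polyX map_polyC /= hornerD hornerN hornerZ hornerX hornerC.
by rewrite uE mulrC divfK ?subrr // ev_eq0.
Qed.

End FrameConstruction.

(** * Algebras that are fields *)

Section FieldOfAlgebra.
Variables (k : fieldType) (D : algType k).

(** The alias carries the proof that [D] is a field, so that a field structure can be attached to
    it. *)
Definition field_of (fD : is_field D) : Type := D.
Variable fD : is_field D.

HB.instance Definition _ := GRing.NzRing.copy (field_of fD) D.
Lemma field_of_mulC : commutative (@GRing.mul (field_of fD)).
Proof. by case: fD. Qed.
HB.instance Definition _ := GRing.PzRing_hasCommutativeMul.Build (field_of fD) field_of_mulC.

Lemma field_of_inv_ex (u : field_of fD) :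
  exists v : field_of fD, (u != 0 -> v * u = 1) /\ (u = 0 -> v = 0).
Proof.
have [u0|u0] := eqVneq u 0; first by exists 0.
have [v uv] := proj2 fD u u0; exists v; split=> [_|e]; first by rewrite field_of_mulC.
by case/eqP: u0.
Qed.

Definition field_of_inv (u : field_of fD) := projT1 (cid (field_of_inv_ex u)).
Lemma field_of_mulV u : u != 0 -> field_of_inv u * u = 1.
Proof. by rewrite /field_of_inv; case: cid => v /= [h h0] /h. Qed.
Lemma field_of_inv0 : field_of_inv 0 = 0.
Proof. by rewrite /field_of_inv; case: cid => v /= [h h0]; apply: h0. Qed.
HB.instance Definition _ :=
  GRing.ComNzRing_isField.Build (field_of fD) field_of_mulV field_of_inv0.

Lemma field_of_emb : exists j : {rmorphism D -> field_of fD}, j =1 id.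
Proof.
have h1 : zmod_morphism (id : D -> field_of fD) by [].
have h2 : monoid_morphism (id : D -> field_of fD) by [].
pose m1 := GRing.isZmodMorphism.Build _ _ _ h1.
pose m2 := GRing.isMonoidMorphism.Build _ _ _ h2.
by exists (HB.pack (id : D -> field_of fD) m1 m2 : {rmorphism D -> field_of fD}).
Qed.

End FieldOfAlgebra.

Section FieldCase.
Variables (k : fieldType) (D : algType k).
Hypothesis fD : is_field D.
Hypothesis fg : fg_field_over_k D.
Hypothesis spl : TranscendenceBases.splits_over k.

Lemma field_embedding : exists (F : fieldType) (kappa : {rmorphism k -> F})
  (j : {rmorphism D -> F}), [/\ bijective j, forall c, kappa c = j (c%:A) &
    forall c u, j (c *: u) = kappa c * j u].
Proof.
have [j jE] := field_of_emb fD.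
exists (field_of fD : fieldType).
exists (j \o in_alg D : {rmorphism k -> field_of fD}), j.
split=> // [|c u] /=; first by exists id => u; rewrite jE.
by rewrite -rmorphM -scalerAl mul1r.
Qed.

(** The elements algebraic over a transcendence basis chosen among the generators form a subfield
    containing all generators. *)
Lemma frame_field : exists d, inhabited (frame D d).
Proof.
have [F [kappa [j [[j' jK jK'] kE jZ]]]] := field_embedding.
have [gs gsP] := fg.
have [d [z [ind zgs alg]]] :=
  TranscendenceBases.transcendence_basis kappa [seq j g | g <- gs].
have [aC aD aM aV] := TranscendenceBases.algebraic_field ind.
have allD u : TranscendenceBases.algebraic kappa z (j u).
  apply: (gsP (fun u => TranscendenceBases.algebraic kappa z (j u))).
    split=> [c|v w av aw|v w av aw|v e av ve].
    - by rewrite -kE; apply: aC.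
    - by rewrite rmorphD; apply: aD.
    - by rewrite rmorphM; apply: aM.
    - have -> : j e = (j v)^-1; last exact: aV.
      have jve : j v * j e = 1 by rewrite -rmorphM ve rmorph1.
      have v0 : j v != 0 by apply: contraTneq (oner_neq0 F) => v0; rewrite -jve v0 mul0r eqxx.
      by apply: (mulfI v0); rewrite jve divff.
  by move=> g ggs; apply: alg; rewrite map_f.
have zE : z = (fun i => j (j' (z i))) by apply/funext => i; rewrite jK'.
exists d; apply: (FrameConstruction.frame_of_transcendence_basis
  (kappa := kappa) (j := j) (z := fun i => j' (z i))) => //.
- exact: can_inj jK.
- by rewrite -zE.
- by move=> u; rewrite -zE -[u]jK'.
- by right.
Qed.

(** Every element is periodic. If [M] is a common period of the generators, the fixed points of
    sigma^M form a subfield containing them. *)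
Lemma locally_algebraic_finite_order (sigma : {lrmorphism D -> D}) :
  locally_algebraic sigma -> finite_order sigma.
Proof.
move=> la.
have [F [kappa [j [[j' jK jK'] kE jZ]]]] := field_embedding.
pose s u := j (sigma (j' u)).
have j'D u v : j' (u + v) = j' u + j' v by apply: (can_inj jK); rewrite rmorphD !jK'.
have j'B u v : j' (u - v) = j' u - j' v by apply: (can_inj jK); rewrite rmorphB /= !jK'.
have j'M u v : j' (u * v) = j' u * j' v by apply: (can_inj jK); rewrite rmorphM /= !jK'.
have j'1 : j' 1 = 1 by apply: (can_inj jK); rewrite rmorph1 !jK'.
have sB : zmod_morphism s by move=> u v; rewrite /s j'B !rmorphB.
have sM : monoid_morphism s by split=> [|u v]; rewrite /s ?j'1 ?rmorph1 // j'M !rmorphM.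
pose m1 := GRing.isZmodMorphism.Build _ _ s sB.
pose m2 := GRing.isMonoidMorphism.Build _ _ s sM.
pose S : {rmorphism F -> F} := HB.pack s m1 m2.
have SE i u : iter i S (j u) = j (iter i sigma u).
  by elim: i => //= i ->; rewrite /s jK.
have Sc c : S (kappa c) = kappa c by rewrite kE /= /s jK linearZ /= rmorph1.
have fd (u : F) : exists n, forall g : nat -> nat, exists c : nat -> k,
    (exists2 i, (i <= n)%N & c i != 0) /\ \sum_(i < n.+1) kappa (c i) * iter (g i) S u = 0.
  have [us [usu [st _]]] := la [:: j' u].
  have orb i : in_span us (iter i sigma (j' u)).
    by elim: i => [|i IH] /=; [apply: usu; rewrite mem_head|apply: st].
  exists (size us) => g; pose t := mkseq (fun i => iter (g i) sigma (j' u)) (size us).+1.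
  have /lin_freeP nf : ~ lin_free t.
    move=> ft; have := steinitz ft (s := us); rewrite size_mkseq ltnn.
    move=> h; have tus : {in t, forall v, in_span us v}.
      by move=> v /mapP [i _ ->]; apply: orb.
    by have := h tus.
  have [c [c0 [i ilt ci]]] : exists c : nat -> k, \sum_(i < size t) c i *: t`_i = 0 /\
      exists2 i, (i < size t)%N & c i != 0.
    apply: contrapT => h; apply: nf => c c0 i ilt; apply/eqP; apply: contraT => ci.
    by case: h; exists c; split=> //; exists i.
  rewrite size_mkseq in c0 ilt; exists c; split; first by exists i.
  rewrite -[RHS](rmorph0 j) -[in RHS]c0 rmorph_sum; apply: eq_bigr => l _ /=.
  by rewrite jZ nth_mkseq // -[in LHS](jK' u) SE.
have per u : exists m, (0 < m)%N /\ iter m sigma u = u.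
  have [m m0 mu] := locally_algebraic_periodic Sc spl fd (j u).
  by exists m; split=> //; apply: (can_inj jK); rewrite -SE.
have iterX m n u : iter m sigma u = u -> iter (m * n) sigma u = u.
  by move=> mu; elim: n => [|n IH]; rewrite ?muln0 // mulnS iterD IH.
have [gs gsP] := fg.
have [M [M0 gsM]] : exists M, (0 < M)%N /\ {in gs, forall g, iter M sigma g = g}.
  elim: (gs) => [|g l [M [M0 lM]]]; first by exists 1%N.
  have [m [m0 gm]] := per g; exists (m * M)%N; split; first by rewrite muln_gt0 m0.
  move=> g'; rewrite inE => /predU1P [->|/lM g'M]; first exact: iterX.
  by rewrite mulnC; apply: iterX.
exists M; split=> //.
have iterR i : [/\ forall c : k, iter i sigma c%:A = c%:A,
    forall u v, iter i sigma (u + v) = iter i sigma u + iter i sigma v &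
    forall u v, iter i sigma (u * v) = iter i sigma u * iter i sigma v].
  elim: i => [|i [h1 h2 h3]] //; split=> [c|u v|u v] /=.
  - by rewrite h1 linearZ /= rmorph1.
  - by rewrite h2 rmorphD.
  - by rewrite h3 rmorphM.
have [h1 h2 h3] := iterR M.
apply: (gsP (fun d => iter M sigma d = d)) => //; split=> //.
- by move=> u v eu ev; rewrite h2 eu ev.
- by move=> u v eu ev; rewrite h3 eu ev.
- move=> u e eu ue; have ue' : u * iter M sigma e = 1.
    by rewrite -{1}eu -h3 ue; have := h1 1; rewrite scale1r.
  case: (fD) => C _; rewrite -[LHS]mul1r -ue -mulrA [e * _]C mulrA ue' mul1r //.
Qed.

(** The translates of [vs] over one period span a stable space, and sigma^(m-1) inverts sigma on
    it. *)
Lemma finite_order_locally_algebraic (sigma : {lrmorphism D -> D}) :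
  finite_order sigma -> locally_algebraic sigma.
Proof.
move=> [m [m1 sm]] vs; exists (orbit_list sigma vs m).
have st u : in_span (orbit_list sigma vs m) u -> in_span (orbit_list sigma vs m) (sigma u).
  apply: (in_span_min (S := fun u => in_span (orbit_list sigma vs m) (sigma u))).
    split; first by rewrite raddf0; case: (in_span_subspace (orbit_list sigma vs m)).
    move=> c v w sv sw; rewrite linearP.
    by case: (in_span_subspace (orbit_list sigma vs m)) => _; apply.
  move=> _ /orbit_listP [i [v [ilt vvs ->]]]; apply/in_span_mem/orbit_listP.
  move: ilt; rewrite leq_eqVlt => /predU1P [e|ilt]; last by exists i.+1, v.
  by exists 0%N, v; rewrite -iterS e sm.
split; first by move=> v vvs; apply/in_span_mem/orbit_listP; exists 0%N, v.
split=> // u usu; exists (iter m.-1 sigma u); split; last by rewrite -iterS prednK.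
by elim: (m.-1) => //= i IH; apply: st.
Qed.

End FieldCase.

From mathcomp Require Import all_classical all_reals all_analysis Rstruct.
From mathcomp Require Import lra.

(** * Gelfand-Kirillov dimension from polynomial bounds *)

Section LimSup.
Variable R : realType.
Implicit Types (f : nat -> \bar R) (l : \bar R).

Lemma limn_esup_le_eventually f l :
  (exists N, forall n, (N <= n)%N -> (f n <= l)%E) -> (limn_esup f <= l)%E.
Proof.
move=> [N fN]; apply: (@le_trans _ _ (ereal_sup (f @` [set n | (N <= n)%N])%classic)).
  by apply: ereal_inf_lbound; exists [set n | (N <= n)%N]%classic => //; exact: nbhs_infty_ge.
by apply: ge_ereal_sup => _ [n /= Nn <-]; apply: fN.
Qed.

Lemma limn_esup_ge_frequently f l :
  (forall N, exists2 n, (N <= n)%N & (l <= f n)%E) -> (l <= limn_esup f)%E.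
Proof.
move=> fN; apply: le_ereal_inf_tmp => _ [V [N _ NV] <-].
have [n Nn ln] := fN N; apply: le_trans ln _; apply: ereal_sup_ubound.
by exists n => //; apply: NV.
Qed.

Lemma ln_nat_unbounded (T : R) : exists N, forall n, (N <= n)%N -> T <= ln n%:R.
Proof.
exists (Num.truncn (expR T)).+1 => n Nn; rewrite -[T]expRK ler_ln ?posrE ?expR_gt0 //.
  by apply: le_trans (ltW (truncnS_gt _)) _; rewrite ler_nat.
by rewrite ltr0n; apply: leq_trans Nn.
Qed.

Lemma ln_nat_ge0 (n : nat) : 0 <= ln n%:R :> R.
Proof.
by case: n => [|n]; [rewrite ln0|rewrite ln_ge0 // ler1n].
Qed.

Lemma ler_ln_nat (m n : nat) : (m <= n)%N -> ln m%:R <= ln n%:R :> R.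
Proof.
case: m => [|m] mn; first by rewrite [ln 0%:R]ln0 ?ln_nat_ge0.
by rewrite ler_ln ?posrE ?ltr0n // ?ler_nat //; apply: leq_trans mn.
Qed.

Lemma ln_natM (m n : nat) : (0 < m)%N -> (0 < n)%N -> ln (m * n)%:R = ln m%:R + ln n%:R :> R.
Proof. by move=> m0 n0; rewrite natrM lnM // posrE ltr0n. Qed.

Lemma ln_natX (m e : nat) : (0 < m)%N -> ln (m ^ e)%:R = e%:R * ln m%:R :> R.
Proof. by move=> m0; rewrite natrX lnXn ?ltr0n // mulr_natl. Qed.

End LimSup.

Section GKdim.
Variables (k : fieldType) (B : algType k).
Local Notation R := Rdefinitions.R.

Lemma GKdim_le e : growth_le B e -> (GKdim B <= e%:R%:E)%E.
Proof.
move=> gr; apply: ge_ereal_sup => _ [vs _ <-].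
have [C CP] := gr vs.
apply/lee_addgt0Pr => eps eps0; apply: limn_esup_le_eventually.
(* C (n+1)^e is at most (C+1) (2n)^e, whose logarithm is K + e ln n; K is at most eps ln n once n is
   large. The successor of C keeps the logarithm additive when C = 0. *)
pose K : R := ln C.+1%:R + e%:R * ln 2%:R.
have [N NP] := ln_nat_unbounded (Num.max 1 (K / eps)).
exists (maxn N 1) => n; rewrite geq_max => /andP [Nn n1].
have := NP n Nn; rewrite ge_max => /andP [ln1 lnK].
have ln0 : 0 < ln n%:R :> R by apply: lt_le_trans ln1.
rewrite /GK_growth lee_fin ler_pdivrMr //.
have h : (span_dim (words_upto vs n) <= C.+1 * (2 * n) ^ e)%N.
  apply: leq_trans (CP n) _; apply: leq_mul => //.
  by case: (e) => [|e'] //; rewrite leq_exp2r //; lia.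
apply: le_trans (ler_ln_nat _ h) _.
rewrite ln_natM ?expn_gt0 ?muln_gt0 ?n1 // ln_natX ?muln_gt0 // ln_natM //.
have : K <= ln n%:R * eps by rewrite -ler_pdivrMr.
rewrite /K; lra.
Qed.

(** Fractional exponents are allowed because the growth of a non locally algebraic case is p/q with
    q = d + 1. An upper limit needs the bound only for arbitrarily large m, and the constants [C]
    and [c] vanish after division by the logarithm. *)
Lemma GKdim_ge (vs : seq B) (C c p q : nat) : (0 < C)%N -> (0 < c)%N -> (0 < q)%N ->
  (forall N, exists2 m, (N <= m)%N &
    (m ^ p <= C * span_dim (words_upto vs (c * m)) ^ q)%N) ->
  ((p%:R / q%:R)%:E <= GKdim B)%E.
Proof.
move=> C0 c0 q0 fr; apply: (@le_trans _ _ (limn_esup (GK_growth vs))); last first.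
  by apply: ereal_sup_ubound; exists vs.
apply/lee_subgt0Pr => eps eps0; apply: limn_esup_ge_frequently => N.
have q0R : 0 < q%:R :> R by rewrite ltr0n.
pose K : R := ln C%:R + p%:R * ln c%:R.
have [N' N'P] := ln_nat_unbounded (Num.max 1 (K / (q%:R * eps))).
have [m] := fr (maxn (maxn N N') 1); rewrite !geq_max -andbA => /and3P [Nm N'm m0] mp.
exists (c * m)%N; first by apply: leq_trans Nm _; rewrite leq_pmull.
have := N'P m N'm; rewrite ge_max => /andP [ln1 lnK].
have lnm0 : 0 < ln m%:R :> R by apply: lt_le_trans ln1.
have lnc0 : 0 <= ln c%:R :> R by apply: ln_nat_ge0.
have lncm : ln (c * m)%:R = ln c%:R + ln m%:R :> R by rewrite ln_natM.
rewrite /GK_growth -EFinD lee_fin ler_pdivlMr; last by rewrite lncm; lra.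
set S := span_dim _ in mp *.
have S0 : (0 < S)%N.
  rewrite lt0n; apply/eqP => S0; move: mp; rewrite S0 exp0n // muln0 leqn0.
  by rewrite expn_eq0 -[m]prednK.
have mp' : p%:R * ln m%:R <= ln C%:R + q%:R * ln S%:R :> R.
  have := ler_ln_nat R mp; rewrite ln_natX // ln_natM ?expn_gt0 ?S0 //.
  by rewrite ln_natX.
have K' : K <= ln m%:R * (q%:R * eps) by rewrite -ler_pdivrMr // mulr_gt0.
rewrite lncm -(ler_pM2l q0R) mulrA mulrBr mulrCA divff ?mulr1; last by rewrite gt_eqF.
have : 0 <= q%:R * eps * ln c%:R by rewrite !mulr_ge0 ?(ltW q0R) ?(ltW eps0).
by rewrite /K in K'; nra.
Qed.

End GKdim.

Section FrameGKdim.
Variables (k : fieldType) (D A : algType k) (d : nat) (fr : frame D d).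
Variables (sigma : {lrmorphism D -> D}) (a : D) (iota : {lrmorphism D -> A}) (x y : A).
Hypothesis bij : is_alg_automorphism sigma.
Hypothesis ca : central a.
Hypothesis gwa : is_GWA sigma a iota x y.
Local Notation R := Rdefinitions.R.

Lemma frame_GKdim : GKdim D = d%:R%:E.
Proof.
apply/eqP; rewrite eq_le (GKdim_le (fr_growth fr)) /=.
have [W WP] := frame_growth_ge (@fr_scale _ _ _ fr) (fr_valP fr) (@fr_val_const _ _ _ fr)
  (@fr_mon_neq0 _ _ _ fr) (@fr_mon_sim _ _ _ fr).
have -> : d%:R%:E = (d%:R / 1%:R)%:E :> \bar R by rewrite divr1.
apply: (@GKdim_ge _ _ W 1 d.+1) => // N; exists N => //.
by rewrite mul1n expn1.
Qed.

Lemma frame_GKdim_GWA_ge : (d.+1%:R%:E <= GKdim A)%E.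
Proof.
have [W WP] := GWA_growth_ge (@fr_scale _ _ _ fr) (fr_valP fr) (@fr_val_const _ _ _ fr)
  (@fr_mon_neq0 _ _ _ fr) (@fr_mon_sim _ _ _ fr) bij ca gwa.
have -> : d.+1%:R%:E = (d.+1%:R / 1%:R)%:E :> \bar R by rewrite divr1.
apply: (@GKdim_ge _ _ W 1 d.+1) => // N; exists N => //.
by rewrite mul1n expn1.
Qed.

(* With n = h (2h+1)^d <= 3^d h^(d+1), the bound h n^(d+1) <= dim W_((d+3)n) has exponent
   d + 1 + 1/(d+1) in n. *)
Lemma frame_GKdim_GWA_gt : ~ locally_algebraic sigma -> (d.+1%:R%:E < GKdim A)%E.
Proof.
move=> nla.
have [W WP] := GWA_growth_big (@fr_inj _ _ _ fr) (@fr_scale _ _ _ fr) (fr_valP fr)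
  (@fr_val_const _ _ _ fr) (@fr_residue _ _ _ fr) (@fr_mon_neq0 _ _ _ fr)
  (@fr_mon_sim _ _ _ fr) bij ca gwa nla.
apply: (@lt_le_trans _ _ ((d.+1 ^ 2).+1%:R / d.+1%:R)%:E).
  rewrite lte_fin ltr_pdivlMr ?ltr0n // -natrM ltr_nat; lia.
apply: (@GKdim_ge _ _ W (3 ^ d) (d + 3)) => //; rewrite ?expn_gt0 ?addn3 //.
move=> N; exists (spread_size d N.+1).
  by apply: leq_trans (leqnSn _) _; rewrite leq_pmulr // expn_gt0.
set n := spread_size d N.+1; set S := span_dim _.
have hS : (N.+1 * n ^ d.+1 <= S)%N by rewrite /S -addn3; apply: WP.
have nh : (n <= 3 ^ d * N.+1 ^ d.+1)%N.
  rewrite expnS mulnCA -expnMn leq_mul2l leq_expn_base ?orbT //; lia.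
(* With h = N + 1: n^((d+1)^2 + 1) = n (n^(d+1))^(d+1) <= 3^d (h n^(d+1))^(d+1) <= 3^d S^(d+1). *)
rewrite expnS; apply: leq_trans (leq_mul nh (leqnn _)) _.
rewrite -mulnA leq_mul2l; apply/orP; right.
by rewrite -mulnn expnM -expnMn leq_expn_base.
Qed.

Theorem frame_GKdim_GWA : GKdim A = (GKdim D + 1)%E <-> locally_algebraic sigma.
Proof.
have E : (GKdim D + 1)%E = d.+1%:R%:E by rewrite frame_GKdim -EFinD natr1.
rewrite E; split=> [e|la].
  by apply: contrapT => /frame_GKdim_GWA_gt; rewrite e ltxx.
apply/eqP; rewrite eq_le frame_GKdim_GWA_ge andbT; apply: GKdim_le.
exact: (GWA_growth_le bij gwa la (fr_growth fr)).
Qed.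

End FrameGKdim.

Theorem theorem0p1 :
  (* (1) P_n <= D <= Q_n : (a) <-> (b) *)
  (forall (k : fieldType) (n : nat) (D : algType k) (sigma : {lrmorphism D -> D})
      (a : D) (A : algType k) (iota : {lrmorphism D -> A}) (x y : A),
    is_alg_automorphism sigma -> central a -> is_GWA sigma a iota x y ->
    between_poly_and_fractions n D ->
    (GKdim A = (GKdim D + 1)%E <-> locally_algebraic sigma)) /\
  (* (2) k algebraically closed, D a finitely generated field extension of k, a <> 0 :
     (a), (b), (c), (d) are equivalent *)
  (forall (k : closedFieldType) (D : algType k) (sigma : {lrmorphism D -> D})
      (a : D) (A : algType k) (iota : {lrmorphism D -> A}) (x y : A),
    is_alg_automorphism sigma -> central a -> is_GWA sigma a iota x y ->
    is_field D -> fg_field_over_k D -> a != 0 ->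
    [<-> GKdim A = (GKdim D + 1)%E;
         locally_algebraic sigma;
         finite_order sigma;
         ~ simple_algebra A]).
Proof.
split=> [k n D sigma a A iota x y bij ca gwa|k D sigma a A iota x y bij ca gwa fD fg a0].
  by move=> /FrameConstruction.frame_between [fr]; apply: (frame_GKdim_GWA fr bij ca gwa).
have spl : TranscendenceBases.splits_over k.
  by move=> p; have [r rE] := closed_field_poly_normal p; exists r.
have [d [fr]] := frame_field fD fg spl.
have ab := frame_GKdim_GWA fr bij ca gwa.
tfae.
- by move/ab.
- exact: locally_algebraic_finite_order.
- exact: finite_order_not_simple gwa.
- move=> ns; apply/ab/finite_order_locally_algebraic; apply: contrapT => inf.
  by apply: ns; apply: infinite_order_simple gwa fD a0 inf.
Qed.
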